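(* Let $X$ be a smooth vector field on a complete, noncompact, oriented Riemannian manifold $M^n$, such that $\mathrm{div}_M X$ does not change sign on $M$ (that is, $\mathrm{div}_MX\ge 0$ everywhere on $M$ or $\mathrm{div}_MX\leq 0$ everywhere on $M$). If $|X|\in\mathcal L^1(M)$, then $\mathrm{div}_M X=0$ on $M$.
   Context: $\mathcal L^1(M)$ is the space of Lebesgue integrable functions on $M$ with respect to the Riemannian volume measure; $\mathrm{div}_M$ is the Riemannian divergence. *)

(* Defs.v *)
From mathcomp Require Import all_boot all_order all_algebra.
From mathcomp Require Import all_classical all_reals all_analysis.

Set Implicit Arguments.
Unset Strict Implicit.
Unset Printing Implicit Defensive.

Import Order.TTheory GRing.Theory Num.Theory.
Import numFieldNormedType.Exports.

Local Open Scope classical_set_scope.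
Local Open Scope ring_scope.

(* Convention: tangent vectors in coordinates are row vectors, on which a
   Jacobian matrix acts on the right (as in [jacobian] of derive.v). *)

Definition partial (R : realType) (n : nat) (W : normedModType R)
    (k : 'I_n) (f : 'rV[R]_n -> W) : 'rV[R]_n -> W :=
  fun x => 'D_(delta_mx 0 k) f x.

Fixpoint Ck_on (R : realType) (n : nat) (W : normedModType R) (k : nat)
    (U : set 'rV[R]_n) (f : 'rV[R]_n -> W) : Prop :=
  (forall x, U x -> {for x, continuous f}) /\
  if k is k'.+1 then
    forall i : 'I_n,
      (forall x, U x -> derivable f x (delta_mx 0 i)) /\
      Ck_on k' U (partial i f)
  else True.

Definition smooth_on (R : realType) (n : nat) (W : normedModType R)
    (U : set 'rV[R]_n) (f : 'rV[R]_n -> W) : Prop :=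
  forall k, Ck_on k U f.

(* The orientation is carried by the atlas: all its transition maps preserve
   the orientation of R^n.  [coord i] and [param i] are total functions, but
   only their restrictions to [dom i] and [coord i @` dom i] are meaningful. *)
Record oriented_manifold (R : realType) (n : nat) := OrientedManifold {
  carrier :> ptopologicalType ;
  manifold_hausdorff : hausdorff_space carrier ;
  manifold_second_countable : @second_countable carrier ;
  chart : Type ;
  dom : chart -> set carrier ;
  coord : chart -> carrier -> 'rV[R]_n ;
  param : chart -> 'rV[R]_n -> carrier ;
  dom_open : forall i, open (dom i) ;
  codom_open : forall i, open (coord i @` dom i) ;
  coordK : forall i p, dom i p -> param i (coord i p) = p ;
  coord_continuous : forall i p, dom i p -> {for p, continuous (coord i)} ;
  param_continuous : forall i x, (coord i @` dom i) x ->
    {for x, continuous (param i)} ;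
  dom_cover : forall p, exists i, dom i p ;
  transition_smooth : forall i j,
    smooth_on (coord i @` (dom i `&` dom j)) (coord j \o param i) ;
  transition_oriented : forall i j x, (coord i @` (dom i `&` dom j)) x ->
    0 < \det (jacobian (coord j \o param i) x)
}.

Section Manifold.
Context (R : realType) (n : nat) (M : oriented_manifold R n).

Definition codom (i : chart M) : set 'rV[R]_n := @coord R n M i @` dom i.

Definition overlap (i j : chart M) : set 'rV[R]_n :=
  @coord R n M i @` (dom i `&` dom j).

Definition transition (i j : chart M) : 'rV[R]_n -> 'rV[R]_n :=
  coord j \o param i.

Definition chart_at (p : M) : chart M := projT1 (cid (dom_cover p)).

(* A smooth (0,2)-tensor field given by its matrices in the charts. *)
Record riemannian_metric := RiemannianMetric {
  metric_mx :> chart M -> 'rV[R]_n -> 'M[R]_n ;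
  metric_smooth : forall i, smooth_on (codom i) (metric_mx i) ;
  metric_sym : forall i x, codom i x -> (metric_mx i x)^T = metric_mx i x ;
  metric_pos : forall i x (v : 'rV[R]_n), codom i x -> v != 0 ->
    0 < (v *m metric_mx i x *m v^T) 0 0 ;
  metric_compat : forall i j x, overlap i j x ->
    metric_mx i x = jacobian (transition i j) x
                    *m metric_mx j (transition i j x)
                    *m (jacobian (transition i j) x)^T
}.

Record vector_field := VectorField {
  field_comp :> chart M -> 'rV[R]_n -> 'rV[R]_n ;
  field_smooth : forall i, smooth_on (codom i) (field_comp i) ;
  field_compat : forall i j x, overlap i j x ->
    field_comp j (transition i j x) =
    field_comp i x *m jacobian (transition i j) x
}.

Section Riemannian.
Variable g : riemannian_metric.

Definition local_norm (i : chart M) (x v : 'rV[R]_n) : R :=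
  Num.sqrt ((v *m g i x *m v^T) 0 0).

Definition field_norm (X : vector_field) (p : M) : R :=
  let i := chart_at p in local_norm i (coord i p) (X i (coord i p)).

(* [christoffel i k a b x] is Gamma^k_{ab}, in the chart i, of the Levi-Civita
   connection. *)
Definition christoffel (i : chart M) (k a b : 'I_n) (x : 'rV[R]_n) : R :=
  2^-1 * \sum_(l < n) invmx (g i x) k l *
    (partial a (fun y => g i y b l) x
     + partial b (fun y => g i y a l) x
     - partial l (fun y => g i y a b) x).

(* The matrix of v |-> nabla_v X in the chart i. *)
Definition covariant_derivative (X : vector_field) (i : chart M)
    (x : 'rV[R]_n) : 'M[R]_n :=
  \matrix_(a < n, k < n)
    (partial a (fun y => X i y 0 k) x
     + \sum_(b < n) christoffel i k a b x * X i x 0 b).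

Definition divergence (X : vector_field) (p : M) : R :=
  let i := chart_at p in \tr (covariant_derivative X i (coord i p)).

Definition C1_curve (c : R -> M) : Prop :=
  continuous c /\
  forall (i : chart M) (t : R), dom i (c t) ->
    derivable (coord i \o c) t 1 /\
    {for t, continuous (derive1 (coord i \o c))}.

Definition speed (c : R -> M) (t : R) : R :=
  let i := chart_at (c t) in
  local_norm i (coord i (c t)) (derive1 (coord i \o c) t).

(* [joined p q l]: some piecewise C^1 curve from p to q has length l. *)
Inductive joined (p : M) : M -> \bar R -> Prop :=
| joined_refl : joined p p 0%E
| joined_arc (c : R -> M) (a b : R) (l : \bar R) :
    C1_curve c -> a <= b -> joined p (c a) l ->
    joined p (c b)
      (l + \int[lebesgue_measure]_(t in `[a, b]) (speed c t)%:E)%E.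

(* Equal to +oo when p and q lie in different connected components. *)
Definition riemannian_dist (p q : M) : \bar R := ereal_inf [set l | joined p q l].

Definition complete_metric : Prop :=
  forall u : nat -> M,
    (forall e : R, 0 < e -> exists N : nat, forall m k : nat,
       (N <= m)%N -> (N <= k)%N -> (riemannian_dist (u m) (u k) < e%:E)%E) ->
    exists p : M, forall e : R, 0 < e -> exists N : nat, forall m : nat,
       (N <= m)%N -> (riemannian_dist (u m) p < e%:E)%E.

End Riemannian.
End Manifold.

(* Lebesgue integral over R^n of a nonnegative Borel function: the integral
   against the n-fold product of Lebesgue measure, one variable at a time. *)
Fixpoint lebesgue_int (R : realType) (n : nat) :
    ('rV[R]_n -> \bar R) -> \bar R :=
  match n with
  | 0%N => fun f => f 0
  | n'.+1 => fun f =>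
      (\int[lebesgue_measure]_(t in [set: R])
         lebesgue_int (fun v : 'rV[R]_n' => f (row_mx (t%:M : 'rV[R]_1) v)))%E
  end.

Definition borel (T : ptopologicalType) := g_sigma_algebraType (@open T).

(* Since countably many charts cover M, this determines the measure. *)
Definition is_riemannian_volume (R : realType) (n : nat)
    (M : oriented_manifold R n) (g : riemannian_metric M)
    (mu : {measure set (borel M) -> \bar R}) : Prop :=
  forall (i : chart M) (A : set (borel M)), measurable A -> A `<=` dom i ->
    mu A = lebesgue_int (fun x =>
      (Num.sqrt (\det (g i x)) * \1_(coord i @` A) x)%:E).

(* Main.v *)
From HB Require Import structures.
From mathcomp Require Import all_boot all_order all_algebra.
From mathcomp Require Import all_classical all_reals all_analysis.
From mathcomp Require Import perm measurable_realfun ring lra.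
Require Import Defs.

Set Implicit Arguments.
Unset Strict Implicit.
Unset Printing Implicit Defensive.

Import Order.TTheory GRing.Theory Num.Theory.
Import numFieldNormedType.Exports.

Local Open Scope classical_set_scope.
Local Open Scope ring_scope.

(* If the divergence has a sign and is nonzero at [p0], test it against
   [phi q = max 0 (1 - eps * d p0 q)].  This function is [eps]-Lipschitz, and compactly supported
   because closed balls of a complete manifold are compact, so integration by parts gives
   [|\int phi div X| <= 2 eps (\int |X| + 1)], which tends to [0] with [eps], whereas the left-hand
   side stays bounded below by a positive constant.
   Integration by parts against the merely Lipschitz [phi] uses no differentiability of [phi]: in a
   chart the derivative is replaced by difference quotients and the field is frozen at a point, so
   that only the Lipschitz bound of [phi] along straight segments enters.  The factor [2] is the
   price of joining points by a segment reparametrized on the whole line. *)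

(** * Calculus on row vectors *)

(** Three obstacles shape the proof. Completeness is given by Cauchy sequences, so the compactness
    of balls is obtained without geodesics: near a ball that is not relatively compact there is
    another one of half the radius, and the limit of the centers is contradictory. The divergence is
    evaluated in the chart that [chart_at] selects at each point, so its value has to be shown the
    same in all charts; this comes out of the weak formulation itself, tested with [phi = 1],
    instead of the transformation law of the Christoffel symbols. Finally, integration by parts is
    local: it bounds the integral of [phi * div (psi X)] for a bump [psi], with an error
    proportional to [eta] per unit of volume, due to freezing the field. The [+ 1] of the bound is
    this error: [eta] is the inverse of [1 + \int chi], for a cutoff [chi] of finite integral that
    equals 1 on a compact set outside which [phi] vanishes. The manifold may be disconnected; [phi]
    is then 0 on the components at infinite distance from [p0]. *)

Section Calculus.
Context {R : realType}.

Lemma is_derive_line (V W : normedModType R) (f : V -> W) (x v : V) (t : R) :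
  derivable f (x + t *: v) v ->
  is_derive t 1 (fun s : R => f (x + s *: v)) ('D_v f (x + t *: v)).
Proof.
have E : (fun h : R => h^-1 *: ((fun s : R => f (x + s *: v)) (h *: 1 + t) -
    (fun s : R => f (x + s *: v)) t)) =
    (fun h : R => h^-1 *: (f (h *: v + (x + t *: v)) - f (x + t *: v))).
  apply/funext => h; congr (_ *: (f _ - _)).
  by rewrite scalerDl addrCA [h *: (1 : R)]mulr1.
move=> df; split; first by rewrite /derivable E.
by rewrite /derive E.
Qed.

(** The segment is parametrized by [t * a] with [t] in [[0, 1]], so that one statement serves both
    signs of [a]. *)
Lemma mean_value_line (V : normedModType R) (f : V -> R) (x v : V) (a : R) :
  (forall t : R, 0 <= t <= 1 -> derivable f (x + (t * a) *: v) v) ->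
  exists2 c : R, 0 <= c <= 1 & f (x + a *: v) - f x = a * 'D_v f (x + (c * a) *: v).
Proof.
move=> df.
have dg (t : R) : 0 <= t <= 1 ->
  is_derive t 1 (fun s : R => f (x + (s * a) *: v)) ('D_v f (x + (t * a) *: v) * a).
  move=> t01; apply: (@is_derive1_comp _ (fun s => f (x + s *: v)) ( *%R^~ a)).
    exact/is_derive_line/df.
  have -> : *%R^~ a = (id : R -> R) * cst a by [].
  apply: is_derive_eq.
  by rewrite /= scaler0 add0r [LHS]mulr1.
have [||c] := @MVT_segment R (fun s : R => f (x + (s * a) *: v))
  (fun t => 'D_v f (x + (t * a) *: v) * a) 0 1 ler01.
- by move=> t; rewrite in_itv /= => /andP[t0 t1]; apply: dg; rewrite !ltW.
- apply: derivable_within_continuous => t; rewrite in_itv /= => t01.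
  by have [] := dg _ t01.
- rewrite in_itv /= mul1r mul0r scale0r addr0 subr0 mulr1 => c01 e.
  by exists c => //; rewrite mulrC.
Qed.

Lemma near_finite (T : nbhsType) (x : T) (I : finType) (P : I -> T -> Prop) :
    Filter (nbhs x) ->
  (forall i, \forall y \near x, P i y) -> \forall y \near x, forall i, P i y.
Proof. by move=> FF H; apply: (@filter_forall _ I (fun i => [set y | P i y])). Qed.

Lemma cvg_sumR (T I : Type) (F : set_system T) (r : seq I) (P : pred I)
    (f : I -> T -> R) (l : I -> R) : Filter F ->
  (forall i, P i -> f i t @[t --> F] --> l i) ->
  \sum_(i <- r | P i) f i t @[t --> F] --> \sum_(i <- r | P i) l i.
Proof. by move=> FF fl; apply: cvg_big => //; exact: add_continuous. Qed.

Lemma continuous_sumR (T : topologicalType) (I : Type) (x : T) (r : seq I)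
    (P : pred I) (f : I -> T -> R) :
  (forall i, P i -> {for x, continuous (f i)}) ->
  {for x, continuous (fun t => \sum_(i <- r | P i) f i t)}.
Proof. by move=> fc; apply: cvg_sumR. Qed.

Lemma continuous_entry m n (i : 'I_m) (j : 'I_n) (A : 'M[R]_(m, n)) :
  {for A, continuous (fun B : 'M[R]_(m, n) => B i j)}.
Proof. exact: matrix_normedtype.coord_continuous. Qed.

Lemma differentiable_expansion (V W : normedModType R) (f : V -> W)
    (L : {linear V -> W}) (x : V) : continuous L ->
  (forall e, 0 < e -> \forall h \near (0 : V), `|f (h + x) - f x - L h| <= e * `|h|) ->
  differentiable f x.
Proof.
move=> Lc H; have key : f \o shift x = cst (f x) + L +o_ 0 id.
  apply/eqaddoP => e e0; apply: filterS (H e e0) => h.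
  by rewrite !fctE /= opprD addrA.
by apply/diff_locallyP; rewrite (diff_unique Lc key).
Qed.

Lemma mx_norm_coord m n (A : 'M[R]_(m, n)) i j : `|A i j| <= `|A|.
Proof.
rewrite [leRHS]/Num.Def.normr/= mx_normrE.
exact: (le_bigmax _ (fun k : 'I_m * 'I_n => `|A k.1 k.2|) (i, j)).
Qed.

(** The norm is the sup norm, so dropping or shrinking coordinates of [h] does not enlarge it. This
    keeps the axis-parallel path from [x] to [x + h] in every ball around [x] that contains
    [x + h]. *)
Lemma partial_sum_norm n (h : 'rV[R]_n) (P : pred 'I_n) (c : 'I_n -> R) :
  (forall k, `|c k| <= 1) ->
  `|\sum_(k | P k) (c k * h 0 k) *: (delta_mx 0 k : 'rV[R]_n)| <= `|h|.
Proof.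
move=> c1.
rewrite [leLHS]/Num.Def.normr/= mx_normrE; apply: bigmax_le => //= -[i j] _ /=.
rewrite summxE; have [Pj|Pj] := boolP (P j); last first.
  rewrite big1 ?normr0// => k Pk; rewrite !mxE (ord1 i) eqxx /=.
  by have [jk|] := eqVneq j k; [rewrite jk Pk in Pj|rewrite mulr0].
rewrite (bigD1 j)//= big1 ?addr0; last first.
  by move=> k /andP[_ kj]; rewrite !mxE [j == k]eq_sym (negbTE kj) andbF mulr0.
rewrite !mxE (ord1 i) !eqxx mulr1 normrM -[leRHS]mul1r.
by rewrite ler_pM// mx_norm_coord.
Qed.

(** The increment along [h] is split into [n] moves parallel to the axes; on each the mean value
    theorem gives a partial derivative at a point close to [x], and continuity replaces that point
    by [x]. *)
Lemma differentiable_partials n (f : 'rV[R]_n -> R) (x : 'rV[R]_n) :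
  (forall k : 'I_n, \forall y \near x, derivable f y (delta_mx 0 k)) ->
  (forall k, {for x, continuous (partial k f)}) ->
  differentiable f x.
Proof.
move=> df cf.
pose T (h : 'rV[R]_n) := \sum_k h 0 k * partial k f x.
have Tlin : linear T.
  move=> a u v; rewrite /T scaler_sumr -big_split; apply: eq_bigr => k _ /=.
  by rewrite !mxE mulrDl [in RHS]/GRing.scale /= mulrA.
have [L LE] : exists L : {linear 'rV[R]_n -> R}, forall h, L h = T h.
  pose M := GRing.isLinear.Build _ _ _ _ T Tlin.
  pose L : {linear 'rV[R]_n -> R} := HB.pack T M.
  by exists L.
have Lc : continuous L.
  move=> u; rewrite (_ : (L : _ -> _) = T); last exact/funext.
  by apply: continuous_sumR => k _; apply: continuousM; [exact: continuous_entry|exact: cst_continuous].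
apply: (differentiable_expansion Lc) => e e0.
  (* Each of the [n] moves contributes an error [d * |h|]; [n.+1] keeps the divisor nonzero when
     [n = 0]. *)
  pose d : R := e / n.+1%:R.
  have d0 : 0 < d by rewrite divr_gt0.
  have : \forall y \near x, forall k : 'I_n, derivable f y (delta_mx 0 k) /\
     `|partial k f x - partial k f y| < d.
    apply: near_finite => k; apply: filterI; first exact: df.
    by move/cvgrPdist_lt : (cf k) => /(_ _ d0).
  move=> /nbhs_ballP[r /= r0 rP].
  apply/nbhs_ballP; exists r => //= h; rewrite -ball_normE /= sub0r normrN => hr.
  pose S (m : nat) := \sum_(k < n | (k < m)%N) (1 * h 0 k) *: (delta_mx 0 k : 'rV[R]_n).
  have ball_in (P : pred 'I_n) (c : 'I_n -> R) : (forall k, `|c k| <= 1) ->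
     ball x r (x + \sum_(k | P k) (c k * h 0 k) *: (delta_mx 0 k : 'rV[R]_n)).
    move=> c1; rewrite -ball_normE /= opprD addNKr normrN.
    by apply: le_lt_trans hr; exact: partial_sum_norm.
  have step (m : nat) : (m <= n)%N ->
      `|f (x + S m) - f x - \sum_(k < n | (k < m)%N) h 0 k * partial k f x| <=
      m%:R * (d * `|h|).
    elim: m => [|m IH] mn.
      by rewrite /S !big_pred0// addr0 subrr subr0 normr0 mul0r.
    pose k0 : 'I_n := Ordinal mn.
    have splitm (Z : zmodType) (F : 'I_n -> Z) :
      \sum_(k < n | (k < m.+1)%N) F k = \sum_(k < n | (k < m)%N) F k + F k0.
      rewrite (bigD1 k0)//= addrC; congr (_ + _); apply: eq_bigl => k.
      by rewrite -val_eqE /= ltnS ltn_neqAle andbC.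
    rewrite splitm.
    have -> : S m.+1 = S m + (h 0 k0) *: delta_mx 0 k0 by rewrite /S splitm mul1r.
    have inb (t : R) : 0 <= t <= 1 -> ball x r (x + S m + (t * h 0 k0) *: delta_mx 0 k0).
      move=> /andP[t0 t1].
      (* The coordinates before [k0] are taken in full, the coordinate [k0] in proportion [t]. *)
      have := @ball_in (fun k => (k < m.+1)%N) (fun k => if k == k0 then t else 1).
      rewrite splitm eqxx -addrA.
      have -> : \sum_(k < n | (k < m)%N) ((if k == k0 then t else 1) * h 0 k) *:
         (delta_mx 0 k : 'rV[R]_n) = S m.
        by apply: eq_bigr => k km; rewrite -val_eqE /= ltn_eqF.
      by apply=> k; case: ifP => _; rewrite ger0_norm.
    have [|c c01 fE] := @mean_value_line _ f (x + S m) (delta_mx 0 k0) (h 0 k0).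
      by move=> t t01; have [+ _] := rP _ (inb t t01) k0.
    have [_ pE] := rP _ (inb c c01) k0.
    rewrite addrA.
    have -> : f (x + S m + h 0 k0 *: delta_mx 0 k0) - f x -
       (\sum_(k < n | (k < m)%N) h 0 k * partial k f x + h 0 k0 * partial k0 f x) =
       (f (x + S m) - f x - \sum_(k < n | (k < m)%N) h 0 k * partial k f x) +
       - h 0 k0 * (partial k0 f x - partial k0 f (x + S m + (c * h 0 k0) *: delta_mx 0 k0)).
      rewrite -[f (x + S m + h 0 k0 *: delta_mx 0 k0)](subrK (f (x + S m))) fE /partial.
      ring.
    apply: le_trans (ler_normD _ _) _; rewrite -natr1 mulrDl mul1r lerD ?IH 1?ltnW//.
    by rewrite normrM normrN mulrC; apply: ler_pM => //; [exact: ltW|exact: mx_norm_coord].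
  have Sn : S n = h.
    by rewrite /S [RHS]row_sum_delta; apply: eq_big => [k|k _]; rewrite ?ltn_ord// mul1r.
  have := step n (leqnn n); rewrite Sn.
  have -> : \sum_(k < n | (k < n)%N) h 0 k * partial k f x = L h.
    by rewrite LE; apply: eq_bigl => k; rewrite ltn_ord.
  move=> H; rewrite [h + x]addrC; apply: (le_trans H).
  rewrite mulrA ler_wpM2r// /d mulrCA ger_pMr// ler_pdivrMr// mul1r ler_nat.
  exact: leqnSn.
Qed.

Lemma continuous_near_eq (T U : topologicalType) (f g : T -> U) (x : T) :
  (\forall y \near x, f y = g y) -> {for x, continuous f} -> {for x, continuous g}.
Proof.
move=> fg; rewrite /prop_for /continuous_at -(nbhs_singleton fg) => fc.
apply: cvg_trans fc; exact: near_eq_cvg.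
Qed.

Lemma near_open (T : topologicalType) (U : set T) (P : T -> Prop) (x : T) :
  open U -> U x -> (forall y, U y -> P y) -> \forall y \near x, P y.
Proof. by move=> oU Ux UP; apply: filterS UP _; exact: open_nbhs_nbhs. Qed.

Lemma derive_partials n (f : 'rV[R]_n -> R) (x v : 'rV[R]_n) : differentiable f x ->
  'D_v f x = \sum_k v 0 k * partial k f x.
Proof.
move=> df; rewrite deriveE// [in LHS](row_sum_delta v) linear_sum.
by apply: eq_bigr => k _; rewrite linearZ /= /partial deriveE.
Qed.

(** Differentiability is required separately: [partial] is a total function, and its continuity
    alone does not make [f] derivable. *)
Definition C1_on n (U : set 'rV[R]_n) (f : 'rV[R]_n -> R) : Prop :=
  forall x, U x -> differentiable f x /\ forall k, {for x, continuous (partial k f)}.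

Lemma C1_on_diff n (U : set 'rV[R]_n) f x : C1_on U f -> U x -> differentiable f x.
Proof. by move=> fU /fU[]. Qed.

Lemma C1_on_cont n (U : set 'rV[R]_n) f x : C1_on U f -> U x -> {for x, continuous f}.
Proof. by move=> fU /fU[/differentiable_continuous]. Qed.

Lemma C1_on_partial n (U : set 'rV[R]_n) f k x :
  C1_on U f -> U x -> {for x, continuous (partial k f)}.
Proof. by move=> fU /fU[]. Qed.

Lemma near_eq_differentiable (V W : normedModType R) (f g : V -> W) (x : V) :
  (\forall y \near x, f y = g y) -> differentiable f x -> differentiable g x.
Proof.
move=> fg /diff_locallyxP[dc df].
apply: (differentiable_expansion (L := 'd f x) dc) => e e0.
have /eqaddoP/(_ e e0) : f \o shift x = cst (f x) + 'd f x +o_ 0 id by exact/funext.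
have : \forall h \near (0 : V), f (h + x) = g (h + x).
  by move: fg; rewrite (near_shift 0) subr0.
apply: filterS2 => h fgh; rewrite !fctE /= fgh (nbhs_singleton fg).
by rewrite opprD addrA.
Qed.

(** The passage from the smoothness recorded for transition maps, metric and field to real-valued C1
    functions; as [U] is open, the entrywise formula for the derivative holds around each point. *)
Lemma Ck1_entry n p q (U : set 'rV[R]_n) (F : 'rV[R]_n -> 'M[R]_(p, q)) i j :
  open U -> Ck_on 1 U F -> C1_on U (fun x => F x i j).
Proof.
move=> oU [cF dF] x Ux.
have dFij k y : U y -> derivable (fun x => F x i j) y (delta_mx 0 k).
  by move=> Uy; have [dk _] := dF k; move: (dk y Uy) => /derivable_mxP.
have cFij k : {for x, continuous (partial k (fun x => F x i j))}.
  have [dk [ck _]] := dF k.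
  apply: (@continuous_near_eq _ _ (fun y => partial k F y i j)).
    apply: (near_open oU Ux) => y Uy.
    by rewrite /partial derive_mx ?mxE//; exact: dk.
  apply: (@continuous_comp _ _ _ (partial k F) (fun A : 'M[R]_(p, q) => A i j)).
    exact: ck.
  exact: continuous_entry.
split=> //; apply: differentiable_partials => // k.
by apply: (near_open oU Ux) => y; exact: dFij.
Qed.

Lemma C1_on_cst n (U : set 'rV[R]_n) (c : R) : C1_on U (fun=> c).
Proof.
move=> x _; split; first exact: differentiable_cst.
move=> k; have -> : partial k (fun=> c) = fun=> (0 : R).
  by apply/funext => y; rewrite /partial (derive_cst c).
exact: cst_continuous.
Qed.

(** The candidates [pf] have to agree with the partial derivatives on [U] only, since continuity at
    a point of an open set is a local matter. *)
Lemma C1_on_near n (U : set 'rV[R]_n) (f : 'rV[R]_n -> R) (pf : 'I_n -> 'rV[R]_n -> R) :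
  open U -> (forall x, U x -> differentiable f x) ->
  (forall x k, U x -> partial k f x = pf k x) ->
  (forall x k, U x -> {for x, continuous (pf k)}) -> C1_on U f.
Proof.
move=> oU df pfE cpf x Ux; split; first exact: df.
move=> k; apply: continuous_near_eq (cpf x k Ux).
by apply: (near_open oU Ux) => y Uy; rewrite pfE.
Qed.

Lemma C1_onD n (U : set 'rV[R]_n) (f g : 'rV[R]_n -> R) :
  open U -> C1_on U f -> C1_on U g -> C1_on U (fun x => f x + g x).
Proof.
move=> oU fU gU; apply: (@C1_on_near _ _ _ (fun k x => partial k f x + partial k g x)) => //.
- by move=> x Ux; apply: differentiableD; [exact: (C1_on_diff fU)|exact: (C1_on_diff gU)].
- move=> x k Ux; rewrite /partial; apply: deriveD; apply: diff_derivable;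
  [exact: (C1_on_diff fU)|exact: (C1_on_diff gU)].
- move=> x k Ux; apply: continuousD; [exact: (C1_on_partial fU)|exact: (C1_on_partial gU)].
Qed.

Lemma C1_onM n (U : set 'rV[R]_n) (f g : 'rV[R]_n -> R) :
  open U -> C1_on U f -> C1_on U g -> C1_on U (fun x => f x * g x).
Proof.
move=> oU fU gU; apply: (@C1_on_near _ _ _
  (fun k x => f x * partial k g x + g x * partial k f x)) => //.
- by move=> x Ux; apply: differentiableM; [exact: (C1_on_diff fU)|exact: (C1_on_diff gU)].
- move=> x k Ux; rewrite /partial; apply: deriveM; apply: diff_derivable;
  [exact: (C1_on_diff fU)|exact: (C1_on_diff gU)].
- move=> x k Ux; apply: continuousD; apply: continuousM.
  + exact: (C1_on_cont fU).
  + exact: (C1_on_partial gU).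
  + exact: (C1_on_cont gU).
  + exact: (C1_on_partial fU).
Qed.

Lemma C1_on_sum n (U : set 'rV[R]_n) (I : Type) (r : seq I) (P : pred I)
    (f : I -> 'rV[R]_n -> R) :
  open U -> (forall i, P i -> C1_on U (f i)) -> C1_on U (fun x => \sum_(i <- r | P i) f i x).
Proof.
move=> oU fU; elim: r => [|i r IH].
  by rewrite (_ : (fun x => _) = fun=> 0); [exact: C1_on_cst|
    apply/funext => x; rewrite big_nil].
have [Pi|Pi] := boolP (P i).
  rewrite (_ : (fun x => _) = fun x => f i x + \sum_(i <- r | P i) f i x).
    by apply: C1_onD => //; exact: fU.
  by apply/funext => x; rewrite big_cons Pi.
by under eq_fun do rewrite big_cons (negbTE Pi).
Qed.

Lemma C1_on_prod n (U : set 'rV[R]_n) (I : Type) (r : seq I) (P : pred I)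
    (f : I -> 'rV[R]_n -> R) :
  open U -> (forall i, P i -> C1_on U (f i)) -> C1_on U (fun x => \prod_(i <- r | P i) f i x).
Proof.
move=> oU fU; elim: r => [|i r IH].
  by rewrite (_ : (fun x => _) = fun=> 1); [exact: C1_on_cst|
    apply/funext => x; rewrite big_nil].
have [Pi|Pi] := boolP (P i).
  rewrite (_ : (fun x => _) = fun x => f i x * \prod_(i <- r | P i) f i x).
    by apply: C1_onM => //; exact: fU.
  by apply/funext => x; rewrite big_cons Pi.
by under eq_fun do rewrite big_cons (negbTE Pi).
Qed.

Lemma partial_comp1 n (f : 'rV[R]_n -> R) (h : R -> R) (dh : R) (x : 'rV[R]_n) k :
  differentiable f x -> is_derive (f x) 1 h dh ->
  differentiable (h \o f) x /\ partial k (h \o f) x = dh * partial k f x.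
Proof.
move=> df dh1.
have dhf : differentiable h (f x) by apply/derivable1_diffP; case: dh1.
have dhof := differentiable_comp df dhf.
split=> //; rewrite /partial !deriveE//= diff_comp//= deriv1E; last by case: dh1.
by rewrite derive1E derive_val mulrC.
Qed.

Lemma C1_on_comp1 n (U : set 'rV[R]_n) (f : 'rV[R]_n -> R) (h dh : R -> R) :
  open U -> C1_on U f ->
  (forall x, U x -> is_derive (f x) 1 h (dh (f x)) /\ {for f x, continuous dh}) ->
  C1_on U (fun x => h (f x)).
Proof.
move=> oU fU hh; apply: (@C1_on_near _ _ _ (fun k x => dh (f x) * partial k f x)) => //.
- move=> x Ux; apply: differentiable_comp; first exact: (C1_on_diff fU).
  by apply/derivable1_diffP; have [[]] := hh x Ux.
- move=> x k Ux; have [hd _] := hh x Ux.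
  by have [_ <-] := partial_comp1 k (C1_on_diff fU Ux) hd.
- move=> x k Ux; apply: continuousM; last exact: (C1_on_partial fU).
  by apply: continuous_comp; [exact: (C1_on_cont fU)|have [_] := hh x Ux].
Qed.

Lemma differentiable_entries (V : normedModType R) m n (F : V -> 'M[R]_(m, n)) (x : V) :
  (forall i j, differentiable (fun y => F y i j) x) -> differentiable F x.
Proof.
move=> dF.
have -> : F = \sum_i \sum_j (fun y => F y i j *: (delta_mx i j : 'M[R]_(m, n))).
  apply/funext => y; rewrite [LHS]matrix_sum_delta fct_sumE; apply: eq_bigr => i _.
  by rewrite fct_sumE.
apply: differentiable_sum => i; apply: differentiable_sum => j.
exact: differentiableZl.
Qed.

Lemma jacobian_entry m n (F : 'rV[R]_m -> 'rV[R]_n) (x : 'rV[R]_m) k j :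
  differentiable F x -> jacobian F x k j = partial k (fun y => F y 0 j) x.
Proof.
move=> dF; rewrite /jacobian /lin1_mx mxE.
have dk : derivable F x (delta_mx 0 k) by exact: diff_derivable.
by rewrite -deriveE// derive_mx// mxE.
Qed.

Lemma partial_comp m n (f : 'rV[R]_n -> R) (F : 'rV[R]_m -> 'rV[R]_n) (x : 'rV[R]_m) k :
  differentiable F x -> differentiable f (F x) ->
  partial k (f \o F) x = \sum_j partial k (fun y => F y 0 j) x * partial j f (F x).
Proof.
move=> dF df; rewrite /partial deriveE; last exact: differentiable_comp.
rewrite diff_comp//= -(deriveE _ dF) -(deriveE _ df) derive_partials//.
by apply: eq_bigr => j _; rewrite derive_mx ?mxE//; exact: diff_derivable.
Qed.

Lemma C1_on_comp m n (U : set 'rV[R]_m) (V : set 'rV[R]_n) (f : 'rV[R]_n -> R)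
    (F : 'rV[R]_m -> 'rV[R]_n) :
  open U -> C1_on V f -> (forall j, C1_on U (fun x => F x 0 j)) ->
  (forall x, U x -> V (F x)) -> C1_on U (fun x => f (F x)).
Proof.
move=> oU fV FU UV.
have dF x : U x -> differentiable F x.
  move=> Ux; apply: differentiable_entries => i j; rewrite (ord1 i).
  exact: (C1_on_diff (FU j)).
apply: (@C1_on_near _ _ _ (fun k x =>
  \sum_j partial k (fun y => F y 0 j) x * partial j f (F x))) => //.
- move=> x Ux; apply: differentiable_comp; first exact: dF.
  exact: (C1_on_diff fV (UV x Ux)).
- by move=> x k Ux; rewrite -partial_comp//; [exact: dF|exact: (C1_on_diff fV (UV x Ux))].
- move=> x k Ux; apply: continuous_sumR => j _; apply: continuousM.
    exact: (C1_on_partial (FU j)).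
  apply: continuous_comp; last exact: (C1_on_partial fV (UV _ Ux)).
  exact/differentiable_continuous/dF.
Qed.

End Calculus.

(** * Lebesgue measure on row vectors *)

Section BorelSpaces.
Context {R : realType}.
Local Notation mu := (@lebesgue_measure R).

Lemma borel_open_measurable (T : ptopologicalType) (A : set (borel T)) :
  open (A : set T) -> measurable A.
Proof. by move=> oA; apply: sub_sigma_algebra. Qed.

Lemma measurable_fun_into_borel d (T : measurableType d) (S : ptopologicalType)
    (f : T -> borel S) :
  (forall U : set S, open U -> measurable (f @^-1` U)) -> measurable_fun setT f.
Proof.
move=> H; apply: (@measurability _ _ _ (borel S) setT f (@open S)) => //.
by move=> _ [U oU <-]; rewrite setTI; exact: H.
Qed.

Lemma continuous_borel_measurable (T S : ptopologicalType) (f : borel T -> borel S) :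
  continuous (f : T -> S) -> measurable_fun setT f.
Proof.
move=> cf; apply: measurable_fun_into_borel => U oU.
by apply: borel_open_measurable; exact: (open_comp _ oU).
Qed.

Lemma measurable_fun_open_real d (T : measurableType d) (D : set T) (f : T -> R) :
  measurable D ->
  (forall U : set R, open U -> measurable (D `&` f @^-1` U)) -> measurable_fun D f.
Proof.
move=> mD H.
apply: (@measurability _ _ _ (measurableTypeR R) D f (RGenOpens.G (R:=R))).
  exact: RGenOpens.measurableE.
move=> _ [U [a [b ->]] <-]; apply: H; exact: interval_open.
Qed.

Lemma borel_measurable_fun_within (T : ptopologicalType) (D : set T) (f : T -> R) :
  open D -> (forall x, D x -> {for x, continuous f}) ->
  measurable_fun (D : set (borel T)) (f : borel T -> R).
Proof.
move=> oD cf; apply: measurable_fun_open_real; first exact: borel_open_measurable.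
move=> U oU; apply: borel_open_measurable.
rewrite openE => x [Dx Ux]; apply: filterI; first exact: open_nbhs_nbhs.
by apply: (cf x Dx); exact: open_nbhs_nbhs.
Qed.

(** The translate of a half-open interval has the same length, so the pushforward agrees with
    Lebesgue measure on the intervals that determine it. *)
Lemma lebesgue_measure_translate (a : R) (A : set (measurableTypeR R)) :
  measurable A ->
  pushforward mu ((fun t => t + a) : measurableTypeR R -> measurableTypeR R) A = mu A.
Proof.
have mt : measurable_fun setT ((fun t : R => t + a) : measurableTypeR R -> measurableTypeR R).
  apply: (@measurable_fun_open_real _ (measurableTypeR R) setT) => // U oU.
  rewrite setTI; apply: open_measurable.
  by apply: (open_comp _ oU) => t _; apply: continuousD; [exact: cvg_id|exact: cst_continuous].
pose pf : {measure set (measurableTypeR R) -> \bar R} :=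
  measure_function_pushforward__canonical__measure_function_Measure mu mt.
move=> mA; apply/esym; apply: (@lebesgue_measure_unique R pf) => //= _ [[b c]] _ <-.
rewrite /pf /= /pushforward.
have -> : ((fun t : R => t + a) @^-1` [set` `]b, c] ]) = [set` `](b - a), (c - a)] ].
  by apply/seteqP; split => t /=; rewrite !in_itv /= ltrBlDr lerBrDr.
rewrite !lebesgue_measure_itv /= !lte_fin ltrD2r -!EFinB.
by have -> : c - a - (b - a) = c - b by ring.
Qed.

Lemma ge0_integral_translate (a : R) (f : measurableTypeR R -> \bar R) :
  measurable_fun setT f -> (forall t, (0 <= f t)%E) ->
  (\int[mu]_(t in [set: R]) f (t + a)%R = \int[mu]_(t in [set: R]) f t)%E.
Proof.
move=> mf f0.
have mt : measurable_fun setT ((fun t : R => t + a) : measurableTypeR R -> measurableTypeR R).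
  apply: (@measurable_fun_open_real _ (measurableTypeR R) setT) => // U oU.
  rewrite setTI; apply: open_measurable.
  by apply: (open_comp _ oU) => t _; apply: continuousD; [exact: cvg_id|exact: cst_continuous].
transitivity (\int[pushforward mu ((fun t : R => (t + a)%R) : measurableTypeR R -> measurableTypeR R)]_(t in setT) f t)%E.
  by rewrite (ge0_integral_pushforward mt).
by apply: eq_measure_integral => //= A mA AS; exact: lebesgue_measure_translate.
Qed.

Lemma mx_norm_ltP m n (A : 'M[R]_(m, n)) (e : R) : 0 < e ->
  `|A| < e <-> forall i j, `|A i j| < e.
Proof.
move=> e0; split=> [Ae i j|H]; first exact: le_lt_trans (mx_norm_coord _ _ _) Ae.
by rewrite [ltLHS]/Num.Def.normr/= mx_normrE; apply: bigmax_lt.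
Qed.

(** The identification of [R * R^n] with [R^(n+1)] along which [lebesgue_int] recurses; it is an
    isometry for the sup norm. *)
Definition row_cons n (t : R) (v : 'rV[R]_n) : 'rV[R]_n.+1 := row_mx (t%:M : 'rV[R]_1) v.

Lemma row_consEl n t (v : 'rV[R]_n) i : row_cons t v i (lshift n (0 : 'I_1)) = t.
Proof.
have := row_mxEl (t%:M : 'rV[R]_1) v i 0.
by rewrite (ord1 i) [X in _ = X -> _]mxE eqxx mulr1n.
Qed.

Lemma row_consEr n t (v : 'rV[R]_n) i j : row_cons t v i (rshift 1 j) = v i j.
Proof. exact: (row_mxEr (t%:M : 'rV[R]_1) v i j). Qed.

Lemma row_consB n t s (v w : 'rV[R]_n) : row_cons t v - row_cons s w = row_cons (t - s) (v - w).
Proof. by apply/matrixP => i j; rewrite !mxE; case: fintype.split => k; rewrite !mxE ?mulrnBl. Qed.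

Lemma row_consD n t s (v w : 'rV[R]_n) : row_cons t v + row_cons s w = row_cons (t + s) (v + w).
Proof. by apply/matrixP => i j; rewrite !mxE; case: fintype.split => k; rewrite !mxE ?mulrnDl. Qed.

Lemma row_consK n (w : 'rV[R]_n.+1) :
  row_cons (w 0 0) (rsubmx (w : 'M[R]_(1, 1 + n))) = w.
Proof.
have e : (w 0 0)%:M = lsubmx (w : 'M[R]_(1, 1 + n)).
  apply/matrixP => i j; rewrite !mxE (ord1 i) (ord1 j) eqxx mulr1n; congr (w _ _).
  exact: val_inj.
by rewrite /row_cons e; exact: (@hsubmxK _ 1 1 n).
Qed.

Lemma row_cons_norm_lt n t (v : 'rV[R]_n) (e : R) : 0 < e ->
  `|row_cons t v| < e <-> `|t| < e /\ `|v| < e.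
Proof.
move=> e0; split.
  move/(mx_norm_ltP _ e0) => H; split.
    by have := H 0 (lshift n (0 : 'I_1)); rewrite row_consEl.
  apply/mx_norm_ltP => // i j; rewrite (ord1 i).
  by have := H 0 (rshift 1 j); rewrite row_consEr.
move=> [te /mx_norm_ltP - /(_ e0) ve]; apply/mx_norm_ltP => // i j.
rewrite -(@splitK 1 n j); case: (@fintype.split 1 n j) => k /=.
  by rewrite (ord1 k) row_consEl.
by rewrite row_consEr.
Qed.

Lemma ball_row_cons n t (v : 'rV[R]_n) s w (r : R) : 0 < r ->
  ball (row_cons t v) r (row_cons s w) <-> ball t r s /\ ball v r w.
Proof.
by move=> r0; rewrite -!ball_normE /ball_ /= row_consB; exact: row_cons_norm_lt.
Qed.

Lemma row_cons_continuous n (t : R) : continuous (@row_cons n t).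
Proof.
move=> v; apply/(@cvgrPdist_lt R 'rV[R]_n.+1 'rV[R]_n (nbhs (v : 'rV[R]_n))) => e e0.
apply/nbhs_ballP; exists e => //= w.
rewrite -ball_normE /= row_consB subrr => vw.
by apply/row_cons_norm_lt => //; rewrite normr0.
Qed.

(** The source carries the product of two Borel sigma-algebras, so continuity is not enough: the
    preimage of an open set is written as a countable union of open rectangles, indexed by the
    rational balls of the first factor. *)
Lemma row_cons_measurable n : measurable_fun setT
  ((fun p => row_cons p.1 p.2) : (measurableTypeR R * borel 'rV[R]_n)%type -> borel 'rV[R]_n.+1).
Proof.
apply: measurable_fun_into_borel => U oU.
(* The largest open set whose product with the rational ball [q] is sent into [U], so that no base
   of the second factor has to be chosen. *)
pose W (q : rat * rat) : set 'rV[R]_n :=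
  [set v | exists2 N : set 'rV[R]_n, nbhs v N &
     forall t w, ball (ratr q.1 : R) (ratr q.2) t -> N w -> U (row_cons t w)].
have -> : (fun p : measurableTypeR R * borel 'rV[R]_n => row_cons p.1 p.2) @^-1` U =
    \bigcup_(q : rat * rat) (ball (ratr q.1 : R) (ratr q.2) `*` W q).
  apply/seteqP; split=> [[t v]|[t v] [q _ [/= bt [N vN]]]] /=; last first.
    by apply=> //; exact: nbhs_singleton.
  move=> Utv; have /nbhs_ballP[r /= r0 rU] : nbhs (row_cons t v) U by exact: open_nbhs_nbhs.
  have r20 : 0 < r / 2 by rewrite divr_gt0.
  (* With a rational radius [d < r / 2] and a rational center within [d] of [t], the rational ball
     contains [t] and stays in the ball of radius [r] around it. *)
  have [d] : exists d : rat, ratr d \in `]0, (r / 2)[ by exact: rat_in_itvoo.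
  rewrite in_itv /= => /andP[d0 dr].
  have [q] : exists q : rat, ratr q \in `](t - ratr d), (t + ratr d)[.
    by apply: rat_in_itvoo; rewrite ltrD2l; lra.
  rewrite in_itv /= => /andP[q1 q2].
  have tq : `|t - ratr q| < ratr d by rewrite ltr_norml; lra.
  exists (q, d) => //; split=> /=; first by rewrite -ball_normE /= distrC.
  exists (ball v r); first exact: nbhsx_ballx.
  move=> s w; rewrite -ball_normE /= => sq vw; apply: rU.
  apply/ball_row_cons => //; split=> //.
  rewrite -ball_normE /=; have := ler_distD (ratr q) t s; lra.
apply: countable_bigcupT_measurable.
  by apply: countableP.
move=> q; apply: measurableX.
  exact: measurable_ball.
apply: borel_open_measurable; rewrite openE => v [N vN NU].
rewrite /interior; have : nbhs v (nbhs^~ N) by exact: nbhs_interior.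
by apply: filterS => w wN; exists N.
Qed.

Lemma lebesgue_measure_ball_rV (x r : R) : 0 < r ->
  mu (ball x r) = (2 * r)%:E.
Proof.
move=> r0; rewrite (_ : ball x r = [set` `](x - r), (x + r)[ ]); last first.
  apply/seteqP; split=> t; rewrite -ball_normE /ball_ /= in_itv /= distrC ltr_norml;
    by lra.
rewrite lebesgue_measure_itv /= lte_fin -EFinB.
by rewrite ifT; [congr EFin; ring|lra].
Qed.

(** [lebesgue_int] is an iterated integral, not a measure; these two properties describe a genuine
    measure that computes it, to which the convergence theorems apply. Balls are cubes of side
    [2 * r], because the norm is the sup norm. *)
Definition is_lebesgue n (L : {measure set (borel 'rV[R]_n) -> \bar R}) : Prop :=
  (forall (a : 'rV[R]_n) (r : R), 0 < r -> L (ball a r) = ((2 * r) ^+ n)%:E) /\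
  (forall f : borel 'rV[R]_n -> \bar R, measurable_fun setT f -> (forall x, (0 <= f x)%E) ->
    (\int[L]_x f x = lebesgue_int f)%E).

Lemma is_lebesgue_sigma_finite n (L : {measure set (borel 'rV[R]_n) -> \bar R}) :
  is_lebesgue L -> sigma_finite setT L.
Proof.
move=> [Lb _]; exists (fun k => ball (0 : 'rV[R]_n) k.+1%:R).
  apply/esym/seteqP; split=> // x _; exists (Num.truncn `|x|) => //.
  by rewrite -ball_normE /= sub0r normrN truncnS_gt.
move=> k; split; last by rewrite Lb// ltry.
by apply: borel_open_measurable; exact: ball_open.
Qed.

(** Product measures and Tonelli's theorem take sigma-finiteness as part of the structure of the
    measure; the repacked measure has the same values. *)
Lemma sigma_finite_bundle d (T : measurableType d) (L : {measure set T -> \bar R}) :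
  sigma_finite setT L ->
  exists Ls : {sigma_finite_measure set T -> \bar R}, forall A, Ls A = L A.
Proof.
case: L => m [c1 c2] /= HL.
pose Sm := @Measure_isSigmaFinite.Axioms_ d T R m c1 c2 HL.
pose Ls : {sigma_finite_measure set T -> \bar R} := HB.pack m c1 c2 Sm.
by exists Ls.
Qed.

(** Induction on the dimension: the Dirac measure at the only point of [R^0], then the product with
    the line, pushed along [row_cons]. Tonelli's theorem reproduces the recursion of
    [lebesgue_int]. *)
Lemma lebesgue_rV_exists n : exists L : {measure set (borel 'rV[R]_n) -> \bar R},
  is_lebesgue L.
Proof.
elim: n => [|n [L HL]].
  exists (\d_(0 : borel 'rV[R]_0)); split.
    move=> a r r0; rewrite expr0 /= /dirac indicE mem_set//.
    by rewrite -ball_normE /= [a - 0]thinmx0 normr0.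
  by move=> f mf f0; rewrite integral_dirac//= diracT mul1e.
have [Ls LsE] := sigma_finite_bundle (is_lebesgue_sigma_finite HL).
have HLs : is_lebesgue Ls.
  split=> [a r r0|f mf f0]; first exact: etrans (LsE _) (proj1 HL a r r0).
  by rewrite -(proj2 HL f mf f0); apply: eq_measure_integral => A mA _; exact: LsE.
pose P := (@lebesgue_measure R \x Ls)%E.
pose Lp : {measure set (borel 'rV[R]_n.+1) -> \bar R} :=
  measure_function_pushforward__canonical__measure_function_Measure P (@row_cons_measurable n).
exists Lp; split.
  move=> a r r0; rewrite /Lp /= /pushforward -(row_consK a).
  set v := rsubmx _.
  have -> : (fun p : R * borel 'rV[R]_n => row_cons p.1 p.2) @^-1` ball (row_cons (a 0 0) v) r =
    ball (a 0 0) r `*` ball v r.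
    by apply/seteqP; split=> -[t w] /=; move/(ball_row_cons _ _ _ _ r0).
  rewrite /P product_measure1E.
  - rewrite [X in (X * _)%E](lebesgue_measure_ball_rV (a 0 0) r0).
    by rewrite [X in (_ * X)%E](proj1 HLs v r r0) -EFinM exprS.
  - by apply: open_measurable; exact: ball_open.
  - by apply: borel_open_measurable; exact: ball_open.
move=> f mf f0.
rewrite (@ge0_integral_pushforward _ _ _ _ _ _ (@row_cons_measurable n) P setT f)//.
rewrite preimage_setT fubini_tonelli1//=; last first.
  by apply: measurableT_comp => //; exact: row_cons_measurable.
apply: eq_integral => t _; rewrite /fubini_F /=.
apply: (proj2 HLs) => //.
apply: (measurableT_comp mf); apply: continuous_borel_measurable.
exact: row_cons_continuous.
Qed.

End BorelSpaces.

(** * Translation invariance and weak derivatives on row vectors *)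

Section Translation.
Context {R : realType}.
Local Notation mu := (@lebesgue_measure R).

Lemma borel_measurable_continuous (T : ptopologicalType) (f : T -> R) :
  continuous f -> measurable_fun setT (f : borel T -> R).
Proof.
move=> cf; apply: (@borel_measurable_fun_within R T setT); first exact: openT.
by move=> x _; exact: cf.
Qed.

Lemma addr_continuous_rV n (v : 'rV[R]_n) : continuous (fun x : 'rV[R]_n => x + v).
Proof. by move=> x; apply: continuousD; [exact: cvg_id|exact: cst_continuous]. Qed.

Lemma addr_measurable_rV n (v : 'rV[R]_n) :
  measurable_fun setT ((fun x => x + v) : borel 'rV[R]_n -> borel 'rV[R]_n).
Proof. apply: continuous_borel_measurable; exact: addr_continuous_rV. Qed.

(** Induction on the dimension: the inner variables are translated by the induction hypothesis, the
    outer one by invariance on the line. *)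
Lemma lebesgue_int_translate n (v : 'rV[R]_n) (f : borel 'rV[R]_n -> \bar R) :
  measurable_fun setT f -> (forall x, (0 <= f x)%E) ->
  lebesgue_int (fun x : 'rV[R]_n => f (x + v)) = lebesgue_int f.
Proof.
elim: n v f => [|n IH] v f mf f0 /=.
  by rewrite add0r [v]thinmx0.
rewrite -(row_consK v); set w := rsubmx _; set s := v 0 0.
have mfr t : measurable_fun setT (fun x : borel 'rV[R]_n => f (row_cons t x)).
  apply: (measurableT_comp mf); apply: continuous_borel_measurable.
  exact: row_cons_continuous.
have [L HL] := @lebesgue_rV_exists R n.
have [Ls LsE] := sigma_finite_bundle (is_lebesgue_sigma_finite HL).
transitivity (\int[mu]_(t in [set: R])
    lebesgue_int (fun x : 'rV[R]_n => f (row_cons (t + s)%R x)))%E.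
  apply: eq_integral => t _.
  rewrite -(IH w (fun x => f (row_cons (t + s)%R x)))//.
  by congr lebesgue_int; apply/funext => x; rewrite row_consD.
apply: (@ge0_integral_translate R s (fun t => lebesgue_int (fun x : 'rV[R]_n => f (row_cons t x)))).
  (* The inner integral is recognized as a Tonelli partial integral, which is where its
     measurability in [t] comes from. *)
  have -> : (fun t => lebesgue_int (fun x : 'rV[R]_n => f (row_cons t x))) =
    fubini_F Ls (fun p : measurableTypeR R * borel 'rV[R]_n => f (row_cons p.1 p.2)).
    apply/funext => t; rewrite /fubini_F /= -(proj2 HL)//.
    by apply: eq_measure_integral => A mA _; exact: esym (LsE A).
  apply: measurable_fun_fubini_tonelli_F => //.
  by apply: (measurableT_comp mf); exact: row_cons_measurable.
move=> t; rewrite -(proj2 HL)//; exact: integral_ge0.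
Qed.

Context (n : nat) (L : {measure set (borel 'rV[R]_n) -> \bar R}).
Hypothesis HL : is_lebesgue L.

Lemma ge0_integral_translate_rV (v : 'rV[R]_n) (f : borel 'rV[R]_n -> \bar R) :
  measurable_fun setT f -> (forall x, (0 <= f x)%E) ->
  (\int[L]_x f (x + v)%R = \int[L]_x f x)%E.
Proof.
move=> mf f0; rewrite !(proj2 HL)//; first exact: lebesgue_int_translate.
by apply: (measurableT_comp mf); exact: addr_measurable_rV.
Qed.

Lemma integrable_translate_rV (v : 'rV[R]_n) (f : borel 'rV[R]_n -> \bar R) :
  L.-integrable setT f -> L.-integrable setT (fun x : borel 'rV[R]_n => f (x + v)%R).
Proof.
move=> /integrableP[mf fi]; apply/integrableP; split.
  by apply: (measurableT_comp mf); exact: addr_measurable_rV.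
rewrite (@ge0_integral_translate_rV v (fun x => `|f x|)%E)//.
exact: measurableT_comp.
Qed.

Lemma integral_translate_rV (v : 'rV[R]_n) (f : borel 'rV[R]_n -> \bar R) :
  measurable_fun setT f ->
  (\int[L]_x f (x + v)%R = \int[L]_x f x)%E.
Proof.
move=> mf; rewrite integralE [RHS]integralE.
congr (_ - _)%E.
  rewrite -(@ge0_integral_translate_rV v (f^\+)%E) => //; last exact: measurable_funepos.
  by apply: eq_integral => x _; rewrite !funeposE.
rewrite -(@ge0_integral_translate_rV v (f^\-)%E) => //; last exact: measurable_funeneg.
by apply: eq_integral => x _; rewrite !funenegE.
Qed.

Lemma bounded_support_integrable (f : 'rV[R]_n -> R) (C r : R) :
  measurable_fun setT (f : borel 'rV[R]_n -> R) -> 0 < r ->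
  (forall x, `|f x| <= C) -> (forall x, r <= `|x| -> f x = 0) ->
  L.-integrable setT (EFin \o (f : borel 'rV[R]_n -> R)).
Proof.
move=> mf r0 fC fr.
pose A : set (borel 'rV[R]_n) := ball (0 : 'rV[R]_n) r.
have mA : measurable A by apply: borel_open_measurable; exact: ball_open.
have -> : EFin \o (f : borel 'rV[R]_n -> R) = (EFin \o f) \_ A.
  apply/funext => x; rewrite patchE; case: ifPn => // /negP xA /=.
  rewrite fr// leNgt; apply/negP => xr; apply: xA; rewrite inE /A.
  by rewrite -ball_normE /= sub0r normrN.
apply/(integrable_mkcond _ mA); apply: measurable_bounded_integrable => //.
- by rewrite (proj1 HL)// ltry.
- exact: measurable_funTS.
- by exists C; split; [exact: num_real|move=> y Cy x _; exact: le_trans (fC x) (ltW Cy)].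
Qed.

Lemma bounded_of_support (f : 'rV[R]_n -> R) (r : R) :
  continuous f -> (forall x, r <= `|x| -> f x = 0) -> exists2 C, 0 <= C & forall x, `|f x| <= C.
Proof.
move=> cf fr.
(* [|r| + 1] makes the ball nonempty whatever the sign of [r]. *)
pose A : set 'rV[R]_n := closed_ball (0 : 'rV[R]_n) (`|r| + 1).
have r1 : 0 < `|r| + 1 by rewrite ltr_wpDl.
have [c _ cmax] : exists2 c, A c & forall t, A t -> `|f t| <= `|f c|.
  have [|||c] := @EVT_max_rV R n (fun x => `|f x|) A.
  - by exists 0; rewrite /A closed_ballE// /closed_ball_ /= subr0 normr0 ltW.
  - apply: bounded_closed_compact; last exact: closed_ball_closed.
    exists (`|r| + 1); split; first exact: num_real.
    move=> y ry x; rewrite /A closed_ballE// /closed_ball_ /= sub0r normrN => xr.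
    exact: le_trans xr (ltW ry).
  - by apply: continuous_subspaceT => x; apply: continuous_comp; [exact: cf|exact: norm_continuous].
  - by rewrite inE => Ac cm; exists c => // t At; apply: cm; rewrite inE.
exists `|f c| => // x; have [xr|xr] := leP `|x| (`|r| + 1).
  by apply: cmax; rewrite /A closed_ballE// /closed_ball_ /= sub0r normrN.
by rewrite fr ?normr0//; apply: le_trans (ltW xr); rewrite (le_trans (ler_norm _))// lerDl.
Qed.

Lemma derive_continuous (u : 'rV[R]_n -> R) (v : 'rV[R]_n) :
  C1_on setT u -> continuous ('D_v u).
Proof.
move=> u1; have -> : 'D_v u = fun x => \sum_k v 0 k * partial k u x.
  by apply/funext => x; apply: derive_partials; exact: (C1_on_diff u1).
move=> x; apply: continuous_sumR => k _; apply: continuousM.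
  exact: cst_continuous.
exact: (C1_on_partial u1).
Qed.

Lemma derive_support (u : 'rV[R]_n -> R) (v x : 'rV[R]_n) (r : R) :
  (forall x, r <= `|x| -> u x = 0) -> r < `|x| -> 'D_v u x = 0.
Proof.
move=> ur rx; rewrite (@near_eq_derive R _ _ u (cst 0)) ?derive_cst//.
have : \forall y \near x, r < `|y|.
  exact: (cvgr_gt _ (@norm_continuous _ _ x) _ rx).
by apply: filterS => y /ltW/ur.
Qed.

(* The derivative is moved off [u] by discrete differentiation: only difference quotients of
   [phi] appear, so no differentiability of [phi] is needed. *)
Lemma weak_derivative_bound (u phi : 'rV[R]_n -> R) (v : 'rV[R]_n) (B C d r : R) :
  C1_on setT u -> 0 < r -> (forall x, r <= `|x| -> u x = 0) ->
  measurable_fun setT (phi : borel 'rV[R]_n -> R) -> (forall x, `|phi x| <= C) ->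
  0 <= B -> 0 < d ->
  (forall h x, 0 < h < d -> u x != 0 -> `|phi (x - h *: v) - phi x| <= B * h) ->
  L.-integrable setT (EFin \o (fun x : borel 'rV[R]_n => phi x * 'D_v u x)) /\
  (`| \int[L]_x (phi x * 'D_v u x)%:E | <= B%:E * \int[L]_x `|u x|%:E)%E.
Proof.
move=> u1 r0 ur mphi phiC B0 d0 phiB.
have C0 : 0 <= C by exact: le_trans (phiC 0).
have cu : continuous u by move=> x; exact: (C1_on_cont u1).
have cDu := derive_continuous (v := v) u1.
have [K K0 DuK] : exists2 K, 0 <= K & forall x, `|'D_v u x| <= K.
  apply: (@bounded_of_support ('D_v u) (r + 1)) => // x xr.
  by apply: (derive_support v ur); apply: lt_le_trans xr; rewrite ltrDl.
have [Ku _ uK] := bounded_of_support cu ur.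
have mu_ : measurable_fun setT (u : borel 'rV[R]_n -> R) by exact: borel_measurable_continuous.
have mDu : measurable_fun setT ('D_v u : borel 'rV[R]_n -> R) by exact: borel_measurable_continuous.
(* [m.+2] and not [m.+1], so that the step is strictly below [d]. *)
pose h (m : nat) : R := d * m.+2%:R^-1.
have h0 m : 0 < h m by rewrite mulr_gt0// invr_gt0.
have hd m : h m < d by rewrite gtr_pMr// invf_lt1// ltr1n.
(* Outside the ball of radius [r'] both [u] and all its translates by [h m *: v] vanish. *)
pose r' := r + d * `|v|.
have r'0 : 0 < r' by rewrite ltr_wpDr// mulr_ge0// ltW.
have urh m x : r' <= `|x| -> u (x + h m *: v) = 0.
  move=> xr; apply: ur; have := lerB_normD x (h m *: v).
  rewrite normrZ (gtr0_norm (h0 m)).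
  have : h m * `|v| <= d * `|v| by rewrite ler_wpM2r// ltW.
  by rewrite /r' in xr; lra.
have ur' x : r' <= `|x| -> u x = 0.
  move=> xr; apply: ur; apply: le_trans xr.
  by rewrite lerDl mulr_ge0// ltW.
pose f (m : nat) (x : borel 'rV[R]_n) := phi x * ((h m)^-1 * (u (x + h m *: v) - u x)).
pose k m (x : borel 'rV[R]_n) := phi (x - h m *: v) * u x.
have mphit w : measurable_fun setT (fun x : borel 'rV[R]_n => phi (x + w)).
  by apply: (measurableT_comp mphi); exact: addr_measurable_rV.
have mut w : measurable_fun setT (fun x : borel 'rV[R]_n => u (x + w)).
  by apply: (measurableT_comp mu_); exact: addr_measurable_rV.
have mf m : measurable_fun setT (f m).
  apply: measurable_funM => //; apply: measurable_funM => //.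
  by apply: measurable_funB.
have iphiu : L.-integrable setT (EFin \o (fun x : borel 'rV[R]_n => phi x * u x)).
  apply: (@bounded_support_integrable _ (C * Ku) r) => //.
  - exact: measurable_funM.
  - by move=> x; rewrite normrM ler_pM.
  - by move=> x /ur ->; rewrite mulr0.
have ik m : L.-integrable setT (EFin \o k m).
  apply: (@bounded_support_integrable _ (C * Ku) r) => //.
  - exact: measurable_funM.
  - by move=> x; rewrite normrM ler_pM.
  - by move=> x xr; rewrite /k ur ?mulr0.
have fbound m : (`| \int[L]_x (f m x)%:E | <= B%:E * \int[L]_x `|u x|%:E)%E.
  have ikt : L.-integrable setT (fun x : borel 'rV[R]_n => (k m (x + h m *: v))%:E).
    exact: (integrable_translate_rV (h m *: v) (ik m)).
  have ibt := integrableB measurableT ikt iphiu.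
  have ib := integrableB measurableT (ik m) iphiu.
  (* Translation invariance moves the difference from [u] to [phi]: the integral of
     [phi x * u (x + h v)] is that of [phi (x - h v) * u x]. *)
  have -> : (\int[L]_x (f m x)%:E = \int[L]_x ((h m)^-1 * (k m x - phi x * u x))%:E)%E.
    transitivity ((h m)^-1%:E * (\int[L]_x (k m (x + h m *: v)%R)%:E - \int[L]_x (phi x * u x)%:E))%E.
      rewrite -(integralB measurableT ikt iphiu) -(integralZl measurableT ibt).
      apply: eq_integral => x _; rewrite /= -EFinB -EFinM; congr EFin.
      by rewrite /f /k addrK; ring.
    rewrite (@integral_translate_rV (h m *: v) (fun x => (k m x)%:E)); last first.
      by apply/measurable_EFinP; exact: measurable_funM.
    by rewrite -(integralB measurableT (ik m) iphiu) -(integralZl measurableT ib).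
  apply: le_trans (le_abse_integral _ _ _) _ => //.
    apply/measurable_EFinP; apply: measurable_funM => //.
    by apply: measurable_funB; apply: measurable_funM.
  rewrite -ge0_integralZl//=.
  - apply: ge0_le_integral => //=.
    + apply/measurable_EFinP; apply: measurableT_comp => //; apply: measurable_funM => //.
      by apply: measurable_funB; apply: measurable_funM.
    + apply: measurable_funeM; apply/measurable_EFinP; exact: measurableT_comp.
    + move=> x _; rewrite lee_fin /k -mulrBl normrM normrM gtr0_norm ?invr_gt0//.
      have [->|ux] := eqVneq (u x) 0; first by rewrite normr0 !mulr0.
      rewrite mulrA ler_wpM2r// mulrC ler_pdivrMr//.
      by apply: phiB => //; rewrite h0 hd.
  - by apply/measurable_EFinP; exact: measurableT_comp.
(* By the mean value theorem [K] bounds the difference quotients of [u] uniformly in [m], so that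
   [g] dominates every [f m]. *)
pose g (x : borel 'rV[R]_n) := C * K * \1_(ball (0 : 'rV[R]_n) r') x.
have mball : measurable (ball (0 : 'rV[R]_n) r' : set (borel 'rV[R]_n)).
  by apply: borel_open_measurable; exact: ball_open.
have ig : L.-integrable setT (EFin \o g).
  apply: (@bounded_support_integrable _ (C * K) r') => //.
  - by apply: measurable_funM => //; exact: measurable_indic.
  - move=> x; rewrite /g indicE normrM ger0_norm ?mulr_ge0//.
    by case: (_ \in _); rewrite ?normr1 ?normr0 ?mulr1 ?mulr0// mulr_ge0.
  - move=> x xr; rewrite /g indicE memNset ?mulr0//.
    by rewrite -ball_normE /= sub0r normrN; apply/negP; rewrite -leNgt.
have [|||||intf _ Hlim] := @dominated_convergence _ _ _ L setT measurableT
   (fun m => EFin \o f m) (EFin \o (fun x : borel 'rV[R]_n => phi x * 'D_v u x)) (EFin \o g).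
- by move=> m; exact/measurable_EFinP.
- by apply/measurable_EFinP; exact: measurable_funM.
- apply: aeW => x _; apply: cvg_EFin; first exact: nearW.
  rewrite (_ : (fine \o _) = (fun m => phi x * ((h m)^-1 * (u (x + h m *: v) - u x))))//.
  apply: cvgM; first exact: cvg_cst.
  have dq : e^-1 * (u (e *: v + x) - u x) @[e --> (0 : R)^'] --> 'D_v u x.
    exact: (diff_derivable (v := v) (C1_on_diff u1 (I : setT x))).
  move/cvgr_dnbhsP : dq => /(_ h) dq.
  rewrite (_ : (fun m => _) = (fun m => (h m)^-1 * (u (h m *: v + x) - u x))); last first.
    by apply/funext => m; rewrite [x + _]addrC.
  apply: dq.
  split=> [m|]; first by rewrite gt_eqF.
  rewrite -[X in _ --> X](mulr0 d); apply: cvgM; first exact: cvg_cst.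
  by rewrite (cvg_shiftS (@harmonic R)); exact: cvg_harmonic.
- exact: ig.
- apply: aeW => x m _; rewrite /= lee_fin /g indicE.
  have [xr|xr] := leP r' `|x|.
    by rewrite /f urh// ur'// subrr !mulr0 normr0 !mulr_ge0.
  rewrite mem_set ?mulr1; last by rewrite /= -ball_normE /= sub0r normrN.
  rewrite /f normrM ler_pM//.
  have [|c _ ->] := @mean_value_line _ _ u x v (h m).
    by move=> t _; exact/diff_derivable/(C1_on_diff u1).
  by rewrite mulrA mulVf ?mul1r// gt_eqF.
split=> //.
have Hcvg : (`|\int[L]_x (f m x)%:E|)%E @[m --> \oo] -->
    (`|\int[L]_x (phi x * 'D_v u x)%:E|)%E by apply: cvg_abse; exact: Hlim.
rewrite -(cvg_lim (@ereal_hausdorff R) Hcvg); apply: lime_le; first by apply/cvg_ex; eexists; exact: Hcvg.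
by apply: nearW => m; exact: fbound.
Qed.

End Translation.

(** * Integrals against a measure given by a density in a parametrization *)

Section DensityTransfer.
Context d1 d2 (T : measurableType d1) (S : measurableType d2) (R : realType).
Variables (m : {measure set T -> \bar R}) (k : {measure set S -> \bar R}).
Variables (p : S -> T) (w : S -> R) (D : set T) (E : set S).
Hypotheses (mD : measurable D) (mE : measurable E) (mp : measurable_fun E p)
  (mw : measurable_fun E w) (w0 : forall x, E x -> 0 <= w x) (pED : forall x, E x -> D (p x)).
Hypothesis mE_density : forall A : set T, measurable A -> A `<=` D ->
  m A = (\int[k]_(x in E) (w x * \1_A (p x))%:E)%E.
Import HBNNSimple.
Local Open Scope ereal_scope.

(** For indicators this is the hypothesis on the measure of subsets of [D]; linearity gives simple
    functions, and monotone convergence on both sides the rest. *)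
Lemma ge0_integral_density (f : T -> \bar R) :
  measurable_fun D f -> (forall x, D x -> 0 <= f x) ->
  \int[m]_(t in D) f t = \int[k]_(x in E) ((w x)%:E * f (p x)).
Proof.
move=> mf f0.
pose f_ := nnsfun_approx mD mf.
have mfp n : measurable_fun E (fun x => (f_ n (p x))%R).
  by apply: (@measurable_comp _ _ _ _ _ _ setT) => //; exact/measurable_funP.
transitivity (limn (fun n => \int[m]_(x in D) (f_ n x)%:E)).
  rewrite -monotone_convergence//.
  - apply: eq_integral => y /[!inE] yD; apply/esym/cvg_lim => //.
    exact: cvg_nnsfun_approx.
  - by move=> n; apply/measurable_EFinP/measurable_funTS; exact/measurable_funP.
  - by move=> n y _; rewrite lee_fin.
  - by move=> y _ a b ab; rewrite lee_fin; exact/lefP/nd_nnsfun_approx.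
transitivity (limn (fun n => \int[k]_(x in E) ((w x)%:E * (f_ n (p x))%:E))); last first.
  rewrite -monotone_convergence//.
  - apply: eq_integral => y /[!inE] yE; apply/cvg_lim => //.
    by apply: cvgeZl => //; apply: cvg_nnsfun_approx => //; exact: pED.
  - move=> n; under eq_fun do rewrite -EFinM.
    by apply/measurable_EFinP; exact: measurable_funM.
  - by move=> n y Ey; rewrite mule_ge0// lee_fin ?w0.
  - move=> y Ey a b ab; rewrite lee_wpmul2l ?lee_fin ?w0//.
    exact/lefP/nd_nnsfun_approx.
congr (limn _); apply/funext => n.
have mfn r : measurable (f_ n @^-1` [set r]) by [].
transitivity (\sum_(r \in range (f_ n)) (r%:E * m (f_ n @^-1` [set r] `&` D))).
  under eq_integral do rewrite fimfunE -fsumEFin//.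
  rewrite ge0_integral_fsum//; last 2 first.
  - by move=> y; exact/measurable_EFinP/measurable_funM.
  - by move=> y x _; rewrite nnfun_muleindic_ge0.
  by apply: eq_fsbigr => r _; rewrite integralZl_indic_nnsfun// integral_indic.
transitivity (\sum_(r \in range (f_ n))
    \int[k]_(x in E) (r%:E * (w x * \1_(f_ n @^-1` [set r]) (p x))%:E)); last first.
  rewrite -ge0_integral_fsum//.
  - apply: eq_integral => x _.
    under eq_fsbigr do rewrite -EFinM mulrCA EFinM.
    rewrite -ge0_mule_fsumr; last by move=> r; rewrite nnfun_muleindic_ge0.
    by rewrite fsumEFin// -fimfunE.
  - move=> r; apply: measurable_funeM; apply/measurable_EFinP.
    by apply: measurable_funM => //; exact: (@measurable_comp _ _ _ _ _ _ setT).
  - move=> r x Ex; rewrite -EFinM mulrCA EFinM mule_ge0 ?lee_fin ?w0//.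
    by have := nnfun_muleindic_ge0 (f_ n) r (p x); rewrite -EFinM lee_fin.
apply: eq_fsbigr => r /[!inE] -[t _ <-].
rewrite mE_density; [|exact: measurableI|by move=> x []].
rewrite -ge0_integralZl//=.
- apply: eq_integral => x /[!inE] Ex; congr (_ * (_ * _)%:E).
  by rewrite !indicE in_setI (mem_set (pED Ex)) andbT.
- apply/measurable_EFinP; apply: measurable_funM => //.
  apply: (@measurable_comp _ _ _ _ _ _ setT) => //.
  by apply: measurable_indic; exact: measurableI.
- by move=> x Ex; rewrite lee_fin mulr_ge0 ?w0.
- by rewrite lee_fin.
Qed.

(** The weight is nonnegative and so commutes with positive and negative parts; the identity holds
    whether or not [f] is integrable. *)
Lemma integral_density (f : T -> R) :
  measurable_fun D f ->
  \int[m]_(t in D) (f t)%:E = \int[k]_(x in E) (w x * f (p x))%:E.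
Proof.
move=> mf; have mfE : measurable_fun D (EFin \o f) by exact/measurable_EFinP.
rewrite integralE [RHS]integralE !ge0_integral_density//.
- congr (_ - _); apply: eq_integral => x /[!inE] Ex.
    by rewrite !funeposE /= EFinM maxe_pMr ?lee_fin ?w0// mule0.
  by rewrite !funenegE maxe_pMr ?lee_fin ?w0// mule0 muleN -EFinM.
- exact: measurable_funeneg.
- exact: measurable_funepos.
Qed.
End DensityTransfer.

(** * Derivative of a determinant *)

Section DeterminantDerivative.
Context {R : realType}.

Lemma partial_prod n (I : eqType) (k : 'I_n) (r : seq I) (f : I -> 'rV[R]_n -> R) (x : 'rV[R]_n) :
  uniq r -> (forall i, differentiable (f i) x) ->
  differentiable (fun y => \prod_(i <- r) f i y) x /\
  partial k (fun y => \prod_(i <- r) f i y) x =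
  \sum_(i <- r) partial k (f i) x * \prod_(j <- r | j != i) f j x.
Proof.
move=> + df; elim: r => [_|a r IH /andP[ar ur]].
  have -> : (fun y => \prod_(i <- [::]) f i y) = cst 1.
    by apply/funext => y; rewrite big_nil.
  by rewrite big_nil; split; [exact: differentiable_cst|exact: derive_cst].
have [dP pP] := IH ur.
have -> : (fun y => \prod_(i <- a :: r) f i y) = f a * (fun y => \prod_(i <- r) f i y).
  by apply/funext => y; rewrite big_cons.
split; first exact: differentiableM.
rewrite /partial deriveM; [|exact: diff_derivable|exact: diff_derivable].
rewrite -/(partial k _ x) pP big_cons [LHS]addrC; congr (_ + _).
  rewrite [LHS]mulrC; congr (_ * _); rewrite [RHS]big_cons eqxx /= big_seq_cond.
  rewrite [RHS]big_seq_cond; apply: eq_bigl => j.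
  by case: eqVneq => [->|]; rewrite ?(negbTE ar)// andbT.
rewrite scaler_sumr [LHS]big_seq [RHS]big_seq; apply: eq_bigr => i ir.
rewrite [RHS]mulrC big_cons ifT; last by apply: contraNneq ar => ->.
by rewrite [LHS]mulrCA mulrC mulrA.
Qed.

Lemma partial_sum n (I : Type) (k : 'I_n) (r : seq I) (f : I -> 'rV[R]_n -> R) (x : 'rV[R]_n) :
  (forall i, differentiable (f i) x) ->
  differentiable (fun y => \sum_(i <- r) f i y) x /\
  partial k (fun y => \sum_(i <- r) f i y) x = \sum_(i <- r) partial k (f i) x.
Proof.
move=> df; elim: r => [|a r [dS pS]].
  have -> : (fun y => \sum_(i <- [::]) f i y) = cst 0.
    by apply/funext => y; rewrite big_nil.
  by rewrite big_nil; split; [exact: differentiable_cst|exact: derive_cst].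
have -> : (fun y => \sum_(i <- a :: r) f i y) = f a + (fun y => \sum_(i <- r) f i y).
  by apply/funext => y; rewrite big_cons.
split; first exact: differentiableD.
rewrite big_cons -pS /partial deriveD//; exact: diff_derivable.
Qed.

Lemma C1_on_det n m (U : set 'rV[R]_n) (G : 'rV[R]_n -> 'M[R]_m) : open U ->
  (forall i j, C1_on U (fun x => G x i j)) -> C1_on U (fun x => \det (G x)).
Proof.
move=> oU GU; apply: C1_on_sum => // s _; apply: C1_onM => //.
  exact: C1_on_cst.
by apply: C1_on_prod => // i _; exact: GU.
Qed.

(** Jacobi's formula. By the Leibniz rule the derivative is the sum over [i] of the determinants of
    [B i], the matrix with row [i] differentiated, each expanded along that row. *)
Lemma partial_det n m (G : 'rV[R]_n -> 'M[R]_m) (x : 'rV[R]_n) k :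
  (forall i j, differentiable (fun y => G y i j) x) ->
  partial k (fun y => \det (G y)) x =
  \sum_i \sum_j partial k (fun y => G y i j) x * cofactor (G x) i j.
Proof.
move=> dG.
pose B i := \matrix_(a, b) (if a == i then partial k (fun y => G y a b) x else G x a b).
have detB i : \det (B i) = \sum_j partial k (fun y => G y i j) x * cofactor (G x) i j.
  rewrite (expand_det_row _ i); apply: eq_bigr => j _; rewrite mxE eqxx; congr (_ * _).
  rewrite /cofactor; congr (_ * \det _).
  by apply/matrixP => a b; rewrite !mxE eq_sym (negbTE (neq_lift _ _)).
under eq_bigr do rewrite -detB.
have dP (s : {perm 'I_m}) := partial_prod k (index_enum_uniq _) (fun i : 'I_m => dG i (s i)).
have dsP (s : {perm 'I_m}) :
    differentiable (fun y => (-1) ^+ s * \prod_(i < m) G y i (s i)) x.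
  by apply: differentiableM; [exact: differentiable_cst|have [] := dP s].
have [_ ->] := partial_sum k (index_enum _) dsP.
rewrite exchange_big /=; apply: eq_bigr => s _.
have [dp pp] := dP s.
have -> : (fun y => (-1) ^+ s * \prod_(i < m) G y i (s i)) =
   cst ((-1) ^+ s) * (fun y => \prod_(i < m) G y i (s i)) by [].
rewrite /partial deriveM; [|exact: derivable_cst|exact: diff_derivable].
rewrite derive_cst scaler0 addr0 -/(partial k _ x) pp [LHS]mulr_sumr; apply: eq_bigr => i _.
rewrite [in RHS](bigD1 i)//= mxE eqxx; congr (_ * (_ * _)).
by apply: eq_bigr => j ji; rewrite mxE (negbTE ji).
Qed.

(** Jacobi's formula in logarithmic form, [d det G = det G * tr (G^-1 dG)]. *)
Lemma partial_det_unit n m (G : 'rV[R]_n -> 'M[R]_m) (x : 'rV[R]_n) k :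
  (forall i j, differentiable (fun y => G y i j) x) -> G x \in unitmx ->
  partial k (fun y => \det (G y)) x =
  \det (G x) * \sum_i \sum_j invmx (G x) j i * partial k (fun y => G y i j) x.
Proof.
move=> dG uG; rewrite partial_det// mulr_sumr; apply: eq_bigr => i _.
rewrite mulr_sumr; apply: eq_bigr => j _.
have -> : cofactor (G x) i j = \det (G x) * invmx (G x) j i.
  rewrite /invmx uG !mxE mulrA divff ?mul1r//.
  by rewrite -unitfE -unitmxE.
ring.
Qed.

End DeterminantDerivative.

(** * Divergence in charts *)

Section ChartAnalysis.
Context {R : realType}.

Lemma continuous_ext (T U : topologicalType) (f g : T -> U) (x : T) :
  (forall y, g y = f y) -> {for x, continuous f} -> {for x, continuous g}.
Proof. by move=> /funext ->. Qed.

Lemma partial_near n (f h : 'rV[R]_n -> R) (x : 'rV[R]_n) k :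
  (\forall y \near x, f y = h y) -> partial k f x = partial k h x.
Proof. by move=> fh; rewrite /partial; apply: near_eq_derive. Qed.

Lemma continuous_prodR (T : topologicalType) (I : Type) (x : T) (r : seq I)
    (P : pred I) (f : I -> T -> R) :
  (forall i, P i -> {for x, continuous (f i)}) ->
  {for x, continuous (fun t => \prod_(i <- r | P i) f i t)}.
Proof. by move=> fc; apply: cvg_big => //; exact: mul_continuous. Qed.

Lemma continuous_det (T : topologicalType) n (x : T) (A : T -> 'M[R]_n) :
  (forall i j, {for x, continuous (fun t => A t i j)}) ->
  {for x, continuous (fun t => \det (A t))}.
Proof.
move=> Ac; apply: continuous_sumR => s _; apply: continuousM.
  exact: cst_continuous.
by apply: continuous_prodR => i _; exact: Ac.
Qed.

Definition quad n (A : 'M[R]_n) (v : 'rV[R]_n) : R := (v *m A *m v^T) 0 0.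

Lemma quadE n (A : 'M[R]_n) (v : 'rV[R]_n) :
  quad A v = \sum_i \sum_j v 0 i * A i j * v 0 j.
Proof.
rewrite /quad mxE exchange_big /=; apply: eq_bigr => j _; rewrite !mxE mulr_suml.
by apply: eq_bigr.
Qed.

Lemma continuous_quad (T : topologicalType) n (x : T) (A : T -> 'M[R]_n) (v : T -> 'rV[R]_n) :
  (forall i j, {for x, continuous (fun t => A t i j)}) ->
  (forall i, {for x, continuous (fun t => v t 0 i)}) ->
  {for x, continuous (fun t => quad (A t) (v t))}.
Proof.
move=> Ac vc; apply: continuous_ext (fun t => quadE (A t) (v t)) _.
apply: continuous_sumR => i _; apply: continuous_sumR => j _.
by apply: continuousM; [apply: continuousM; [exact: vc|exact: Ac]|exact: vc].
Qed.

Lemma posdef_unitmx n (A : 'M[R]_n) :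
  (forall v : 'rV[R]_n, v != 0 -> 0 < quad A v) -> A \in unitmx.
Proof.
move=> Apos; rewrite -row_free_unit -kermx_eq0; apply/rowV0P => v /sub_kermxP vA.
apply/eqP; apply/negPn/negP => v0; have := Apos v v0.
by rewrite /quad vA mul0mx mxE ltxx.
Qed.

(** The segment from the identity to [A] consists of positive definite, hence invertible matrices;
    the determinant is 1 at its start and cannot reach 0. *)
Lemma posdef_det_gt0 n (A : 'M[R]_n) :
  (forall v : 'rV[R]_n, v != 0 -> 0 < quad A v) -> 0 < \det A.
Proof.
move=> Apos; rewrite ltNge; apply/negP => detA.
pose B (t : R) : 'M[R]_n := t *: A + (1 - t) *: 1%:M.
have cB (t : R) : {for t, continuous (fun t : R => \det (B t))}.
  apply: continuous_det => i j.
  apply: (@continuous_ext _ _ (fun t : R => t * A i j + (1 - t) * (1%:M : 'M[R]_n) i j)).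
    by move=> s; rewrite !mxE.
  apply: continuousD; apply: continuousM.
  + exact: cvg_id.
  + exact: cst_continuous.
  + by apply: continuousB; [exact: cst_continuous|exact: cvg_id].
  + exact: cst_continuous.
have [||t t01 Bt] := @IVT R (fun t => \det (B t)) 0 1 0 ler01.
- by apply: continuous_subspaceT => t; exact: cB.
- rewrite /B scale0r add0r subr0 !scale1r det1 subrr scale0r addr0.
  by rewrite ge_min detA orbT le_max ler01.
move: t01; rewrite in_itv /= => /andP[t0 t1].
have : B t \in unitmx.
  apply: posdef_unitmx => v v0.
  have -> : quad (B t) v = t * quad A v + (1 - t) * quad 1%:M v.
    by rewrite /quad /B mulmxDr mulmxDl -!scalemxAr -!scalemxAl !mxE.
  have v1 : 0 < quad 1%:M v.
    rewrite /quad mulmx1 mxE.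
    have [k vk] : exists k, v 0 k != 0 by apply/rV0Pn.
    rewrite (bigD1 k)//= ltr_pwDl//.
      by rewrite !mxE -expr2 exprn_even_gt0.
    by apply: sumr_ge0 => j _; rewrite !mxE -expr2 sqr_ge0.
  have [->|tn0] := eqVneq t 0; first by rewrite mul0r add0r subr0 mul1r.
  rewrite ltr_pwDl ?mulr_gt0 ?Apos ?lt_def ?tn0//.
  by rewrite mulr_ge0 ?subr_ge0// ltW.
by rewrite unitmxE unitfE Bt eqxx.
Qed.

End ChartAnalysis.

Section LocalDivergence.
Context {R : realType} {n : nat} {M : oriented_manifold R n}.
Variables (g : riemannian_metric M) (X : vector_field M).

Lemma codom_isopen (i : chart M) : open (codom i).
Proof. exact: codom_open. Qed.
Hint Resolve codom_isopen : core.

Lemma metric_C1 (i : chart M) a b : C1_on (codom i) (fun x => g i x a b).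
Proof. apply: Ck1_entry => //; exact: (metric_smooth g i 1). Qed.

Lemma field_C1 (i : chart M) a : C1_on (codom i) (fun x => X i x 0 a).
Proof. apply: Ck1_entry => //; exact: (field_smooth X i 1). Qed.

Lemma metric_det_gt0 (i : chart M) x : codom i x -> 0 < \det (g i x).
Proof. by move=> ix; apply: posdef_det_gt0 => v v0; exact: metric_pos. Qed.

Definition vol_density (i : chart M) (x : 'rV[R]_n) : R := Num.sqrt (\det (g i x)).

Lemma vol_density_gt0 i x : codom i x -> 0 < vol_density i x.
Proof. by move=> ix; rewrite sqrtr_gt0 metric_det_gt0. Qed.

Lemma vol_density_C1 i : C1_on (codom i) (vol_density i).
Proof.
apply: (@C1_on_comp1 _ _ _ (fun x => \det (g i x)) Num.sqrt (fun y => (2 * Num.sqrt y)^-1)) => //.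
  by apply: C1_on_det => // a b; exact: metric_C1.
move=> x ix; have dx := metric_det_gt0 ix; split; first exact: is_derive1_sqrt.
apply: continuousV; first by rewrite mulf_neq0// gt_eqF// sqrtr_gt0.
by apply: continuousM; [exact: cst_continuous|exact: sqrt_continuous].
Qed.

(** [divergence] evaluates this in the chart picked by [chart_at]; here the chart is free, and
    [local_div_chart] shows that the choice does not matter. *)
Definition local_div (i : chart M) (x : 'rV[R]_n) : R := \tr (covariant_derivative g X i x).

(** By symmetry of the metric and of its inverse, the first and the last derivative in
    [Gamma^k_{kb}] cancel after summation over [k] and [l]. *)
Lemma christoffel_trace i b x : codom i x ->
  \sum_k christoffel g i k k b x =
  2^-1 * \sum_k \sum_l invmx (g i x) l k * partial b (fun y => g i y k l) x.
Proof.
move=> ix; rewrite /christoffel -mulr_sumr; congr (_ * _).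
have isym k l : invmx (g i x) k l = invmx (g i x) l k.
  by rewrite -[in LHS](metric_sym g ix) -trmx_inv mxE.
have psym k l m : partial m (fun y => g i y k l) x = partial m (fun y => g i y l k) x.
  apply: partial_near; apply: (near_open (@codom_isopen i) ix) => y iy.
  by rewrite -[in LHS](metric_sym g iy) mxE.
under eq_bigr do under eq_bigr do rewrite mulrBr mulrDr.
under eq_bigr do rewrite big_split /= big_split /= sumrN.
rewrite big_split /= big_split /= sumrN.
under [in RHS]eq_bigr do under eq_bigr do rewrite isym.
set S1 := \sum_k \sum_l _ * partial k (fun y => g i y b l) x.
have -> : \sum_k \sum_l invmx (g i x) k l * partial l (fun y => g i y k b) x = S1.
  rewrite exchange_big /=; apply: eq_bigr => k _; apply: eq_bigr => l _.
  by rewrite isym psym.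
by rewrite addrAC subrr add0r.
Qed.

(** The classical formula [sqrt(det g) div X = d_k (sqrt(det g) X^k)]: by Jacobi's formula the
    logarithmic derivative of the density is the trace of the Christoffel symbols, which accounts
    for the terms of order zero in [X]. *)
Lemma vol_density_div i x : codom i x ->
  vol_density i x * local_div i x =
  \sum_k partial k (fun y => vol_density i y * X i y 0 k) x.
Proof.
move=> ix.
have dw := C1_on_diff (@vol_density_C1 i) ix.
have dX k := C1_on_diff (@field_C1 i k) ix.
have gd := metric_det_gt0 ix.
have pw b : partial b (vol_density i) x = vol_density i x * \sum_k christoffel g i k k b x.
  have [|_ ->] := @partial_comp1 R n (fun y => \det (g i y)) Num.sqrt _ x b _ (is_derive1_sqrt gd).
    by apply: (C1_on_diff _ ix); apply: C1_on_det => // c d; exact: metric_C1.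
  rewrite partial_det_unit; last 2 first.
  - by move=> c d; exact: (C1_on_diff (@metric_C1 i c d)).
  - by apply: posdef_unitmx => v v0; exact: metric_pos.
  rewrite christoffel_trace//.
  set S := \sum_k \sum_l _; rewrite -/(vol_density i x).
  have -> : \det (g i x) = vol_density i x ^+ 2 by rewrite sqr_sqrtr// ltW.
  by field; rewrite gt_eqF// vol_density_gt0.
under [RHS]eq_bigr => k _.
  rewrite /partial deriveM; [|exact: diff_derivable|exact: diff_derivable].
  over.
rewrite /= big_split /= /local_div /mxtrace /covariant_derivative.
under [in LHS]eq_bigr do rewrite mxE.
rewrite big_split /= mulrDr; congr (_ + _).
  by rewrite mulr_sumr.
rewrite exchange_big mulr_sumr /=; apply: eq_bigr => b _.
by rewrite -/(partial b _ x) pw -mulr_suml /GRing.scale /=; ring.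
Qed.

Lemma vol_field_C1 i k : C1_on (codom i) (fun y => vol_density i y * X i y 0 k).
Proof. by apply: C1_onM => //; [exact: vol_density_C1|exact: field_C1]. Qed.

(** Continuity is read off the formula with the density, which avoids the inverse matrix in the
    Christoffel symbols. *)
Lemma local_div_continuous i x : codom i x -> {for x, continuous (local_div i)}.
Proof.
move=> ix.
apply: (@continuous_near_eq _ _ (fun y =>
  (vol_density i y)^-1 * \sum_k partial k (fun y => vol_density i y * X i y 0 k) y)).
  apply: (near_open (@codom_isopen i) ix) => y iy.
  by rewrite -vol_density_div// mulrA mulVf ?mul1r// gt_eqF// vol_density_gt0.
apply: continuousM.
  apply: continuousV; first by rewrite gt_eqF// vol_density_gt0.
  exact: (C1_on_cont (@vol_density_C1 i)).
apply: continuous_sumR => k _; exact: (C1_on_partial (@vol_field_C1 i k)).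
Qed.

End LocalDivergence.

(** * Cutoff functions *)

Section Bump.
Context {R : realType}.

(** Squaring makes the positive part a function of class C1. *)
Definition pos_sq (t : R) : R := (Num.max 0 t) ^+ 2.

Lemma pos_sq_is_derive (t : R) : is_derive t 1 pos_sq (2 * Num.max 0 t).
Proof.
have [t0|t0|->] := ltgtP t 0.
- rewrite mulr0; apply: (@near_eq_is_derive _ _ _ (cst 0)).
  have : \forall s \near t, s < 0 by exact: lt_nbhsl.
  by apply: filterS => s s0; rewrite /pos_sq /= (max_idPl (ltW s0)) expr0n.
- apply: (@near_eq_is_derive _ _ _ ((id : R -> R) * id)).
    have : \forall s \near t, 0 < s by exact: lt_nbhsr.
    by apply: filterS => s s0; rewrite /pos_sq /= (max_idPr (ltW s0)) expr2.
  apply: is_derive_eq.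
  by rewrite /GRing.scale /= mulr1; ring.
rewrite mulr0.
have H : h^-1 *: (pos_sq (h *: 1 + 0) - pos_sq 0) @[h --> (0 : R)^'] --> (0 : R).
  apply/cvgrPdist_lt => e e0; near=> h.
  rewrite /pos_sq maxxx addr0 expr0n subr0 sub0r normrN /GRing.scale /= mulr1.
  have hn0 : h != 0 by near: h; exact: nbhs_dnbhs_neq.
  rewrite normrM normfV normrX.
  have mh : `|Num.max 0 h| <= `|h| by have [] := leP 0 h; rewrite ?normr0.
  have he : `|h| < e by near: h; exact: dnbhs0_lt.
  apply: le_lt_trans he; rewrite ler_pdivrMl ?normr_gt0// -expr2.
  by rewrite ler_sqr ?nnegrE.
by split; [exact/cvg_ex/ex_intro/H|exact: cvg_lim H].
Unshelve. all: by end_near. Qed.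

Lemma pos_sq_derive_continuous (t : R) : {for t, continuous (fun s : R => 2 * Num.max 0 s)}.
Proof.
apply: continuousM; first exact: cst_continuous.
by apply: continuous_max; [exact: cst_continuous|exact: cvg_id].
Qed.

Lemma pos_sq_ge0 t : 0 <= pos_sq t. Proof. exact: sqr_ge0. Qed.

Lemma pos_sq_eq0 t : t <= 0 -> pos_sq t = 0.
Proof. by move=> t0; rewrite /pos_sq (max_idPl t0) expr0n. Qed.

Lemma pos_sq_ge1 t : 1 <= t -> 1 <= pos_sq t.
Proof.
by move=> t1; rewrite /pos_sq (max_idPr (le_trans ler01 t1)) exprn_ege1.
Qed.

Lemma pos_sq_le1 t : t <= 1 -> pos_sq t <= 1.
Proof.
by move=> t1; rewrite /pos_sq exprn_ile1// ?le_max ?lexx// ge_max ler01.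
Qed.

Lemma C1_on_pos_sq n (U : set 'rV[R]_n) f : open U -> C1_on U f -> C1_on U (fun x => pos_sq (f x)).
Proof.
move=> oU fU; apply: (C1_on_comp1 (dh := fun s => 2 * Num.max 0 s)) => // x Ux.
by split; [exact: pos_sq_is_derive|exact: pos_sq_derive_continuous].
Qed.

Lemma C1_on_coord n (U : set 'rV[R]_n) k : open U -> C1_on U (fun x => x 0 k).
Proof.
move=> oU; apply: (@C1_on_near _ _ _ _ (fun j _ => (delta_mx 0 j : 'rV[R]_n) 0 k)) => //.
- by move=> x _; exact: differentiable_coord.
- move=> x j _; rewrite /partial.
  have := @derive_mx R _ 1 n (id : 'rV[R]_n -> 'rV[R]_n) x (delta_mx 0 j) (@derivable_id _ _ _ _).
  by rewrite derive_id => /matrixP/(_ 0 k); rewrite !mxE => <-.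
- by move=> x j _; exact: cst_continuous.
Qed.

Lemma bump_rV n (a : 'rV[R]_n) (r : R) : 0 < r -> exists beta : 'rV[R]_n -> R,
  [/\ C1_on setT beta, forall x, 0 <= beta x <= 1,
      forall x, r <= `|x - a| -> beta x = 0 & \forall x \near a, beta x = 1].
Proof.
move=> r0.
pose s (x : 'rV[R]_n) := \sum_k (x 0 k - a 0 k) * (x 0 k - a 0 k).
have sC1 : C1_on setT s.
  apply: C1_on_sum; first exact: openT.
  move=> k _; have kC1 : C1_on setT (fun x : 'rV[R]_n => x 0 k - a 0 k).
    apply: C1_onD; [exact: openT| |exact: C1_on_cst].
    by apply: C1_on_coord; exact: openT.
  exact: (C1_onM openT kC1 kC1).
(* [s] is the squared Euclidean distance to [a], which dominates the square of the sup norm. Where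
   [s <= c] the inner [pos_sq] below is at least 1 and the outer one vanishes; where
   [s >= 2 * c = r ^+ 2] the inner one vanishes and the outer one is 1. *)
pose c := r ^+ 2 / 2.
have c0 : 0 < c by rewrite divr_gt0// exprn_gt0.
exists (fun x => 1 - pos_sq (1 - pos_sq (2 - s x / c))); split.
- have oT := @openT 'rV[R]_n.
  have subC1 (f : 'rV[R]_n -> R) (d : R) : C1_on setT f -> C1_on setT (fun x => d - f x).
    move=> fC1; have -> : (fun x => d - f x) = (fun x => d + (-1) * f x).
      by apply/funext => x; rewrite mulN1r.
    exact: (C1_onD oT (C1_on_cst d) (C1_onM oT (C1_on_cst (-1)) fC1)).
  have C1s := subC1 _ 2 (C1_onM oT sC1 (C1_on_cst c^-1)).
  exact: (subC1 _ 1 (C1_on_pos_sq oT (subC1 _ 1 (C1_on_pos_sq oT C1s)))).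
- move=> x; rewrite subr_ge0 lerBlDr lerDl pos_sq_ge0 andbT pos_sq_le1//.
  by rewrite lerBlDr lerDl pos_sq_ge0.
- move=> x xr.
  have sr : r ^+ 2 <= s x.
    have [k rk] : exists k, r <= `|x 0 k - a 0 k|.
      apply/not_existsP => H; move: xr; apply/negP; rewrite -ltNge.
      apply/mx_norm_ltP => // i j; rewrite (ord1 i) !mxE ltNge.
      by apply/negP; exact: H.
    rewrite /s (bigD1 k)//= -[leLHS]addr0; apply: lerD.
      by rewrite -expr2 -(real_normK (num_real (x 0 k - a 0 k))) ler_sqr ?nnegrE// ltW.
    by apply: sumr_ge0 => j _; rewrite -expr2 sqr_ge0.
  rewrite (@pos_sq_eq0 (2 - _)); last first.
    by rewrite subr_le0 ler_pdivlMr// /c mulrCA divff ?mulr1// pnatr_eq0.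
  by rewrite subr0 /pos_sq (max_idPr ler01) expr1n subrr.
- have : \forall x \near a, s x < c.
    have sc : {for a, continuous s} by exact: (C1_on_cont sC1).
    apply: (cvgr_lt _ sc); rewrite /s big1// => k _.
    by rewrite subrr mulr0.
  apply: filterS => x sxc; rewrite (@pos_sq_eq0 (1 - _)) ?subr0//.
  rewrite subr_le0; apply: pos_sq_ge1.
  by rewrite lerBrDr -lerBrDl ler_pdivrMr//; apply: ltW; lra.
Qed.

End Bump.

(** * Charts, transition maps and C1 functions on the manifold *)

Section Charts.
Context {R : realType} {n : nat} {M : oriented_manifold R n}.

Lemma codomP (i : chart M) x : codom i x -> dom i (param i x) /\ coord i (param i x) = x.
Proof. by move=> [p ip <-]; rewrite coordK. Qed.

Lemma codom_coord (i : chart M) p : dom i p -> codom i (coord i p).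
Proof. by move=> ip; exists p. Qed.

Lemma overlapE (i j : chart M) : overlap i j = codom i `&` param i @^-1` (dom j).
Proof.
apply/seteqP; split=> x /=.
  by move=> [p [ip jp] <-]; split; [exists p|rewrite coordK].
by move=> [/codomP[ix xE] jx]; exists (param i x).
Qed.

Lemma overlap_coord (i j : chart M) p : dom i p -> dom j p -> overlap i j (coord i p).
Proof. by move=> ip jp; exists p. Qed.

Lemma nbhs_param (i : chart M) x (U : set M) : codom i x -> nbhs (param i x) U ->
  \forall y \near x, codom i y /\ U (param i y).
Proof.
move=> ix Ux; apply: filterI; first exact: (near_open (@codom_isopen _ _ _ i) ix).
exact: (@param_continuous _ _ M i x ix).
Qed.

Lemma overlap_isopen (i j : chart M) : open (overlap i j).
Proof.
rewrite overlapE openE => x [ix jx].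
apply: nbhs_param => //; apply: open_nbhs_nbhs; split => //; exact: dom_open.
Qed.

Lemma transition_param (i j : chart M) x : overlap i j x ->
  param j (transition i j x) = param i x.
Proof. by rewrite overlapE => -[ix jx]; rewrite /transition /= coordK. Qed.

Lemma transition_codom (i j : chart M) x : overlap i j x -> codom j (transition i j x).
Proof. by rewrite overlapE => -[ix jx]; exact: codom_coord. Qed.

Lemma transition_C1 (i j : chart M) k : C1_on (overlap i j) (fun x => transition i j x 0 k).
Proof.
apply: Ck1_entry; [exact: overlap_isopen|exact: (@transition_smooth _ _ M i j 1)].
Qed.

Lemma transition_diff (i j : chart M) x : overlap i j x -> differentiable (transition i j) x.
Proof.
move=> ijx; apply: differentiable_entries => a b; rewrite (ord1 a).
exact: (C1_on_diff (@transition_C1 i j b)).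
Qed.

Definition C1_fun (f : M -> R) : Prop := forall j : chart M, C1_on (codom j) (f \o param j).

(** Allows a different expression around each point, as for a function given by a chart on its
    domain and by zero elsewhere. *)
Lemma C1_on_local m (U : set 'rV[R]_m) (f : 'rV[R]_m -> R) :
  (forall x, U x -> exists V h, [/\ open V, V x, C1_on V h & forall y, V y -> h y = f y]) ->
  C1_on U f.
Proof.
move=> H x Ux; have [V [h [oV Vx hV hf]]] := H x Ux.
have nV : \forall y \near x, h y = f y by exact: (near_open oV Vx).
split; first exact: (near_eq_differentiable nV (C1_on_diff hV Vx)).
move=> k; apply: continuous_near_eq (C1_on_partial hV Vx).
apply: (near_open oV Vx) => y Vy; apply: partial_near; exact: (near_open oV Vy).
Qed.

Lemma chart_closed_ball (i : chart M) p (U : set M) : dom i p -> nbhs p U ->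
  exists2 r : R, 0 < r & forall x, `|x - coord i p| <= r -> codom i x /\ U (param i x).
Proof.
move=> ip Up.
have := nbhs_param (codom_coord ip); rewrite coordK// => /(_ _ Up) /nbhs_ballP[r /= r0 rU].
exists (r / 2); first by rewrite divr_gt0.
move=> x xr; apply: rU; rewrite -ball_normE /= distrC; apply: le_lt_trans xr _.
by rewrite ltr_pdivrMr// ltr_pMr// ltr1n.
Qed.

Lemma compact_param_ball (i : chart M) a (r : R) :
  0 < r -> (forall x, `|x - a| <= r -> codom i x) ->
  compact (param i @` [set x : 'rV[R]_n | `|x - a| <= r]).
Proof.
move=> r0 rU.
apply: continuous_compact.
  apply: continuous_in_subspaceT => x; rewrite inE /= => xr.
  exact: (@param_continuous _ _ M i x (rU x xr)).
have -> : [set x : 'rV[R]_n | `|x - a| <= r] = closed_ball a r.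
  by rewrite closed_ballE//; apply/seteqP; split => x; rewrite /closed_ball_ /= distrC.
apply: bounded_closed_compact; last exact: closed_ball_closed.
exists (`|a| + r); split; first exact: num_real.
move=> y ry x; rewrite closed_ballE// /closed_ball_ /= => xr.
have := ler_distD a 0 x; rewrite !sub0r !normrN; lra.
Qed.

(** The bump of a coordinate ball, extended by zero. At points outside [dom i] it is locally zero:
    its support lies in the image of a closed coordinate ball, which is compact, hence closed
    because the manifold is Hausdorff. *)
Lemma bump_manifold (i : chart M) p (U : set M) : dom i p -> nbhs p U ->
  exists f : M -> R, exists2 r : R, 0 < r &
  [/\ C1_fun f, forall q, 0 <= f q <= 1, \forall q \near p, f q = 1,
      forall x, `|x - coord i p| <= r -> codom i x /\ U (param i x) &
      forall q, f q != 0 -> dom i q /\ `|coord i q - coord i p| <= r].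
Proof.
move=> ip Up; have [r r0 rU] := chart_closed_ball ip Up.
have [b [bC1 b01 b0 b1]] := bump_rV (coord i p) r0.
pose f q := if `[< dom i q >] then b (coord i q) else 0.
have fin q : dom i q -> f q = b (coord i q) by move=> iq; rewrite /f asboolT.
have fout q : ~ dom i q -> f q = 0 by move=> iq; rewrite /f asboolF.
have fsupp q : f q != 0 -> dom i q /\ `|coord i q - coord i p| <= r.
  have [iq|iq] := pselect (dom i q); last by rewrite fout ?eqxx.
  rewrite fin// => bq; split => //; rewrite leNgt; apply/negP => /ltW/b0 e.
  by rewrite e eqxx in bq.
exists f, r => //; split=> //.
- move=> j; apply: C1_on_local => x jx.
  have [iq|iq] := pselect (dom i (param j x)).
    exists (overlap j i), (fun y => b (transition j i y)); split.
    - exact: overlap_isopen.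
    - by rewrite overlapE.
    - apply: (C1_on_comp (V := setT) (@overlap_isopen j i) bC1) => //.
      by move=> k; exact: transition_C1.
    - by move=> y; rewrite overlapE => -[_ iy] /=; rewrite fin.
  pose K := param i @` [set y : 'rV[R]_n | `|y - coord i p| <= r].
  have cK : closed K.
    apply: compact_closed; first exact: manifold_hausdorff.
    by apply: compact_param_ball => // y yr; have [] := rU y yr.
  have nK : (~` K) (param j x).
    by move=> [y yr yx]; apply: iq; rewrite -yx; have [/codomP[]] := rU y yr.
  exists (interior (codom j `&` param j @^-1` (~` K))), (fun=> 0); split.
  + exact: open_interior.
  + by apply: nbhs_param => //; apply: open_nbhs_nbhs; split => //; exact: closed_openC.
  + exact: C1_on_cst.
  + move=> y /interior_subset[jy Ky]; apply/esym/eqP/negPn/negP => /fsupp[idom iyr].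
    by apply: Ky; exists (coord i (param j y)); rewrite ?coordK.
- move=> q; rewrite /f; case: asboolP => // _; by rewrite lexx ler01.
- have : \forall q \near p, dom i q /\ b (coord i q) = 1.
    apply: filterI; first by apply: open_nbhs_nbhs; split => //; exact: dom_open.
    exact: (@Defs.coord_continuous _ _ M i p ip _ b1).
  by apply: filterS => q [iq bq]; rewrite fin.
Qed.

Lemma C1_fun_cst c : C1_fun (fun=> c).
Proof. by move=> j; exact: C1_on_cst. Qed.

Lemma C1_funM f h : C1_fun f -> C1_fun h -> C1_fun (fun p => f p * h p).
Proof. by move=> fC hC j; exact: (C1_onM (@codom_isopen _ _ _ j) (fC j) (hC j)). Qed.

Lemma C1_funB1 f : C1_fun f -> C1_fun (fun p => 1 - f p).
Proof.
move=> fC j; have -> : (fun p => 1 - f p) \o param j = fun x => 1 + (-1) * (f \o param j) x.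
  by apply/funext => x; rewrite mulN1r.
have oj := @codom_isopen _ _ _ j.
exact: (C1_onD oj (C1_on_cst 1) (C1_onM oj (C1_on_cst (-1)) (fC j))).
Qed.

Lemma C1_fun_continuous f : C1_fun f -> continuous f.
Proof.
move=> fC p; have [i ip] := dom_cover p.
have H : {for p, continuous ((f \o param i) \o coord i)}.
  apply: continuous_comp; first exact: Defs.coord_continuous.
  exact: (C1_on_cont (fC i) (codom_coord ip)).
apply: continuous_near_eq H; apply: (near_open (dom_open i) ip) => q iq /=.
by rewrite coordK.
Qed.

Definition dfun (i : chart M) (f : M -> R) (x v : 'rV[R]_n) : R :=
  \sum_k v 0 k * partial k (f \o param i) x.

Lemma jacobian_transition (i j : chart M) x k l : overlap i j x ->
  jacobian (transition i j) x k l = partial k (fun y => transition i j y 0 l) x.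
Proof. by move=> ijx; rewrite jacobian_entry//; exact: transition_diff. Qed.

Lemma dfun_transition (i j : chart M) f x v : C1_fun f -> overlap i j x ->
  dfun i f x v = dfun j f (transition i j x) (v *m jacobian (transition i j) x).
Proof.
move=> fC ijx; rewrite /dfun.
under eq_bigr => k _.
  have -> : partial k (f \o param i) x = partial k ((f \o param j) \o transition i j) x.
    apply: partial_near; apply: (near_open (@overlap_isopen i j) ijx) => y ijy /=.
    by rewrite -(transition_param ijy).
  rewrite partial_comp; [|exact: transition_diff|exact: (C1_on_diff (fC j) (transition_codom ijx))].
  rewrite mulr_sumr; over.
rewrite exchange_big; apply: eq_bigr => l _ /=; rewrite mxE mulr_suml.
by apply: eq_bigr => k _; rewrite jacobian_transition// mulrA.
Qed.

End Charts.

(** * Curves and the Riemannian distance *)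

Section NormsCurves.
Context {R : realType} {n : nat} {M : oriented_manifold R n}.
Variables (g : riemannian_metric M).

Lemma continuous_matrix (T : topologicalType) m k (x : T) (F : T -> 'M[R]_(m, k)) :
  (forall i j, {for x, continuous (fun t => F t i j)}) -> {for x, continuous F}.
Proof.
move=> Fc; apply/(@cvgrPdist_lt R 'M[R]_(m, k) T (nbhs x)) => e e0.
have : \forall t \near x, forall ij : 'I_m * 'I_k, `|F x ij.1 ij.2 - F t ij.1 ij.2| < e.
  apply: near_finite => -[i j] /=.
  by move/cvgrPdist_lt : (Fc i j); exact.
apply: filterS => t H; apply/mx_norm_ltP => // i j.
by rewrite !mxE; exact: (H (i, j)).
Qed.

Lemma local_normE (i : chart M) x v : local_norm g i x v = Num.sqrt (quad (g i x) v).
Proof. by []. Qed.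

Lemma local_norm_ge0 (i : chart M) x v : 0 <= local_norm g i x v.
Proof. exact: sqrtr_ge0. Qed.

Lemma local_normZ (i : chart M) x a v :
  local_norm g i x (a *: v) = `|a| * local_norm g i x v.
Proof.
rewrite !local_normE; have -> : quad (g i x) (a *: v) = a ^+ 2 * quad (g i x) v.
  rewrite !quadE mulr_sumr; apply: eq_bigr => b _; rewrite mulr_sumr.
  by apply: eq_bigr => d _; rewrite !mxE; ring.
by rewrite sqrtrM ?sqr_ge0// sqrtr_sqr.
Qed.

Lemma local_norm_transition (i j : chart M) x v : overlap i j x ->
  local_norm g i x v = local_norm g j (transition i j x) (v *m jacobian (transition i j) x).
Proof.
move=> ijx; rewrite !local_normE; congr Num.sqrt; rewrite /quad (metric_compat g ijx).
by rewrite trmx_mul !mulmxA.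
Qed.

Lemma field_norm_chart (X : vector_field M) (i : chart M) p : dom i p ->
  field_norm g X p = local_norm g i (coord i p) (X i (coord i p)).
Proof.
move=> ip; rewrite /field_norm; set j := chart_at p.
have jp : dom j p by rewrite /j /chart_at; case: cid.
have ijx := overlap_coord ip jp.
rewrite (local_norm_transition _ ijx) -(field_compat X ijx).
by rewrite /transition /= coordK.
Qed.

Lemma continuous_local_norm (T : topologicalType) (t : T) (i : chart M)
    (x v : T -> 'rV[R]_n) :
  codom i (x t) -> {for t, continuous x} -> {for t, continuous v} ->
  {for t, continuous (fun s => local_norm g i (x s) (v s))}.
Proof.
move=> ix xc vc.
apply: (@continuous_comp _ _ _ (fun s => quad (g i (x s)) (v s)) Num.sqrt); last exact: sqrt_continuous.
apply: continuous_quad => a; last first.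
  by apply: (@continuous_comp _ _ _ v (fun w : 'rV[R]_n => w 0 a)); [exact: vc|exact: continuous_entry].
move=> b; apply: (@continuous_comp _ _ _ x (fun y => g i y a b)); first exact: xc.
exact: (C1_on_cont (@metric_C1 _ _ _ g i a b)).
Qed.

Lemma curve_transition (c : R -> M) (i j : chart M) t : C1_curve c ->
  dom i (c t) -> dom j (c t) ->
  derive1 (coord j \o c) t =
  derive1 (coord i \o c) t *m jacobian (transition i j) (coord i (c t)).
Proof.
move=> [cc cd] ic jc.
have ijx := overlap_coord ic jc.
have [/derivable1_diffP di _] := cd i t ic.
rewrite !derive1E.
rewrite (@near_eq_derive _ _ _ _ (transition i j \o (coord i \o c))); last first.
  have : \forall s \near t, dom i (c s).
    by apply: (cc t); apply: open_nbhs_nbhs; split => //; exact: dom_open.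
  by apply: filterS => s is_; rewrite /transition /= coordK.
have dT := transition_diff ijx.
rewrite deriveE; last exact: differentiable_comp.
by rewrite diff_comp//= -(deriveE _ di) -(deriveE _ dT) deriveEjacobian.
Qed.

Lemma chart_atP (p : M) : dom (chart_at p) p.
Proof. by rewrite /chart_at; case: cid. Qed.

Lemma speed_chart (c : R -> M) (i : chart M) t : C1_curve c -> dom i (c t) ->
  speed g c t = local_norm g i (coord i (c t)) (derive1 (coord i \o c) t).
Proof.
move=> cC ic; rewrite /speed; have jc := chart_atP (c t).
have ijx := overlap_coord ic jc.
rewrite (local_norm_transition _ ijx) -(curve_transition cC ic jc).
by rewrite /transition /= coordK.
Qed.

Lemma near_dom_curve (c : R -> M) (i : chart M) t : C1_curve c -> dom i (c t) ->
  \forall s \near t, dom i (c s).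
Proof.
by move=> [cc _] ic; apply: (cc t); apply: open_nbhs_nbhs; split => //; exact: dom_open.
Qed.

Lemma speed_continuous (c : R -> M) : C1_curve c -> continuous (speed g c).
Proof.
move=> cC t; have [i ic] := dom_cover (c t).
have [cc cd] := cC; have [di dc] := cd i t ic.
apply: (@continuous_near_eq _ _
  (fun s => local_norm g i (coord i (c s)) (derive1 (coord i \o c) s))).
  by apply: filterS (near_dom_curve cC ic) => s is_; rewrite (speed_chart cC is_).
apply: continuous_local_norm => //; first exact: codom_coord.
by apply: continuous_comp; [exact: cc|exact: Defs.coord_continuous].
Qed.

Lemma speed_ge0 (c : R -> M) t : 0 <= speed g c t.
Proof. exact: sqrtr_ge0. Qed.

Lemma is_derive_along (c : R -> M) (f : M -> R) (i : chart M) t : C1_curve c -> C1_fun f ->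
  dom i (c t) ->
  is_derive t 1 (f \o c) (dfun i f (coord i (c t)) (derive1 (coord i \o c) t)).
Proof.
move=> cC fC ic.
have [cc cd] := cC; have [/derivable1_diffP di _] := cd i t ic.
apply: (@near_eq_is_derive _ _ _ ((f \o param i) \o (coord i \o c))).
  by apply: filterS (near_dom_curve cC ic) => s is_ /=; rewrite coordK.
have df : differentiable (f \o param i) ((coord i \o c) t).
  exact: (C1_on_diff (fC i) (codom_coord ic)).
have dfc := differentiable_comp di df.
split; first exact: diff_derivable.
rewrite (deriveE _ dfc) (diff_comp di df) /comp -(deriveE _ di) -(deriveE _ df) (derive_partials _ df).
by rewrite /dfun derive1E.
Qed.

(** A bound [C] on the gradient of [f]. One chart at each point is enough, because the speed of a
    curve can be computed in any chart; it can be chosen to suit [f]. *)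
Definition slope_le (f : M -> R) (C : R) : Prop :=
  forall p, exists2 i, dom i p &
    forall v, `|dfun i f (coord i p) v| <= C * local_norm g i (coord i p) v.

(** The derivative of [f] along the curve is at most [C] times the speed, and the fundamental
    theorem of calculus integrates it. *)
Lemma along_curve_bound (c : R -> M) (f : M -> R) (C a b : R) : C1_curve c -> C1_fun f ->
  0 <= C -> slope_le f C -> a <= b ->
  (`|f (c b) - f (c a)|%:E <=
    C%:E * \int[lebesgue_measure]_(t in `[a, b]) (speed g c t)%:E)%E.
Proof.
(* The fundamental theorem is applied on a nondegenerate interval, so [a = b] is settled apart. *)
move=> cC fC C0 fS; rewrite le_eqVlt => /predU1P[<-|ab].
  rewrite subrr normr0 mule_ge0//; apply: integral_ge0 => t _.
  by rewrite lee_fin speed_ge0.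
pose h t := derive1 (f \o c) t.
have hE i t : dom i (c t) -> h t = dfun i f (coord i (c t)) (derive1 (coord i \o c) t).
  by move=> ic; rewrite /h derive1E (@derive_val _ _ _ _ _ _ _ (is_derive_along cC fC ic)).
have fcd t : derivable (f \o c) t 1.
  have [i ic] := dom_cover (c t); exact: (@ex_derive _ _ _ _ _ _ _ (is_derive_along cC fC ic)).
have hc : continuous h.
  move=> t; have [i ic] := dom_cover (c t).
  have [cc cd] := cC; have [di dc] := cd i t ic.
  apply: (@continuous_near_eq _ _
     (fun s => dfun i f (coord i (c s)) (derive1 (coord i \o c) s))).
    by apply: filterS (near_dom_curve cC ic) => s is_; rewrite (hE i).
  apply: continuous_sumR => k _; apply: continuousM.
    by apply: (@continuous_comp _ _ _ _ (fun w : 'rV[R]_n => w 0 k)); [exact: dc|exact: continuous_entry].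
  apply: (@continuous_comp _ _ _ (coord i \o c) (partial k (f \o param i))).
    by apply: continuous_comp; [exact: cc|exact: Defs.coord_continuous].
  exact: (C1_on_partial (fC i) (codom_coord ic)).
have fcc : continuous (f \o c).
  by move=> t; apply: differentiable_continuous; exact/derivable1_diffP.
have hS t : `|h t| <= C * speed g c t.
  have [i ic Hi] := fS (c t); rewrite (hE i t ic) (speed_chart cC ic); exact: Hi.
have mh (u : R -> R) : continuous u -> measurable_fun `[a, b] u.
  by move=> uc; apply: measurable_funTS; exact: continuous_measurable_fun.
have ftc : ((f (c b))%:E - (f (c a))%:E = \int[lebesgue_measure]_(t in `[a, b]) (h t)%:E)%E.
  apply/esym/(@continuous_FTC2 _ h (f \o c) a b ab).
  - exact: continuous_subspaceT.
  - split; [by move=> t _|exact/cvg_at_right_filter/fcc|exact/cvg_at_left_filter/fcc].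
  - by [].
rewrite -[X in (X <= _)%E]/(`|(f (c b) - f (c a))%:E|)%E EFinB ftc.
apply: le_trans (le_abse_integral _ _ _) _ => //.
  by apply/measurable_EFinP; apply: mh; exact: hc.
rewrite -ge0_integralZl//=; last 2 first.
- by apply/measurable_EFinP; apply: mh; exact: speed_continuous.
- by move=> t _; rewrite lee_fin speed_ge0.
apply: ge0_le_integral => //=.
- by apply/measurable_EFinP; apply: measurableT_comp => //; apply: mh; exact: hc.
- apply: measurable_funeM; apply/measurable_EFinP; apply: mh; exact: speed_continuous.
- by move=> t _; rewrite lee_fin.
Qed.

Lemma quadZ m (A : 'M[R]_m) a v : quad A (a *: v) = a ^+ 2 * quad A v.
Proof.
rewrite !quadE mulr_sumr; apply: eq_bigr => b _; rewrite mulr_sumr.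
by apply: eq_bigr => d _; rewrite !mxE; ring.
Qed.

(** The constant is the minimum of the form on the unit sphere, carried to all vectors by
    homogeneity. *)
Lemma posdef_lower_bound m (A : 'M[R]_m) : (forall v : 'rV[R]_m, v != 0 -> 0 < quad A v) ->
  exists2 l : R, 0 < l & forall v, l * `|v| ^+ 2 <= quad A v.
Proof.
move=> Apos.
have q0 : quad A 0 = 0 by rewrite -(scale0r 0) quadZ expr0n mul0r.
(* In dimension 0 the sphere is empty and any constant will do. *)
have [[w w0]|nw] := pselect (exists w : 'rV[R]_m, w != 0); last first.
  exists 1 => // v; have -> : v = 0 by apply/eqP/negPn/negP => v0; apply: nw; exists v.
  by rewrite normr0 expr0n mulr0 q0.
pose S := [set v : 'rV[R]_m | `|v| = 1].
have unitS (v : 'rV[R]_m) : v != 0 -> S (`|v|^-1 *: v).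
  by move=> v0; rewrite /S /= normrZ normfV normr_id mulVf ?normr_eq0.
have nc : continuous (fun v : 'rV[R]_m => `|v|) by exact: norm_continuous.
have [|||c] := @EVT_min_rV R m (quad A) S.
- by exists (`|w|^-1 *: w); exact: unitS.
- apply: bounded_closed_compact; last first.
    exact: (closed_comp (f := fun v : 'rV[R]_m => `|v|) _ (@closed_eq R 1)).
  exists 1; split; [exact: num_real|move=> y y1 v; rewrite /S /= => v1; rewrite v1; exact: ltW].
- apply: continuous_subspaceT => v; apply: continuous_quad => k; last exact: continuous_entry.
  move=> j; exact: cst_continuous.
rewrite inE => Sc cmin; exists (quad A c).
  apply: Apos; apply: contra_eqN Sc => /eqP ->.
  by rewrite normr0 eq_sym oner_eq0.
move=> v; have [->|v0] := eqVneq v 0; first by rewrite normr0 expr0n mulr0 q0.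
have := cmin (`|v|^-1 *: v); rewrite inE => /(_ (unitS v v0)).
rewrite quadZ exprVn => H; rewrite mulrC -ler_pdivlMl//.
by rewrite exprn_gt0// normr_gt0.
Qed.

Lemma local_norm_lower_bound (i : chart M) p : dom i p ->
  exists r l : R, [/\ 0 < r, 0 < l & forall x, `|x - coord i p| <= r ->
    codom i x /\ forall v, l * `|v| <= local_norm g i x v].
Proof.
move=> ip; have ix := codom_coord ip; set x0 := coord i p in ix *.
have [m m0 mP] := posdef_lower_bound (fun v v0 => metric_pos g ix v0).
(* Changing each of the [n * n] entries by at most [e] changes the quadratic form by at most
   [m / 2 * |v| ^+ 2], which leaves half of the minimum [m]. *)
pose e := m / 2 / (n * n).+1%:R.
have e0 : 0 < e by rewrite !divr_gt0.
have gn : \forall x \near x0, forall ab : 'I_n * 'I_n, `|g i x0 ab.1 ab.2 - g i x ab.1 ab.2| < e.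
  apply: near_finite => -[a b] /=.
  have := C1_on_cont (@metric_C1 _ _ _ g i a b) ix.
  by move/cvgrPdist_lt; exact.
have : \forall x \near x0, codom i x /\
    forall ab : 'I_n * 'I_n, `|g i x0 ab.1 ab.2 - g i x ab.1 ab.2| < e.
  by apply: filterI; first exact: (near_open (@codom_isopen _ _ _ i) ix).
move=> /nbhs_ballP[r /= r0 rP].
exists (r / 2), (Num.sqrt (m / 2)); split; rewrite ?divr_gt0 ?sqrtr_gt0 ?divr_gt0//.
move=> x xr; have [|cx gx] := rP x.
  rewrite -ball_normE /= distrC; apply: le_lt_trans xr _.
  by rewrite ltr_pdivrMr// ltr_pMr// ltr1n.
split=> // v; rewrite local_normE.
have -> : Num.sqrt (m / 2) * `|v| = Num.sqrt (m / 2 * `|v| ^+ 2).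
  have m20 : 0 <= m / 2 by rewrite divr_ge0// ltW.
  by rewrite (sqrtrM _ m20) sqrtr_sqr ger0_norm.
rewrite ler_wsqrtr//.
have dq : quad (g i x0) v - quad (g i x) v <= m / 2 * `|v| ^+ 2.
  rewrite !quadE -sumrB.
  apply: (@le_trans _ _ (\sum_(a < n) \sum_(b < n) e * `|v| ^+ 2)).
    apply: ler_sum => a _; rewrite -sumrB; apply: ler_sum => b _.
    have -> : v 0 a * g i x0 a b * v 0 b - v 0 a * g i x a b * v 0 b =
      (g i x0 a b - g i x a b) * (v 0 a * v 0 b) by ring.
    apply: le_trans (ler_norm _) _; rewrite normrM ler_pM//; first exact: ltW (gx (a, b)).
    by rewrite normrM expr2 ler_pM// mx_norm_coord.
  have -> : \sum_(a < n) \sum_(b < n) e * `|v| ^+ 2 = (n * n)%:R * e * `|v| ^+ 2.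
    by rewrite !sumr_const card_ord -mulrnA -[LHS]mulr_natl mulrA.
  apply: ler_wpM2r; first exact: sqr_ge0.
  rewrite /e mulrCA ger_pMr ?divr_gt0// ler_pdivrMr// mul1r ler_nat.
  exact: leqnSn.
have := mP v; lra.
Qed.

(** A witness for lower bounds on the distance: a curve from [p] that leaves [U] makes [f] drop from
    1 to 0, which its slope does not allow in too short a length. *)
Lemma bump_slope p (U : set M) : nbhs p U ->
  exists f : M -> R, exists2 C : R, 0 <= C &
  [/\ C1_fun f, forall q, 0 <= f q <= 1, f p = 1, slope_le f C & forall q, f q != 0 -> U q].
Proof.
move=> Up; have [i ip] := dom_cover p.
have [r1 [l [r10 l0 Hl]]] := local_norm_lower_bound ip.
pose U' := [set q | U q /\ dom i q /\ `|coord i q - coord i p| < r1].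
have U'p : nbhs p U'.
  apply: filterI => //; apply: filterI.
    by apply: open_nbhs_nbhs; split => //; exact: dom_open.
  apply: (@Defs.coord_continuous _ _ M i p ip [set x : 'rV[R]_n | `|x - coord i p| < r1]).
  by apply/nbhs_ballP; exists r1 => //= x; rewrite -ball_normE /= distrC.
have [f [r r0 [fC f01 f1 rU fsupp]]] := bump_manifold ip U'p.
pose A := [set x : 'rV[R]_n | `|x - coord i p| <= r].
have AE : A = closed_ball (coord i p) r.
  by rewrite closed_ballE//; apply/seteqP; split => x; rewrite /A /closed_ball_ /= distrC.
have [K K0 HK] : exists2 K : R, 0 <= K & forall x, A x -> \sum_k `|partial k (f \o param i) x| <= K.
  have [|||c] := @EVT_max_rV R n (fun x => \sum_k `|partial k (f \o param i) x|) A.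
  - by exists (coord i p); rewrite /A /= subrr normr0 ltW.
  - rewrite AE; apply: bounded_closed_compact; last exact: closed_ball_closed.
    exists (`|coord i p| + r); split; first exact: num_real.
    move=> y ry x; rewrite closed_ballE// /closed_ball_ /= => xr.
    have := ler_distD (coord i p) 0 x; rewrite !sub0r !normrN; lra.
  - apply: continuous_in_subspaceT => x; rewrite inE /A /= => xr.
    apply: continuous_sumR => k _; apply: continuous_comp; last exact: norm_continuous.
    by apply: (C1_on_partial (fC i)); have [] := rU x xr.
  rewrite inE => Ac cmax; exists (\sum_k `|partial k (f \o param i) c|).
    by apply: sumr_ge0 => k _.
  by move=> x Ax; apply: cmax; rewrite inE.
(* [K] bounds the differential in coordinates on the closed ball, and [l] compares the coordinate
   norm with the Riemannian one; off that ball [f] is locally zero. *)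
exists f, (K / l); first by rewrite divr_ge0// ltW.
split=> //.
- exact: (nbhs_singleton f1).
- move=> q; have [[x xr xq]|nK] := pselect ((param i @` A) q).
    have [cx Ux] := rU x xr; have [domx cE] := codomP cx.
    rewrite -xq; exists i => // v; rewrite cE.
    have [_ /(_ v) lv] : codom i x /\ forall v, l * `|v| <= local_norm g i x v.
      apply: Hl; rewrite ltW//; have [_ [_ +]] := Ux; by rewrite cE.
    apply: (@le_trans _ _ (K * `|v|)).
      apply: le_trans (ler_norm_sum _ _ _) _.
      apply: (@le_trans _ _ (\sum_k `|partial k (f \o param i) x| * `|v|)).
        by apply: ler_sum => k _; rewrite normrM mulrC ler_wpM2l// mx_norm_coord.
      by rewrite -mulr_suml ler_wpM2r// HK.
    rewrite mulrAC -mulrA ler_wpM2l// ler_pdivlMr// mulrC; exact: lv.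
  have oK : open (~` (param i @` A)).
    apply: closed_openC; apply: compact_closed; first exact: manifold_hausdorff.
    by apply: compact_param_ball => // y yr; have [] := rU y yr.
  exists (chart_at q); first exact: chart_atP.
  move=> v; have -> : dfun (chart_at q) f (coord (chart_at q) q) v = 0.
    rewrite /dfun big1// => k _.
    rewrite (@partial_near _ _ _ (cst 0)); first by rewrite /partial derive_cst mulr0.
    have : \forall y \near coord (chart_at q) q, codom (chart_at q) y /\ (~` (param i @` A)) (param (chart_at q) y).
      apply: nbhs_param; first exact/codom_coord/chart_atP.
      rewrite coordK; last exact: chart_atP.
      exact: open_nbhs_nbhs.
    apply: filterS => y [_ Ky] /=; apply/eqP/negPn/negP => /fsupp[yi yr].
    by apply: Ky; exists (coord i (param (chart_at q) y)) => //; rewrite coordK.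
  by rewrite normr0 mulr_ge0 ?local_norm_ge0 ?divr_ge0// ltW.
- by move=> q /fsupp[qi qr]; have [_ [+ _]] := rU _ qr; rewrite coordK.
Qed.

End NormsCurves.

Section Distance.
Context {R : realType} {n : nat} {M : oriented_manifold R n}.
Variables (g : riemannian_metric M).
Local Notation mu := (@lebesgue_measure R).
Local Notation d := (riemannian_dist g).

(** Reversal of time, for the symmetry of the distance. *)
Lemma C1_curve_opp (c : R -> M) : C1_curve c -> C1_curve (c \o -%R).
Proof.
move=> cC; have [cc cd] := cC.
have oc (T : topologicalType) (f : R -> T) t : {for - t, continuous f} ->
    {for t, continuous (f \o -%R)}.
  by move=> fc; apply: continuous_comp; [exact: opp_continuous|exact: fc].
split=> [t|i t ic]; first by apply: oc; exact: cc.
have dE s : dom i (c (- s)) -> derivable (coord i \o (c \o -%R)) s 1 /\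
    derive1 (coord i \o (c \o -%R)) s = - derive1 (coord i \o c) (- s).
  move=> is_; have [/derivable1_diffP di _] := cd i (- s) is_.
  have no : is_diff s (-%R : R -> R) (-%R : R -> R).
    exact: (is_diffN (is_diff_id s)).
  have dno : differentiable (-%R : R -> R) s by exact: ex_diff.
  have dc := differentiable_comp dno di.
  split; first exact/derivable1_diffP.
  rewrite !derive1E (deriveE _ dc) (diff_comp dno di) /= diff_val linearN.
  by rewrite -(deriveE _ di).
split; first by have [] := dE t ic.
apply: (@continuous_near_eq _ _ (fun s => - derive1 (coord i \o c) (- s))).
  have : \forall s \near t, dom i (c (- s)).
    apply: (oc _ c t (cc (- t)) (dom i)); apply: open_nbhs_nbhs.
    by split => //; exact: dom_open.
  by apply: filterS => s is_; have [_ ->] := dE s is_.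
apply: continuousN; apply: (oc _ (derive1 (coord i \o c))).
by have [] := cd i (- t) ic.
Qed.

Lemma speed_opp (c : R -> M) t : C1_curve c -> speed g (c \o -%R) t = speed g c (- t).
Proof.
move=> cC; have [cc cd] := cC; rewrite /speed /=; set i := chart_at _.
have is_ : dom i (c (- t)) by exact: chart_atP.
have [/derivable1_diffP di _] := cd i (- t) is_.
have no : is_diff t (-%R : R -> R) (-%R : R -> R) by exact: (is_diffN (is_diff_id t)).
have dno : differentiable (-%R : R -> R) t by exact: ex_diff.
have dc := differentiable_comp dno di.
have -> : derive1 (coord i \o (c \o -%R)) t = (-1) *: derive1 (coord i \o c) (- t).
  rewrite !derive1E (deriveE _ dc) (diff_comp dno di) /= diff_val linearN.
  by rewrite -(deriveE _ di) scaleN1r.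
by rewrite local_normZ normrN1 mul1r.
Qed.

Lemma joined_ge0 p q l : joined g p q l -> (0 <= l)%E.
Proof.
elim=> // c a b {}l cC ab _ l0; rewrite adde_ge0//.
by apply: integral_ge0 => t _; rewrite lee_fin speed_ge0.
Qed.

Lemma joined_trans p q s l l' : joined g p q l -> joined g q s l' -> joined g p s (l + l')%E.
Proof.
move=> pq; elim=> [|c a b {}l' cC ab _ IH]; first by rewrite adde0.
by rewrite addeA; exact: joined_arc.
Qed.

Lemma joined_arc1 c a b : C1_curve c -> a <= b ->
  joined g (c a) (c b) (\int[mu]_(t in `[a, b]) (speed g c t)%:E)%E.
Proof.
by move=> cC ab; rewrite -[X in joined _ _ _ X]add0e; apply: joined_arc => //; exact: joined_refl.
Qed.

Lemma joined_sym p q l : joined g p q l -> joined g q p l.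
Proof.
elim=> [|c a b {}l cC ab _ IH]; first exact: joined_refl.
rewrite addeC; apply: joined_trans IH.
have := @joined_arc1 (c \o -%R) (- b) (- a) (C1_curve_opp cC).
rewrite /= !opprK lerN2 => /(_ ab).
rewrite (integration_by_substitution_oppr ab).
  have -> : speed g (c \o -%R) \o -%R = speed g c; last exact.
  by apply/funext => t; rewrite [LHS]/comp (speed_opp _ cC) opprK.
apply: continuous_subspaceT; apply: speed_continuous; exact: C1_curve_opp.
Qed.

Lemma dist_le p q l : joined g p q l -> (d p q <= l)%E.
Proof. by move=> pq; apply: ereal_inf_lbound. Qed.

Lemma dist_lt_joined p q x : (d p q < x)%E -> exists2 l, joined g p q l & (l < x)%E.
Proof. exact: ereal_inf_lt. Qed.

Lemma dist_ge0 p q : (0 <= d p q)%E.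
Proof. by apply: le_ereal_inf_tmp => l /joined_ge0. Qed.

Lemma dist_refl p : d p p = 0%E.
Proof. by apply/eqP; rewrite eq_le dist_ge0 andbT; apply/dist_le/joined_refl. Qed.

Lemma dist_sym p q : d p q = d q p.
Proof.
suff H x y : (d x y <= d y x)%E by apply/eqP; rewrite eq_le !H.
by apply: le_ereal_inf_tmp => l /joined_sym/dist_le.
Qed.

Lemma dist_triangle p q s : (d p s <= d p q + d q s)%E.
Proof.
have [->|pq] := eqVneq (d p q) +oo%E.
  by rewrite addye ?leey//; apply: contraTneq (dist_ge0 q s) => ->.
have [->|qs] := eqVneq (d q s) +oo%E.
  by rewrite addey ?leey//; apply: contraTneq (dist_ge0 p q) => ->.
have pqf : d p q \is a fin_num by rewrite ge0_fin_numE ?dist_ge0// ltey.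
have qsf : d q s \is a fin_num by rewrite ge0_fin_numE ?dist_ge0// ltey.
apply/lee_addgt0Pr => e e0.
have e20 : 0 < e / 2 by rewrite divr_gt0.
have [l pl ll] : exists2 l, joined g p q l & (l < d p q + (e / 2)%:E)%E.
  by apply: dist_lt_joined; rewrite lteDl.
have [l' ql ll'] : exists2 l, joined g q s l & (l < d q s + (e / 2)%:E)%E.
  by apply: dist_lt_joined; rewrite lteDl.
apply: (le_trans (dist_le (joined_trans pl ql))).
apply: (le_trans (leeD (ltW ll) (ltW ll'))).
by rewrite addeACA -EFinD -splitr.
Qed.

Lemma length_bound f C p q l : C1_fun f -> 0 <= C -> slope_le g f C -> joined g p q l ->
  (`|f q - f p|%:E <= C%:E * l)%E.
Proof.
move=> fC C0 fS; elim=> [|c a b {}l cC ab pl IH]; first by rewrite subrr normr0 mule0.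
rewrite ge0_muleDr; [|exact: joined_ge0 pl|]; last first.
  by apply: integral_ge0 => t _; rewrite lee_fin speed_ge0.
apply: (@le_trans _ _ (`|f (c a) - f p|%:E + `|f (c b) - f (c a)|%:E)%E).
  by rewrite -EFinD lee_fin [leRHS]addrC; exact: ler_distD.
by apply: leeD => //; exact: along_curve_bound.
Qed.

(** A bump of slope [C] needs a length of at least [1 / C] to fall from 1 to 0. Together with
    [dist_ball_nbhs] this says that the distance induces the topology of the manifold. *)
Lemma dist_nbhs p (U : set M) : nbhs p U ->
  exists2 r : R, 0 < r & forall q, (d p q < r%:E)%E -> U q.
Proof.
move=> /(bump_slope g)[f [C C0 [fC f01 fp fS fU]]].
(* [C + 1] instead of [C], which may be 0. *)
exists (C + 1)^-1; first by rewrite invr_gt0 ltr_wpDl.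
move=> q /dist_lt_joined[l pl ll]; apply: fU; apply/eqP => fq.
have := length_bound fC C0 fS pl; rewrite fq fp sub0r normrN normr1.
apply/negP; rewrite -ltNge; apply: (@le_lt_trans _ _ (C%:E * ((C + 1)^-1)%:E)%E).
  by rewrite lee_wpmul2l ?lee_fin// ltW.
by rewrite -EFinM lte_fin ltr_pdivrMr ?ltr_wpDl// mul1r ltrDl.
Qed.

(** [C1_curve] asks for regularity in every chart; it is transferred from the chart [i] by the chain
    rule for transition maps. *)
Lemma C1_curve_chart (i : chart M) (y : R -> 'rV[R]_n) :
  (forall t, codom i (y t)) -> (forall t, derivable y t 1) -> continuous (derive1 y) ->
  C1_curve (param i \o y).
Proof.
move=> iy dy cdy.
have diy t : differentiable y t by exact/derivable1_diffP.
have cy : continuous y by move=> t; exact: differentiable_continuous.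
have cc : continuous (param i \o y).
  by move=> t; apply: continuous_comp; [exact: cy|exact: (param_continuous (iy t))].
split=> // j t jt.
have ov s : dom j (param i (y s)) -> overlap i j (y s) by move=> js; rewrite overlapE.
have dE s : dom j (param i (y s)) -> differentiable (transition i j \o y) s /\
    derive1 (transition i j \o y) s = derive1 y s *m jacobian (transition i j) (y s).
  move=> js; have dT := transition_diff (ov s js); have dTy := differentiable_comp (diy s) dT.
  split=> //; rewrite !derive1E (deriveE _ dTy) (diff_comp (diy s) dT) /comp.
  by rewrite -(deriveE _ (diy s)) -(deriveE _ dT) deriveEjacobian.
have nj : \forall s \near t, dom j (param i (y s)).
  by apply: (cc t); apply: open_nbhs_nbhs; split => //; exact: dom_open.
split; first by apply/derivable1_diffP; have [] := dE t jt.
apply: (@continuous_near_eq _ _ (fun s => derive1 y s *m jacobian (transition i j) (y s))).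
  by apply: filterS nj => s js; have [_ <-] := dE s js.
apply: continuous_matrix => a b; rewrite (ord1 a).
apply: (@continuous_near_eq _ _ (fun s => \sum_k derive1 y s 0 k *
    partial k (fun x => transition i j x 0 b) (y s))).
  apply: filterS nj => s js; rewrite mxE; apply: eq_bigr => k _.
  by rewrite (jacobian_transition _ _ (ov s js)).
apply: continuous_sumR => k _; apply: continuousM.
  by apply: (@continuous_comp _ _ _ _ (fun w : 'rV[R]_n => w 0 k)); [exact: cdy|exact: continuous_entry].
apply: (@continuous_comp _ _ _ y (partial k (fun x => transition i j x 0 b))); first exact: cy.
exact: (C1_on_partial (@transition_C1 _ _ _ i j b) (ov t jt)).
Qed.

(* The segment is run through as [sin], because a curve has to be defined on the whole line. *)
Lemma dist_segment (i : chart M) (x v : 'rV[R]_n) (B : R) :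
  (forall t, -1 <= t <= 1 -> codom i (x + t *: v)) ->
  (forall t, -1 <= t <= 1 -> local_norm g i (x + t *: v) v <= B) ->
  (d (param i x) (param i (x + v)) <= (2 * B)%:E)%E.
Proof.
move=> iv vB.
have s1 (t : R) : -1 <= sin t <= 1 by rewrite sin_geN1 sin_le1.
have B0 : 0 <= B by apply: le_trans (local_norm_ge0 _ _ _ _) (vB 0 _); rewrite lerN10 ler01.
pose y (t : R) := x + sin t *: v.
have yd (t : R) : is_derive t 1 y (cos t *: v).
  have de a b : is_derive t 1 (fun s => y s a b) (cos t * v a b).
    have -> : (fun s => y s a b) = cst (x a b) + (sin : R -> R) * cst (v a b).
      by apply/funext => s; rewrite !mxE.
    apply: (@is_derive_eq _ _ _ _ _ _ _ _ (is_deriveD (is_derive_cst (x a b) t 1)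
      (is_deriveM (is_derive_sin t) (is_derive_cst (v a b) t 1)))).
    by rewrite scaler0 add0r add0r mulrC.
  have yd : derivable y t 1.
    by apply/derivable_mxP => a b; exact: (@ex_derive _ _ _ _ _ _ _ (de a b)).
  split=> //; rewrite derive_mx//; apply/matrixP => a b; rewrite !mxE.
  exact: (@derive_val _ _ _ _ _ _ _ (de a b)).
have y1 : derive1 y = fun t => cos t *: v.
  by apply/funext => t; rewrite derive1E (@derive_val _ _ _ _ _ _ _ (yd t)).
have cC : C1_curve (param i \o y).
  apply: C1_curve_chart.
  - by move=> t; exact: iv.
  - by move=> t; exact: (@ex_derive _ _ _ _ _ _ _ (yd t)).
  - rewrite y1 => t; apply: continuous_matrix => a b.
    apply: (@continuous_ext _ _ (fun s : R => cos s * v a b)); first by move=> s; rewrite mxE.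
    by apply: continuousM; [exact: continuous_cos|exact: cst_continuous].
(* The point [x + v] is reached at time [pi / 2 < 2], and [|cos t| <= 1] bounds the speed by [B]:
   hence the factor 2. *)
have pi0 : 0 <= pi / 2 :> R by have /andP[/ltW] := pihalf_02 R.
have := dist_le (@joined_arc1 _ 0 (pi / 2) cC pi0).
rewrite /comp /y sin0 sin_pihalf scale0r addr0 scale1r => H; apply: le_trans H _.
apply: (@le_trans _ _ (\int[mu]_(t in `[0%R, (pi / 2)%R]) (cst B%:E) t)%E).
  apply: ge0_le_integral => //=.
  - by move=> t _; rewrite lee_fin speed_ge0.
  - apply/measurable_EFinP; apply: measurable_funTS; apply: continuous_measurable_fun.
    exact: speed_continuous.
  - move=> t _; rewrite lee_fin.
    have cy := iv _ (s1 t); have [dy yE] := codomP cy.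
    rewrite (speed_chart g cC dy) yE.
    have -> : derive1 (coord i \o (param i \o y)) t = cos t *: v.
      have <- : derive1 y t = cos t *: v by rewrite y1.
      congr (derive1 _ t); apply/funext => s /=.
      by have [_ ->] := codomP (iv _ (s1 s)).
    rewrite local_normZ; apply: le_trans (vB _ (s1 t)).
    by rewrite ler_piMl ?local_norm_ge0// ler_norml cos_geN1 cos_le1.
rewrite integral_cst//= lebesgue_measure_itv /= lte_fin.
case: ifPn => _; last by rewrite mule0 lee_fin mulr_ge0.
by rewrite oppr0 -EFinD -EFinM lee_fin addr0 mulrC ler_wpM2r// ltW// pihalf_lt2.
Qed.

Lemma local_norm_upper_bound (i : chart M) p : dom i p ->
  exists r B : R, [/\ 0 < r, 0 < B & forall x, `|x - coord i p| <= r ->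
    codom i x /\ forall v, local_norm g i x v <= B * `|v|].
Proof.
move=> ip; have ix := codom_coord ip; set x0 := coord i p in ix *.
(* Entries of the metric that are within 1 of their values at [p] are bounded by the summands of
   [G]. *)
pose G := \sum_(a < n) \sum_(b < n) (`|g i x0 a b| + 1).
have gn : \forall x \near x0, forall ab : 'I_n * 'I_n, `|g i x0 ab.1 ab.2 - g i x ab.1 ab.2| < 1.
  apply: near_finite => -[a b] /=.
  have := C1_on_cont (@metric_C1 _ _ _ g i a b) ix.
  by move/cvgrPdist_lt; apply.
have : \forall x \near x0, codom i x /\
    forall ab : 'I_n * 'I_n, `|g i x0 ab.1 ab.2 - g i x ab.1 ab.2| < 1.
  by apply: filterI; first exact: (near_open (@codom_isopen _ _ _ i) ix).
have G0 : 0 <= G by apply: sumr_ge0 => a _; apply: sumr_ge0 => b _; rewrite addr_ge0.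
move=> /nbhs_ballP[r /= r0 rP].
exists (r / 2), (Num.sqrt (G + 1)); split; rewrite ?divr_gt0 ?sqrtr_gt0 ?ltr_wpDl//.
move=> x xr; have [|cx gx] := rP x.
  rewrite -ball_normE /= distrC; apply: le_lt_trans xr _.
  by rewrite ltr_pdivrMr// ltr_pMr// ltr1n.
split=> // v; rewrite local_normE.
have -> : Num.sqrt (G + 1) * `|v| = Num.sqrt ((G + 1) * `|v| ^+ 2).
  have G10 : 0 <= G + 1 by rewrite addr_ge0.
  by rewrite (sqrtrM _ G10) sqrtr_sqr ger0_norm.
rewrite ler_wsqrtr// quadE.
apply: (@le_trans _ _ (G * `|v| ^+ 2)); last by rewrite ler_wpM2r ?sqr_ge0// lerDl.
rewrite /G mulr_suml; apply: ler_sum => a _; rewrite mulr_suml; apply: ler_sum => b _.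
have -> : v 0 a * g i x a b * v 0 b = g i x a b * (v 0 a * v 0 b) by ring.
apply: le_trans (ler_norm _) _; rewrite normrM ler_pM//.
  have := ltW (gx (a, b)); rewrite /= => gab.
  have := ler_distD (g i x0 a b) (g i x a b) 0; rewrite !subr0 distrC; lra.
by rewrite normrM expr2 ler_pM// mx_norm_coord.
Qed.

Lemma dist_ball_nbhs p (e : R) : 0 < e -> \forall q \near p, (d p q < e%:E)%E.
Proof.
move=> e0; have [i ip] := dom_cover p.
have [r [B [r0 B0 rB]]] := local_norm_upper_bound ip.
(* With [|v| < e / (4 * B)] the length bound [2 * (B * |v|)] for the segment is below [e / 2]. *)
pose s := Num.min r (e / (4 * B)).
have s0 : 0 < s by rewrite lt_min r0 divr_gt0// mulr_gt0.
have : \forall q \near p, dom i q /\ `|coord i q - coord i p| < s.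
  apply: filterI; first by apply: open_nbhs_nbhs; split => //; exact: dom_open.
  apply: (@Defs.coord_continuous _ _ M i p ip [set x : 'rV[R]_n | `|x - coord i p| < s]).
  by apply/nbhs_ballP; exists s => //= x; rewrite -ball_normE /= distrC.
apply: filterS => q [iq qs].
set v := coord i q - coord i p in qs.
have inr (t : R) : -1 <= t <= 1 -> `|coord i p + t *: v - coord i p| <= r.
  move=> t1; rewrite addrC addKr normrZ.
  apply: (@le_trans _ _ (1 * `|v|)); first by rewrite ler_wpM2r// ler_norml.
  by rewrite mul1r; move: qs; rewrite lt_min => /andP[/ltW].
rewrite -(coordK ip) -(coordK iq) -[coord i q](subrK (coord i p)) -/v addrC.
apply: le_lt_trans (@dist_segment i (coord i p) v (B * `|v|) _ _) _.
- by move=> t /inr/rB[].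
- by move=> t /inr/rB[_]; exact.
- rewrite lte_fin; move: qs; rewrite lt_min => /andP[_].
  rewrite ltr_pdivlMr ?mulr_gt0// => H.
  have vB0 : 0 <= B * `|v| by rewrite mulr_ge0// ltW.
  have -> : 2 * (B * `|v|) = (`|v| * (4 * B)) / 2 by field.
  by rewrite ltr_pdivrMr//; apply: lt_trans H _; rewrite ltr_pMr// ltr1n.
Qed.

Lemma speed_integral_fin (c : R -> M) a b : C1_curve c ->
  (\int[mu]_(t in `[a, b]) (speed g c t)%:E < +oo)%E.
Proof.
move=> cC.
have : mu.-integrable `[a, b] (EFin \o speed g c).
  apply: continuous_compact_integrable; first exact: segment_compact.
  by apply: continuous_subspaceT; exact: speed_continuous.
move=> /integrableP[_]; apply: le_lt_trans; apply: ge0_le_integral => //=.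
- by move=> t _; rewrite lee_fin speed_ge0.
- apply/measurable_EFinP; apply: measurable_funTS; apply: continuous_measurable_fun.
  exact: speed_continuous.
- by apply/measurable_EFinP; apply: measurableT_comp => //; apply: measurable_funTS;
    apply: continuous_measurable_fun; exact: speed_continuous.
- by move=> t _; rewrite lee_fin ler_norm.
Qed.

Lemma speed_integral_split (c : R -> M) a s b : C1_curve c -> a <= s -> s <= b ->
  (\int[mu]_(t in `[a, b]) (speed g c t)%:E =
   \int[mu]_(t in `[a, s]) (speed g c t)%:E + \int[mu]_(t in `[s, b]) (speed g c t)%:E)%E.
Proof.
move=> cC as_ sb.
have ms : measurable_fun setT (fun t => (speed g c t)%:E).
  by apply/measurable_EFinP; apply: continuous_measurable_fun; exact: speed_continuous.
have -> : `[a, b]%classic = `[a, s]%classic `|` `]s, b]%classic.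
  by rewrite -itv_bndbnd_setU// bnd_simp.
rewrite ge0_integral_setU//=.
- by congr (_ + _)%E; apply: integral_itv_obnd_cbnd; apply: measurable_funTS.
- exact: measurable_funTS.
- by move=> t _; rewrite lee_fin speed_ge0.
- by apply/disj_setPS => t [] /=; rewrite !in_itv /= => /andP[_ ts] /andP[st _]; lra.
Qed.

Lemma dist_continuous_along p (c : R -> M) : continuous c ->
  (forall t, d p (c t) \is a fin_num) -> continuous (fun t => fine (d p (c t))).
Proof.
move=> cc fin t; apply/cvgrPdist_lt => e e0.
have : \forall s \near t, (d (c t) (c s) < e%:E)%E by exact: (cc t _ (dist_ball_nbhs (c t) e0)).
apply: filterS => s dts; rewrite -lte_fin; apply: le_lt_trans dts.
have f1 := fin t; have f2 := fin s.
have t1 := dist_triangle p (c t) (c s); have t2 := dist_triangle p (c s) (c t).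
rewrite (dist_sym (c s)) in t2.
case: (d (c t) (c s)) t1 t2 => [r| |] t1 t2; rewrite ?leey//.
  move: t1 t2; rewrite -(fineK f1) -(fineK f2) -!EFinD !lee_fin => t1 t2.
  by rewrite ler_norml; lra.
by move: t1; rewrite -(fineK f1) -(fineK f2).
Qed.

(** The point [y] takes the place of a point on a minimizing geodesic. Induction on the chain of
    arcs finds one on which the distance to [p] passes [r], and the intermediate value theorem finds
    the point on it. *)
Lemma dist_intermediate p q (l : \bar R) (r : R) : joined g p q l -> 0 <= r ->
  (r%:E <= d p q)%E -> exists2 y, (d p y = r%:E)%E & (r%:E + d y q <= l)%E.
Proof.
move=> pql r0; elim: pql => [|c a b {}l cC ab pl IH] rd.
  exists p; last by rewrite dist_refl adde0 -(dist_refl p).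
  by apply/eqP; rewrite eq_le rd andbT dist_refl lee_fin.
have cab := dist_le (joined_arc1 cC ab).
have [rca|car] := leP (r%:E) (d p (c a)).
  have [y py yl] := IH rca; exists y => //.
  apply: le_trans (leeD yl cab); rewrite -addeA leeD2l//.
  exact: dist_triangle.
have fin t : d p (c t) \is a fin_num.
  rewrite ge0_fin_numE ?dist_ge0//.
  apply: le_lt_trans (dist_triangle p (c a) (c t)) _; rewrite lte_add_pinfty//.
    exact: lt_trans car (ltry _).
  have [at_|ta] := leP a t.
    exact: le_lt_trans (dist_le (joined_arc1 cC at_)) (speed_integral_fin _ _ cC).
  rewrite dist_sym.
  exact: le_lt_trans (dist_le (joined_arc1 cC (ltW ta))) (speed_integral_fin _ _ cC).
have Fc := dist_continuous_along (proj1 cC) fin.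
have [||s sab Fs] := @IVT R (fun t => fine (d p (c t))) a b r ab.
- exact: continuous_subspaceT.
- rewrite ge_min le_max -!lee_fin !fineK//.
  by rewrite (ltW car) rd orbT.
move: sab; rewrite in_itv /= => /andP[as_ sb].
have ps : d p (c s) = r%:E by rewrite -Fs fineK.
exists (c s) => //; rewrite (speed_integral_split cC as_ sb) addeA; apply: leeD.
  by rewrite -ps; apply: dist_le; exact: joined_arc.
exact: dist_le (joined_arc1 cC sb).
Qed.

End Distance.

(** * Compactness of balls *)

Section Compactness.

(** If [K] were not in the ideal [I], the sets whose complement in [K] is in it would form a proper
    filter, and a cluster point would contradict the local hypothesis. The lemma plays the part of a
    finite subcover. *)
Lemma compact_ideal (T : topologicalType) (K : set T) (I : set T -> Prop) :
  I set0 -> (forall A B, I A -> I B -> I (A `|` B)) -> (forall A B, A `<=` B -> I B -> I A) ->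
  compact K -> (forall x, K x -> exists2 U, nbhs x U & I U) -> I K.
Proof.
move=> I0 IU IS cK loc; apply: contrapT => nIK.
pose F : set_system T := [set A | I (K `\` A)].
have FF : ProperFilter F.
  split; first by rewrite /F /= setD0.
  split.
  - by rewrite /F /= setDT.
  - by move=> A B FA FB; rewrite /F /= setDIr; exact: IU.
  - by move=> A B AB; apply: IS; exact: setDS.
have FK : F K by rewrite /F /= setDv.
have [x [Kx clx]] := cK F FF FK.
have [U Ux IUx] := loc x Kx.
have FU : F (~` U) by apply: IS IUx => y [_ /contrapT].
by have [y [+ Uy]] := clx _ _ FU Ux; exact.
Qed.

End Compactness.

(** * From metric completeness to relatively compact balls *)

Section CohnVossen.
Context {R : realType} {n : nat} {M : oriented_manifold R n}.
Variables (g : riemannian_metric M).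
Local Notation d := (riemannian_dist g).

(** Inclusion in some compact set, rather than compactness of the closure, makes the notion pass to
    smaller balls at once. *)
Definition relatively_compact_ball (q : M) (r : R) : Prop :=
  exists2 K : set M, compact K & forall x, (d q x < r%:E)%E -> K x.

Lemma relatively_compact_ball_small q : exists2 r : R, 0 < r & relatively_compact_ball q r.
Proof.
have [i iq] := dom_cover q.
have [r r0 rU] := chart_closed_ball iq (filterT : nbhs q setT).
pose K := param i @` [set y : 'rV[R]_n | `|y - coord i q| <= r].
have cK : compact K by apply: compact_param_ball => // y yr; have [] := rU y yr.
have nK : nbhs q K.
  have : \forall x \near q, dom i x /\ `|coord i x - coord i q| <= r.
    apply: filterI; first by apply: open_nbhs_nbhs; split => //; exact: dom_open.
    apply: (@Defs.coord_continuous _ _ M i q iq [set x : 'rV[R]_n | `|x - coord i q| <= r]).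
    by apply/nbhs_ballP; exists r => //= x; rewrite -ball_normE /= distrC => /ltW.
  by apply: filterS => x [ix xr]; exists (coord i x) => //; rewrite coordK.
by have [s s0 sK] := dist_nbhs g nK; exists s => //; exists K.
Qed.

Lemma relatively_compact_ball_sub q q' r r' : relatively_compact_ball q r ->
  (d q q' + r'%:E <= r%:E)%E -> relatively_compact_ball q' r'.
Proof.
move=> [K cK KP] qr; exists K => // x xr; apply: KP; apply: lt_le_trans (qr).
apply: le_lt_trans (dist_triangle _ _ q' _) _.
have qf : d q q' \is a fin_num.
  rewrite ge0_fin_numE ?dist_ge0// ltey; apply: contraTneq qr => ->.
  by rewrite addye.
by rewrite lteD2lE.
Qed.

(** A point of the larger ball is within [3 * r / 8] of the set [S] of points at distance at most
    [s - r / 8] from [q]. That set is closed and contained in [K], hence compact, and the balls of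
    radius [3 * r / 8] around points within [r / 8] of some [y] in [S] all fit into the ball of
    radius [r / 2] around [y]. *)
Lemma relatively_compact_ball_grow q (s r : R) : 0 < r -> r / 8 <= s <= r ->
  (forall x, (d q x <= r%:E)%E -> relatively_compact_ball x (r / 2)) ->
  relatively_compact_ball q s -> relatively_compact_ball q (s + r / 4).
Proof.
move=> r0 /andP[rs sr] H [K cK KP].
pose S := [set y | (d q y <= (s - r / 8)%:E)%E].
have SK : S `<=` K.
  by move=> y Sy; apply: KP; apply: le_lt_trans Sy _; rewrite lte_fin; lra.
have clS : closed S.
  move=> y Hy; rewrite /S /=; apply/lee_addgt0Pr => e e0.
  have [z [Sz dz]] := Hy _ (dist_ball_nbhs g y e0).
  apply: le_trans (dist_triangle _ _ z _) _; apply: leeD => //.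
  by rewrite dist_sym ltW.
have cS : compact S by exact: subclosed_compact clS cK SK.
pose I (A : set M) := exists2 K' : set M, compact K' &
  forall y x, A y -> (d y x < (3 * r / 8)%:E)%E -> K' x.
have [|||||K' cK' KS] := @compact_ideal M S I.
- by exists set0; [exact: compact0|].
- move=> A B [KA cA AP] [KB cB BP]; exists (KA `|` KB); first exact: compactU.
  by move=> y x [Ay|By] yx; [left; exact: AP yx|right; exact: BP yx].
- by move=> A B AB [KB cB BP]; exists KB => // y x /AB; exact: BP.
- exact: cS.
- move=> y Sy; have [|Ky cKy yP] := H y.
    by apply: le_trans Sy _; rewrite lee_fin; lra.
  have r80 : 0 < r / 8 by rewrite divr_gt0.
  exists [set z | (d y z < (r / 8)%:E)%E]; first exact: dist_ball_nbhs.
  exists Ky => // z x yz zx; apply: yP.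
  apply: le_lt_trans (dist_triangle _ _ z _) _.
  have -> : (r / 2)%:E = ((r / 8)%:E + (3 * r / 8)%:E)%E by rewrite -EFinD; congr EFin; field.
  exact: lteD.
exists K' => // x qx.
have [xs|sx] := leP (d q x) (s - r / 8)%:E.
  apply: (KS x x) => //; rewrite dist_refl lte_fin; lra.
have [l ql ll] := dist_lt_joined qx.
have [||y qy yl] := dist_intermediate (r := s - r / 8) ql; [lra|exact: ltW|].
apply: (KS y x); first by rewrite /S /= qy.
have := le_lt_trans yl ll.
have -> : (s + r / 4)%:E = ((s - r / 8)%:E + (3 * r / 8)%:E)%E.
  by rewrite -EFinD; congr EFin; field.
by rewrite lteD2lE.
Qed.

(** Otherwise all balls of radius [r / 2] centered in the closed ball are relatively compact, and
    two enlargements by [r / 4] lead from the radius [r / 2] at [q] to [r]. *)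
Lemma bad_ball_halve q r : 0 < r -> ~ relatively_compact_ball q r ->
  exists2 q', (d q q' <= r%:E)%E & ~ relatively_compact_ball q' (r / 2).
Proof.
move=> r0 bad; apply: contrapT => H; apply: bad.
have good x : (d q x <= r%:E)%E -> relatively_compact_ball x (r / 2).
  by move=> qx; apply: contrapT => nx; apply: H; exists x.
have g1 : relatively_compact_ball q (r / 2).
  by apply: good; rewrite dist_refl lee_fin ltW.
have g2 : relatively_compact_ball q (r / 2 + r / 4).
  by apply: relatively_compact_ball_grow => //; lra.
have -> : r = (r / 2 + r / 4) + r / 4 by field.
by apply: relatively_compact_ball_grow => //; lra.
Qed.

(** One direction of the Hopf-Rinow theorem, by the argument of Cohn-Vossen: bad balls are halved
    repeatedly, their centers form a Cauchy sequence, and a small relatively compact ball around the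
    limit contains one of the bad balls. *)
Lemma complete_relatively_compact_ball : complete_metric g ->
  forall q r, relatively_compact_ball q r.
Proof.
move=> complete q r; apply: contrapT => bad.
have r0 : 0 < r.
  rewrite ltNge; apply/negP => r0; apply: bad; exists set0; first exact: compact0.
  by move=> x /(le_lt_trans (dist_ge0 _ _ _)); rewrite lte_fin ltNge r0.
pose rk (k : nat) : R := r / 2 ^+ k.
have rk0 k : 0 < rk k by rewrite divr_gt0// exprn_gt0.
have rkS k : rk k.+1 = rk k / 2 by rewrite /rk exprS invfM mulrA mulrAC.
(* The default value [x] is never taken along [u], whose balls are all bad. *)
pose next (k : nat) (x : M) : M :=
  if pselect (exists2 q', (d x q' <= (rk k)%:E)%E & ~ relatively_compact_ball q' (rk k.+1))
  is left h then projT1 (cid2 h) else x.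
pose u := fix u k := if k is k'.+1 then next k' (u k') else q.
have nextP k x : ~ relatively_compact_ball x (rk k) ->
    (d x (next k x) <= (rk k)%:E)%E /\ ~ relatively_compact_ball (next k x) (rk k.+1).
  move=> /(bad_ball_halve (rk0 k)) bx; rewrite /next; case: pselect => [h|[]]; last by rewrite rkS.
  by case: cid2 => y /= y1 y2.
have ubad k : ~ relatively_compact_ball (u k) (rk k).
  elim: k => [|k IH]; first by rewrite /rk expr0 divr1.
  by have [] := nextP k (u k) IH.
(* The right-hand side is the sum of the geometric series of the radii from [rk k] up to, and
   without, [rk (k + m)]. *)
have tele k m : (d (u k) (u (k + m)%N) <= (2 * rk k - 2 * rk (k + m)%N)%:E)%E.
  elim: m => [|m IH]; first by rewrite addn0 subrr dist_refl.
  rewrite addnS; apply: le_trans (dist_triangle _ _ (u (k + m)%N) _) _.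
  have [um _] := nextP _ _ (ubad (k + m)%N).
  apply: le_trans (leeD IH um) _; rewrite -EFinD lee_fin rkS; lra.
have rk_le k m : rk (k + m)%N <= rk k.
  by have := le_trans (dist_ge0 _ _ _) (tele k m); rewrite lee_fin; lra.
have rk_small e : 0 < e -> exists N, rk N < e.
  move=> e0; exists (Num.truncn (r / e)).+1; rewrite /rk ltr_pdivrMr ?exprn_gt0//.
  rewrite mulrC -ltr_pdivrMr//; apply: lt_le_trans (truncnS_gt _) _.
  by rewrite -natrX ler_nat ltnW// ltn_expl.
have tele' N m k : (N <= m)%N -> (m <= k)%N -> (d (u m) (u k) <= (2 * rk N)%:E)%E.
  move=> Nm mk; have := tele m (k - m)%N; rewrite subnKC// => H; apply: le_trans H _.
  rewrite lee_fin; have := rk_le N (m - N)%N; rewrite subnKC//; have := rk0 k; lra.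
have [|p pP] := complete u.
  move=> e e0; have [N NP] := rk_small (e / 2) ltac:(by rewrite divr_gt0).
  exists N => m k Nm Nk; have [mk|km] := leqP m k.
    by apply: le_lt_trans (tele' _ _ _ Nm mk) _; rewrite lte_fin; lra.
  by rewrite dist_sym; apply: le_lt_trans (tele' _ _ _ Nk (ltnW km)) _; rewrite lte_fin; lra.
have [s s0 ps] := relatively_compact_ball_small p.
have s20 : 0 < s / 2 by rewrite divr_gt0.
have [N1 N1P] := pP _ s20; have [N2 N2P] := rk_small _ s20.
(* Beyond both thresholds the center is within [s / 2] of [p] and the radius is below [s / 2]. *)
apply: (ubad (N2 + N1)%N); apply: relatively_compact_ball_sub ps _.
have H := N1P (N2 + N1)%N (leq_addl _ _).
rewrite dist_sym; apply: le_trans (leeD (ltW H) (lexx _)) _.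
by rewrite -EFinD lee_fin; have := rk_le N2 N1; lra.
Qed.

End CohnVossen.

(** * Weak form of the divergence *)

Section WeakDivergence.
Context {R : realType} {n : nat} (L : {measure set (borel 'rV[R]_n) -> \bar R}).
Hypothesis HL : is_lebesgue L.

(** The bound for one direction, summed. Each term has its own direction and its own rate of
    variation of [phi], so that a frozen direction can be mixed with the coordinate ones. *)
Lemma weak_divergence_bound (I : Type) (s : seq I) (u : I -> 'rV[R]_n -> R)
    (v : I -> 'rV[R]_n) (B : I -> R) (phi : 'rV[R]_n -> R) (C r : R) :
  0 < r -> (forall j, C1_on setT (u j)) -> (forall j x, r <= `|x| -> u j x = 0) ->
  measurable_fun setT (phi : borel 'rV[R]_n -> R) -> (forall x, `|phi x| <= C) ->
  (forall j, 0 <= B j) ->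
  (forall j, exists2 d, 0 < d &
     forall h x, 0 < h < d -> u j x != 0 -> `|phi (x - h *: v j) - phi x| <= B j * h) ->
  L.-integrable setT (EFin \o (fun x : borel 'rV[R]_n => phi x * \sum_(j <- s) 'D_(v j) (u j) x)) /\
  (`| \int[L]_x (phi x * \sum_(j <- s) 'D_(v j) (u j) x)%:E | <=
     \int[L]_x (\sum_(j <- s) B j * `|u j x|)%:E)%E.
Proof.
move=> r0 uC ur mphi phiC B0 HB.
elim: s => [|j s [IHi IH]].
  have E : (fun x : borel 'rV[R]_n => phi x * \sum_(j <- [::]) 'D_(v j) (u j) x) = cst 0.
    by apply/funext => x; rewrite big_nil mulr0.
  rewrite (_ : EFin \o _ = cst 0%E); last first.
    by apply/funext => x; rewrite /= big_nil mulr0.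
  split; first exact: integrable0.
  rewrite (_ : (fun x => _) = cst 0%E); last first.
    by apply/funext => x; rewrite /= big_nil mulr0.
  rewrite integral0 abse0; apply: integral_ge0 => x _.
  by rewrite big_nil.
have [d d0 dB] := HB j.
have [Ij Hj] := weak_derivative_bound HL (uC j) r0 (ur j) mphi phiC (B0 j) d0 dB.
have E : EFin \o (fun x : borel 'rV[R]_n => phi x * \sum_(j <- j :: s) 'D_(v j) (u j) x) =
  (fun x => (phi x * 'D_(v j) (u j) x)%:E + (phi x * \sum_(j <- s) 'D_(v j) (u j) x)%:E)%E.
  by apply/funext => x; rewrite /= big_cons mulrDr EFinD.
have mu_ k : measurable_fun setT (u k : borel 'rV[R]_n -> R).
  by apply: borel_measurable_continuous => x; exact: (C1_on_cont (uC k)).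
have mabs k : measurable_fun setT (fun x : borel 'rV[R]_n => `|u k x|%:E).
  by apply/measurable_EFinP; apply: measurableT_comp => //; exact: mu_.
split; first by rewrite E; exact: integrableD.
rewrite (_ : (fun x => _) = (fun x => (phi x * 'D_(v j) (u j) x)%:E +
   (phi x * \sum_(j <- s) 'D_(v j) (u j) x)%:E)%E); last first.
  by apply/funext => x; rewrite big_cons mulrDr EFinD.
rewrite integralD//; apply: le_trans (lee_abs_add _ _) _.
apply: le_trans (leeD Hj IH) _.
rewrite -ge0_integralZl//; last by rewrite lee_fin.
rewrite -ge0_integralD//.
- by under [X in (_ <= X)%E]eq_integral do rewrite big_cons EFinD EFinM.
- by move=> x _; rewrite mule_ge0// lee_fin.
- exact: measurable_funeM.
- by move=> x _; rewrite lee_fin; apply: sumr_ge0 => k _; rewrite mulr_ge0.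
- apply/measurable_EFinP; apply: measurable_sum => k; apply: measurable_funM => //.
  by apply: measurableT_comp => //; exact: mu_.
Qed.

Definition extend (U : set 'rV[R]_n) (f : 'rV[R]_n -> R) : 'rV[R]_n -> R :=
  fun x => if `[< U x >] then f x else 0.

Lemma extendE U f x : U x -> extend U f x = f x.
Proof. by move=> Ux; rewrite /extend asboolT. Qed.

Lemma extend_out U f x : ~ U x -> extend U f x = 0.
Proof. by move=> Ux; rewrite /extend asboolF. Qed.

Lemma extend_measurable U f : open U -> (forall x, U x -> {for x, continuous f}) ->
  measurable_fun setT (extend U f : borel 'rV[R]_n -> R).
Proof.
move=> oU fU; have -> : extend U f = f \_ U.
  apply/funext => x; rewrite patchE /extend; case: asboolP => Ux.
    by rewrite mem_set.
  by rewrite memNset.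
apply/(measurable_restrict _ _ measurableT); first exact: borel_open_measurable.
by rewrite setTI; exact: borel_measurable_fun_within.
Qed.

(** Points outside [U] lie off the closed ball that carries [f], and there the extension is locally
    zero. *)
Lemma extend_C1 U f (a : 'rV[R]_n) r : open U -> C1_on U f -> 0 < r ->
  (forall x, `|x - a| <= r -> U x) -> (forall x, U x -> f x != 0 -> `|x - a| <= r) ->
  C1_on setT (extend U f).
Proof.
move=> oU fU r0 rU fr; apply: C1_on_local => x _.
have [Ux|nUx] := pselect (U x).
  by exists U, f; split => // y Uy; rewrite extendE.
exists (~` closed_ball a r), (fun=> 0); split.
- exact/closed_openC/closed_ball_closed.
- move=> H; apply: nUx; apply: rU; move: H.
  by rewrite closed_ballE// /closed_ball_ /= distrC.
- exact: C1_on_cst.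
- move=> y; rewrite closed_ballE// /closed_ball_ /= => yr; rewrite /extend.
  case: asboolP => // Uy; apply/esym/eqP/negPn/negP => /(fr y Uy).
  by rewrite distrC.
Qed.

Lemma extend_partial U f k x : open U -> U x -> partial k (extend U f) x = partial k f x.
Proof.
move=> oU Ux; apply: partial_near; apply: (near_open oU Ux) => y Uy.
by rewrite extendE.
Qed.

End WeakDivergence.

(** * Riemannian volume in a chart *)

Section ChartIntegral.
Context {R : realType} {n : nat} {M : oriented_manifold R n}.
Variables (g : riemannian_metric M) (mu : {measure set (borel M) -> \bar R}).
Hypothesis hmu : is_riemannian_volume g mu.
Variables (L : {measure set (borel 'rV[R]_n) -> \bar R}).
Hypothesis HL : is_lebesgue L.

Lemma dom_measurable (i : chart M) : measurable (dom i : set (borel M)).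
Proof. by apply: borel_open_measurable; exact: dom_open. Qed.

Lemma codom_measurable (i : chart M) : measurable (codom i : set (borel 'rV[R]_n)).
Proof. by apply: borel_open_measurable; exact: codom_isopen. Qed.

Lemma param_measurable (i : chart M) :
  measurable_fun (codom i : set (borel 'rV[R]_n)) (param i : borel 'rV[R]_n -> borel M).
Proof.
apply: (@measurability _ _ _ (borel M) _ _ (@open M)) => //.
move=> _ [U oU <-]; apply: borel_open_measurable.
rewrite openE => x [ix Ux]; apply: (nbhs_param ix).
by apply: open_nbhs_nbhs.
Qed.

Lemma vol_density_measurable (i : chart M) :
  measurable_fun (codom i : set (borel 'rV[R]_n)) (vol_density g i : borel 'rV[R]_n -> R).
Proof.
apply: borel_measurable_fun_within; first exact: codom_isopen.
by move=> x; exact: (C1_on_cont (@vol_density_C1 _ _ _ g i)).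
Qed.

(** Turns the specification of the volume by iterated integrals over all of [R^n] into an integral
    over the open set [codom i] against the measure [L]. *)
Lemma chart_density (i : chart M) (A : set (borel M)) : measurable A -> A `<=` dom i ->
  mu A = (\int[L]_(x in codom i) (vol_density g i x * \1_A (param i x))%:E)%E.
Proof.
move=> mA Ai; rewrite (hmu mA Ai).
have BE : coord i @` A = codom i `&` param i @^-1` A.
  apply/seteqP; split=> x /=.
    by move=> [p Ap <-]; split; [exists p => //; exact: Ai|rewrite coordK//; exact: Ai].
  by move=> [/codomP[ix xE] Ax]; exists (param i x).
have mB : measurable (coord i @` A : set (borel 'rV[R]_n)).
  by rewrite BE; apply: param_measurable => //; exact: codom_measurable.
have E : (fun x : 'rV[R]_n => (Num.sqrt (\det (g i x)) * \1_(coord i @` A) x)%:E) =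
  (fun x => (vol_density g i x * \1_A (param i x))%:E) \_ (codom i).
  apply/funext => x; rewrite patchE; case: ifPn => xi.
    rewrite inE in xi; congr (_ * _)%:E; rewrite !indicE; congr (nat_of_bool _)%:R.
    by apply/asboolP/asboolP; rewrite ?BE => //= -[].
  by rewrite indicE memNset ?mulr0// BE => -[ix _]; rewrite (mem_set ix) in xi.
rewrite E -(proj2 HL).
- by rewrite [RHS]integral_mkcond.
- apply/(measurable_restrict _ (codom_measurable i) measurableT); rewrite setTI.
  apply/measurable_EFinP; apply: measurable_funM; first exact: vol_density_measurable.
  apply: (@measurable_comp _ _ _ _ _ _ setT _ _ _ _ _ _ (@param_measurable i)) => //.
- by move=> x; rewrite patchE; case: ifPn => // _; rewrite lee_fin mulr_ge0// sqrtr_ge0.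
Qed.

Lemma ge0_chart_integral (i : chart M) (f : M -> \bar R) :
  measurable_fun (dom i : set (borel M)) (f : borel M -> \bar R) ->
  (forall q, dom i q -> (0 <= f q)%E) ->
  (\int[mu]_(q in dom i) f q = \int[L]_(x in codom i) ((vol_density g i x)%:E * f (param i x)))%E.
Proof.
move=> mf f0; apply: (@ge0_integral_density _ _ (borel M) (borel 'rV[R]_n) R mu L
  (param i) (vol_density g i) (dom i) (codom i)) => //.
- exact: dom_measurable.
- exact: codom_measurable.
- exact: param_measurable.
- exact: vol_density_measurable.
- by move=> x _; exact: sqrtr_ge0.
- by move=> x /codomP[].
- by move=> A mA Ai; exact: chart_density.
Qed.

Lemma chart_integral (i : chart M) (f : M -> R) :
  measurable_fun (dom i : set (borel M)) (f : borel M -> R) ->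
  (\int[mu]_(q in dom i) (f q)%:E =
   \int[L]_(x in codom i) (vol_density g i x * f (param i x))%:E)%E.
Proof.
move=> mf; apply: (@integral_density _ _ (borel M) (borel 'rV[R]_n) R mu L
  (param i) (vol_density g i) (dom i) (codom i)) => //.
- exact: dom_measurable.
- exact: codom_measurable.
- exact: param_measurable.
- exact: vol_density_measurable.
- by move=> x _; exact: sqrtr_ge0.
- by move=> x /codomP[].
- by move=> A mA Ai; exact: chart_density.
Qed.

End ChartIntegral.

(** * Local integration by parts *)

Section LocalWeakBound.
Context {R : realType} {n : nat} {M : oriented_manifold R n}.
Variables (g : riemannian_metric M) (X : vector_field M).
Variable (mu : {measure set (borel M) -> \bar R}).
Hypothesis hmu : is_riemannian_volume g mu.
Local Notation d := (riemannian_dist g).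

Definition lie (psi : M -> R) (q : M) : R :=
  let i := chart_at q in dfun i psi (coord i q) (X i (coord i q)).

Lemma lie_chart (psi : M -> R) (i : chart M) q : C1_fun psi -> dom i q ->
  lie psi q = dfun i psi (coord i q) (X i (coord i q)).
Proof.
move=> pC iq; rewrite /lie; set j := chart_at q; have jq : dom j q by exact: chart_atP.
have ijq := overlap_coord iq jq.
rewrite [RHS](dfun_transition _ pC ijq) -(field_compat X ijq).
by rewrite /transition /= coordK.
Qed.

Lemma dfun_locally_constant (psi : M -> R) (c : R) (i : chart M) (q : M) v :
  dom i q -> (\forall x \near q, psi x = c) ->
  dfun i psi (coord i q) v = 0.
Proof.
move=> iq pc; rewrite /dfun big1// => k _.
rewrite (@partial_near _ _ _ (cst c)); first by rewrite /partial derive_cst mulr0.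
have := nbhs_param (codom_coord iq); rewrite coordK// => /(_ _ pc).
by apply: filterS => y [].
Qed.

Lemma near_zero_off_ball (psi : M -> R) (i : chart M) (p : M) r (q : M) : 0 < r ->
  (forall x, `|x - coord i p| <= r -> codom i x) ->
  (forall q, psi q != 0 -> dom i q /\ `|coord i q - coord i p| <= r) ->
  ~ dom i q -> \forall x \near q, psi x = 0.
Proof.
move=> r0 rU ps nq.
pose K := param i @` [set y : 'rV[R]_n | `|y - coord i p| <= r].
have oK : open (~` K).
  apply: closed_openC; apply: compact_closed; first exact: manifold_hausdorff.
  exact: compact_param_ball.
apply: (near_open oK).
  by move=> [y yr yq]; apply: nq; rewrite -yq; have [] := codomP (rU y yr).
move=> x Kx; apply/eqP/negPn/negP => /ps[ix xr].
by apply: Kx; exists (coord i x) => //; rewrite coordK.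
Qed.

Lemma dfun_continuous (psi : M -> R) (i : chart M) q : C1_fun psi -> dom i q ->
  {for q, continuous (fun q => dfun i psi (coord i q) (X i (coord i q)))}.
Proof.
move=> pC iq; have cq := codom_coord iq.
have cc : {for q, continuous (coord i)} by exact: Defs.coord_continuous.
apply: continuous_sumR => k _; apply: continuousM.
  apply: (@continuous_comp _ _ _ (coord i) (fun x => X i x 0 k)) => //.
  exact: (C1_on_cont (@field_C1 _ _ _ X i k)).
apply: (@continuous_comp _ _ _ (coord i) (partial k (psi \o param i))) => //.
exact: (C1_on_partial (pC i)).
Qed.

Lemma near_lt_continuous (T : topologicalType) (f : T -> R) (x : T) (c : R) :
  {for x, continuous f} -> f x < c -> \forall y \near x, f y < c.
Proof. by move=> fc; exact: (@cvgr_lt _ _ _ _ _ _ fc). Qed.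

Lemma near_gt_continuous (T : topologicalType) (f : T -> R) (x : T) (c : R) :
  {for x, continuous f} -> c < f x -> \forall y \near x, c < f y.
Proof. by move=> fc; exact: (@cvgr_gt _ _ _ _ _ _ fc). Qed.

(** [W] is the value of [vol_density * X] at [p]. All quantities are continuous at [p], where the
    last inequality holds with room to spare. *)
Lemma frozen_field_estimate (i : chart M) p (eta : R) : dom i p -> 0 < eta ->
  exists (W : 'rV[R]_n) (rho A : R) (E : 'I_n -> R),
  [/\ 0 < rho, 0 <= A, forall k, 0 <= E k &
  forall x, `|x - coord i p| < rho ->
    [/\ codom i x, local_norm g i x W <= A,
      forall k, local_norm g i x (delta_mx 0 k) <= E k &
      A + \sum_k E k * `|vol_density g i x * X i x 0 k - W 0 k| <=
        vol_density g i x * (local_norm g i x (X i x) + eta)]].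
Proof.
move=> ip eta0; have ix := codom_coord ip; set x0 := coord i p in ix *.
pose w := vol_density g i; have w0 : 0 < w x0 by exact: vol_density_gt0.
pose W : 'rV[R]_n := w x0 *: X i x0.
pose E k := local_norm g i x0 (delta_mx 0 k) + 1.
have E0 k : 0 <= E k by rewrite addr_ge0// local_norm_ge0.
pose a := local_norm g i x0 W.
(* One [e] is spent on [A = a + e], one on the lower bound [a - e] of [w * |X|], and [\sum_k E k] of
   them on the components; the total is [eta * w x0 / 2], which is below [eta * w x]. *)
pose e := eta * w x0 / 2 / (2 + \sum_k E k).
have sE : 0 < 2 + \sum_k E k by rewrite ltr_pwDl// sumr_ge0.
have e0 : 0 < e by rewrite !divr_gt0// mulr_gt0.
have cidx : {for x0, continuous (fun x : 'rV[R]_n => x)} by exact: cvg_id.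
have cw : {for x0, continuous w} by exact: (C1_on_cont (@vol_density_C1 _ _ _ g i)).
have cX k : {for x0, continuous (fun x => X i x 0 k)}.
  exact: (C1_on_cont (@field_C1 _ _ _ X i k)).
have cXm : {for x0, continuous (X i)}.
  by apply: continuous_matrix => b k; rewrite (ord1 b).
have near1 : \forall x \near x0, local_norm g i x W < a + e.
  apply: near_lt_continuous; last by rewrite ltrDl.
  by apply: (continuous_local_norm (t := x0) ix cidx); exact: cst_continuous.
have near2 : \forall x \near x0, forall k, local_norm g i x (delta_mx 0 k) < E k.
  apply: near_finite => k; apply: near_lt_continuous; last by rewrite ltrDl.
  by apply: (continuous_local_norm (t := x0) ix cidx); exact: cst_continuous.
have near3 : \forall x \near x0, forall k, `|w x * X i x 0 k - W 0 k| < e.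
  apply: near_finite => k.
  have : {for x0, continuous (fun x => w x * X i x 0 k)} by apply: continuousM.
  move=> /cvgrPdist_lt/(_ _ e0); apply: filterS => x.
  by rewrite distrC mxE.
have near4 : \forall x \near x0, w x0 / 2 < w x.
  by apply: near_gt_continuous => //; rewrite ltr_pdivrMr// ltr_pMr// ltr1n.
have near5 : \forall x \near x0, a - e < w x * local_norm g i x (X i x).
  apply: near_gt_continuous.
    apply: continuousM => //; exact: (continuous_local_norm (t := x0) ix cidx cXm).
  by rewrite /a /W local_normZ gtr0_norm// ltrBlDr ltrDl.
have : \forall x \near x0, [/\ codom i x, local_norm g i x W < a + e,
   forall k, local_norm g i x (delta_mx 0 k) < E k,
   forall k, `|w x * X i x 0 k - W 0 k| < e &
   w x0 / 2 < w x /\ a - e < w x * local_norm g i x (X i x)].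
  near=> x; split; last split.
  - by near: x; exact: (near_open (@codom_isopen _ _ _ i) ix).
  - by near: x.
  - by near: x.
  - by near: x.
  - by near: x.
  - by near: x.
move=> /nbhs_ballP[rho /= rho0 rhoP].
exists W, rho, (a + e), E; split => //.
  by rewrite addr_ge0// ?local_norm_ge0// ltW.
move=> x xr; have [|cx x1 x2 x3 [x4 x5]] := rhoP x.
  by rewrite -ball_normE /= distrC.
split=> //; [exact: ltW|by move=> k; exact: ltW|].
have sum_le : \sum_k E k * `|w x * X i x 0 k - W 0 k| <= (\sum_k E k) * e.
  by rewrite mulr_suml; apply: ler_sum => k _; rewrite ler_wpM2l// ltW.
have ee : e * (2 + \sum_k E k) = eta * w x0 / 2 by rewrite /e divfK// gt_eqF.
have : eta * (w x0 / 2) <= eta * w x by rewrite ler_pM2l// ltW.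
rewrite -/(w x) mulrDr; set S := \sum_k _ * `|_|; move: sum_le; rewrite -/S.
set T := \sum_k E k in ee *; nra.
Unshelve. all: by end_near. Qed.

(* Near [p] the vector field [vol_density * X] is replaced by its constant value [W] at [p]:
   [phi] varies along [W] at rate at most [lip * |W|], and the remaining components along the
   coordinate directions are as small as needed, whence the error [eta]. *)
Lemma local_weak_bound (i : chart M) p (eta : R) : dom i p -> 0 < eta ->
  exists2 U : set M, nbhs p U &
  forall (D psi phi : M -> R) (r lip C : R),
    0 < r -> C1_fun psi -> (forall q, 0 <= psi q) ->
    (forall x, `|x - coord i p| <= r -> codom i x /\ U (param i x)) ->
    (forall q, psi q != 0 -> dom i q /\ `|coord i q - coord i p| <= r) ->
    (forall q, psi q != 0 -> D q = local_div g X i (coord i q)) ->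
    continuous phi -> (forall q, `|phi q| <= C) -> 0 <= lip ->
    (forall q q' e, (d q q' <= e%:E)%E -> `|phi q - phi q'| <= lip * e) ->
    mu.-integrable setT (EFin \o (fun q : borel M => phi q * (psi q * D q + lie psi q))) /\
    (`| \int[mu]_q (phi q * (psi q * D q + lie psi q))%:E | <=
       \int[mu]_q (2 * lip * (psi q * (field_norm g X q + eta)))%:E)%E.
Proof.
move=> ip eta0.
have [L HL] := @lebesgue_rV_exists R n.
have [W [rho [A [E [rho0 A0 E0 good]]]]] := frozen_field_estimate ip eta0.
set x0 := coord i p in good *.
(* Half of [rho] bounds the support of [psi]; the other half is room for the shifts by
   [h *: v j]. *)
exists [set q | dom i q /\ `|coord i q - x0| < rho / 2].
  apply: filterI; first by apply: open_nbhs_nbhs; split => //; exact: dom_open.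
  apply: (@Defs.coord_continuous _ _ M i p ip [set x : 'rV[R]_n | `|x - x0| < rho / 2]).
  by apply/nbhs_ballP; exists (rho / 2); rewrite /= ?divr_gt0// => x; rewrite -ball_normE /= distrC.
move=> D psi phi r lip C r0 pC p0 rU psupp pD cphi phiC lip0 philip.
have rho20 : 0 < rho / 2 by rewrite divr_gt0.
have oc := @codom_isopen _ _ _ i.
have rcod x : `|x - x0| <= r -> codom i x by move=> /rU[].
have rrho x : `|x - x0| <= r -> `|x - x0| < rho / 2.
  by move=> /rU[cx [_ +]]; have [_ ->] := codomP cx.
pose w := vol_density g i.
pose pt (x : 'rV[R]_n) := psi (param i x).
have ptsupp x : codom i x -> pt x != 0 -> `|x - x0| <= r.
  by move=> cx /psupp[_]; have [_ ->] := codomP cx.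
have ptC : C1_on (codom i) pt by exact: (pC i).
pose wXW k (x : 'rV[R]_n) := w x * X i x 0 k + - W 0 k.
have wXWC k : C1_on (codom i) (wXW k).
  exact: (C1_onD oc (@vol_field_C1 _ _ _ g X i k) (C1_on_cst (- W 0 k))).
pose u (j : option 'I_n) : 'rV[R]_n -> R := if j is Some k
  then extend (codom i) (fun x => wXW k x * pt x) else extend (codom i) pt.
pose v (j : option 'I_n) : 'rV[R]_n := if j is Some k then delta_mx 0 k else W.
pose N (j : option 'I_n) : R := if j is Some k then E k else A.
(* By [dist_segment], a shift by [h *: v j] moves a point by a distance of at most [2 * h * N j]. *)
pose B j := 2 * lip * N j.
pose s : seq (option 'I_n) := None :: [seq Some k | k <- index_enum 'I_n].
pose Phi := extend (codom i) (phi \o param i).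
have N0 j : 0 <= N j by case: j => [k|] /=.
have goodN j x : `|x - x0| < rho -> local_norm g i x (v j) <= N j.
  by move=> /good[_ gW gk _]; case: j => [k|] /=; [exact: gk|exact: gW].
have uC j : C1_on setT (u j).
  case: j => [k|] /=.
    apply: (extend_C1 oc (C1_onM oc (wXWC k) ptC) r0 rcod).
    by move=> x cx; rewrite mulf_eq0 negb_or => /andP[_]; exact: ptsupp.
  exact: (extend_C1 oc ptC r0 rcod).
have usupp j x : u j x != 0 -> codom i x /\ `|x - x0| <= r.
  have [cx|ncx] := pselect (codom i x); last by case: j => [k|] /=; rewrite extend_out// eqxx.
  case: j => [k|] /=; rewrite extendE//; last by move=> /ptsupp - /(_ cx).
  by rewrite mulf_eq0 negb_or => /andP[_ /ptsupp]; split => //; auto.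
pose r' := `|x0| + r + 1.
have r'0 : 0 < r' by rewrite ltr_wpDl// addr_ge0// ltW.
have ur' j x : r' <= `|x| -> u j x = 0.
  move=> xr; apply/eqP/negPn/negP => /usupp[_].
  by have := ler_distD x0 x 0; rewrite !subr0; rewrite /r' in xr; lra.
have C0 : 0 <= C by exact: le_trans (phiC p).
have mPhi : measurable_fun setT (Phi : borel 'rV[R]_n -> R).
  apply: extend_measurable => // x cx; apply: continuous_comp; last exact: cphi.
  exact: (param_continuous cx).
have PhiC x : `|Phi x| <= C.
  by rewrite /Phi /extend; case: asboolP => _; rewrite ?normr0// phiC.
have B0 j : 0 <= B j by rewrite !mulr_ge0.
have HB j : exists2 d, 0 < d &
     forall h x, 0 < h < d -> u j x != 0 -> `|Phi (x - h *: v j) - Phi x| <= B j * h.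
  (* The shifts are shorter than [rho / 2]; the [+ 1] covers [v j = 0]. *)
  exists (rho / 2 / (`|v j| + 1)); first by rewrite divr_gt0// ltr_wpDl.
  move=> h x /andP[h0 hd] /usupp[cx /rrho xr].
  have hv : h * `|v j| < rho / 2.
    move: hd; rewrite ltr_pdivlMr ?ltr_wpDl// mulrDr mulr1; lra.
  have xt (t : R) : -1 <= t <= 1 -> `|x + t *: (- (h *: v j)) - x0| < rho.
    move=> t1; rewrite addrAC; apply: le_lt_trans (ler_normD _ _) _.
    rewrite normrZ normrN normrZ (gtr0_norm h0).
    have : `|t| * (h * `|v j|) <= 1 * (h * `|v j|).
      by apply: ler_wpM2r; [rewrite mulr_ge0// ltW|rewrite ler_norml].
    lra.
  have cxt t : -1 <= t <= 1 -> codom i (x + t *: - (h *: v j)) by move=> /xt/good[].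
  have cx1 : codom i (x - h *: v j).
    by have := cxt 1; rewrite scale1r; apply; lra.
  rewrite /Phi !extendE//=.
  have := @dist_segment _ _ _ g i x (- (h *: v j)) (h * N j) cxt.
  have H t : -1 <= t <= 1 -> local_norm g i (x + t *: - (h *: v j)) (- (h *: v j)) <= h * N j.
    move=> t1; rewrite -scaleNr local_normZ normrN (gtr0_norm h0) ler_pM2l//.
    by apply: goodN; rewrite scaleNr; exact: xt.
  move=> /(_ H); rewrite dist_sym => /philip.
  by rewrite /B (_ : lip * _ = 2 * lip * N j * h)//; ring.
have [iH bH] := weak_divergence_bound HL s (v := v) r'0 uC ur' mPhi PhiC B0 HB.
set H := (fun x : borel 'rV[R]_n => _) in iH.
(* The sum of the directional derivatives is the coordinate divergence of [w * psi * X]: the terms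
   with [W] cancel. *)
have flux x : codom i x -> \sum_(j <- s) 'D_(v j) (u j) x =
    w x * (pt x * local_div g X i x + \sum_k X i x 0 k * partial k pt x).
  move=> cx; rewrite /s big_cons big_map /=.
  rewrite derive_partials; last exact: (C1_on_diff (uC None)).
  have e1 k : partial k (extend (codom i) pt) x = partial k pt x by exact: extend_partial.
  have e2 k : 'D_(delta_mx 0 k) (extend (codom i) (fun y => wXW k y * pt y)) x =
      wXW k x * partial k pt x + pt x * partial k (fun y => w y * X i y 0 k) x.
    transitivity (partial k (fun y => wXW k y * pt y) x); first exact: extend_partial.
    rewrite /partial deriveM; [|exact: (diff_derivable (C1_on_diff (wXWC k) cx))|
       exact: (diff_derivable (C1_on_diff ptC cx))].
    rewrite deriveD; [|exact: (diff_derivable (C1_on_diff (@vol_field_C1 _ _ _ g X i k) cx))|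
       exact: derivable_cst].
    by rewrite derive_cst addr0.
  rewrite (eq_bigr _ (fun k _ => congr1 ( *%R _) (e1 k))) (eq_bigr _ (fun k _ => e2 k)).
  rewrite big_split /= -mulr_sumr -vol_density_div// addrA -big_split /=.
  rewrite mulrDr addrC; congr (_ + _); first by rewrite -/(w x); ring.
  rewrite mulr_sumr; apply: eq_bigr => k _; rewrite /wXW; ring.
pose h (q : borel M) := phi q * (psi q * D q + lie psi q).
pose h0 (q : borel M) := phi q * (psi q * local_div g X i (coord i q) +
   dfun i psi (coord i q) (X i (coord i q))).
have hE q : dom i q -> h q = h0 q.
  move=> iq; rewrite /h /h0 (lie_chart pC iq); congr (_ * (_ + _)).
  by have [->|/pD ->//] := eqVneq (psi q) 0; rewrite !mul0r.
have lie_out q : ~ dom i q -> lie psi q = 0.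
  move=> nq; apply: (@dfun_locally_constant _ 0); first exact: chart_atP.
  exact: near_zero_off_ball r0 rcod psupp nq.
have psi_out q : ~ dom i q -> psi q = 0.
  by move=> nq; apply/eqP/negPn/negP => /psupp[].
have h_out q : ~ dom i q -> h q = 0.
  by move=> nq; rewrite /h lie_out// psi_out// mul0r addr0 mulr0.
have mdom : measurable (dom i : set (borel M)) by exact: dom_measurable.
have mcod := @codom_measurable _ _ _ i.
have ch q : dom i q -> {for q, continuous (coord i)} by exact: Defs.coord_continuous.
have mh : measurable_fun (dom i : set (borel M)) h.
  apply: (@eq_measurable_fun _ _ _ _ _ h0); first by move=> q; rewrite inE => /hE.
  apply: borel_measurable_fun_within; first exact: dom_open.
  move=> q iq; apply: continuousM; first exact: cphi.
  apply: continuousD; last exact: dfun_continuous.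
  apply: continuousM; first exact: C1_fun_continuous.
  apply: (@continuous_comp _ _ _ (coord i) (local_div g X i)); first exact: ch.
  by apply: local_div_continuous; exact: codom_coord.
have restr (f : borel M -> \bar R) : (forall q, ~ dom i q -> f q = 0%E) -> f = f \_ (dom i).
  move=> fo; apply/funext => q; rewrite patchE; case: ifPn => // /negP nq.
  by apply: fo => iq; apply: nq; rewrite inE.
have whE x : codom i x -> w x * h (param i x) = H x.
  move=> cx; have [dx cE] := codomP cx.
  rewrite (hE _ dx) /h0 cE /H flux// /Phi extendE// /dfun -/(pt x) /=; ring.
have H_out x : ~ codom i x -> H x = 0 by move=> nx; rewrite /H /Phi extend_out// mul0r.
have restrL (f : borel 'rV[R]_n -> \bar R) :
    (forall x, ~ codom i x -> f x = 0%E) -> f = f \_ (codom i).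
  move=> fo; apply/funext => x; rewrite patchE; case: ifPn => // /negP nx.
  by apply: fo => cx; apply: nx; rewrite inE.
split.
  apply/integrableP; split.
    rewrite (restr (EFin \o h)); last by move=> q /h_out /= ->.
    apply/(measurable_restrict _ mdom measurableT); rewrite setTI.
    exact/measurable_EFinP.
  rewrite (restr (fun q => `|(EFin \o h) q|)%E); last by move=> q /h_out /= ->; rewrite normr0.
  rewrite -integral_mkcond (ge0_chart_integral hmu HL); last 2 first.
  - by apply: measurableT_comp => //; exact/measurable_EFinP.
  - by move=> q _; rewrite abse_ge0.
  move: iH => /integrableP[_]; apply: le_lt_trans.
  rewrite [X in (_ <= X)%E](_ : _ = \int[L]_(x in codom i) `|(EFin \o H) x|)%E; last first.
    rewrite [RHS]integral_mkcond; congr integral; apply: restrL => x /H_out /= ->.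
    by rewrite normr0.
  rewrite le_eqVlt; apply/orP; left; apply/eqP; apply: eq_integral => x; rewrite inE => cx.
  have w0 : 0 <= w x by exact: sqrtr_ge0.
  by rewrite /= -(whE x cx) [in RHS]normrM (ger0_norm w0) EFinM.
have -> : (\int[mu]_q (phi q * (psi q * D q + lie psi q))%:E = \int[L]_x (H x)%:E)%E.
  rewrite (restr (fun q => (h q)%:E)); last by move=> q /h_out ->.
  rewrite -integral_mkcond (chart_integral hmu HL mh).
  rewrite (restrL (fun x => (H x)%:E)); last by move=> x /H_out ->.
  rewrite -integral_mkcond; apply: eq_integral => x; rewrite inE => cx.
  by rewrite -(whE x cx).
apply: le_trans bH _.
pose k0 (q : borel M) := 2 * lip * (psi q * (field_norm g X q + eta)).
have k00 q : 0 <= k0 q.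
  by rewrite !mulr_ge0// addr_ge0 ?sqrtr_ge0// ltW.
rewrite (restr (fun q => (k0 q)%:E)); last by move=> q /psi_out e; rewrite /k0 e mul0r mulr0.
rewrite -integral_mkcond (ge0_chart_integral hmu HL); last 2 first.
- apply/measurable_EFinP.
  apply: (@eq_measurable_fun _ _ _ _ _ (fun q : borel M => 2 * lip * (psi q *
     (local_norm g i (coord i q) (X i (coord i q)) + eta)))).
    by move=> q; rewrite inE => iq; rewrite /k0 (field_norm_chart g X iq).
  apply: borel_measurable_fun_within; first exact: dom_open.
  move=> q iq; apply: continuousM; first exact: cst_continuous.
  apply: continuousM; first exact: C1_fun_continuous.
  apply: continuousD; last exact: cst_continuous.
  apply: continuous_local_norm; [exact: codom_coord|exact: ch|].
  apply: continuous_comp; first exact: ch.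
  apply: continuous_matrix => b k; rewrite (ord1 b).
  exact: (C1_on_cont (@field_C1 _ _ _ X i k) (codom_coord iq)).
- by move=> q _; rewrite lee_fin.
rewrite (restrL (fun x => (\sum_(j <- s) B j * `|u j x|)%:E)); last first.
  move=> x nx; rewrite big1// => j _; have [->|/usupp[]//] := eqVneq (u j x) 0.
  by rewrite normr0 mulr0.
rewrite -integral_mkcond; apply: ge0_le_integral => //.
- by move=> x _; rewrite lee_fin; apply: sumr_ge0 => j _; rewrite mulr_ge0.
- apply/measurable_EFinP; apply: measurable_funTS; apply: measurable_sum => j.
  apply: measurable_funM => //; apply: measurableT_comp => //.
  by apply: borel_measurable_continuous => x; exact: (C1_on_cont (uC j)).
- apply/measurable_EFinP.
  apply: (@eq_measurable_fun _ _ _ _ _ (fun x : borel 'rV[R]_n => w x * (2 * lip * (pt x *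
     (local_norm g i x (X i x) + eta))))).
    move=> x; rewrite inE => cx; have [dx cE] := codomP cx.
    by rewrite /k0 (field_norm_chart g X dx) cE.
  apply: borel_measurable_fun_within => // x cx; apply: continuousM.
    exact: (C1_on_cont (@vol_density_C1 _ _ _ g i)).
  apply: continuousM; first exact: cst_continuous.
  apply: continuousM; first exact: (C1_on_cont ptC).
  apply: continuousD; last exact: cst_continuous.
  have cidx : {for x, continuous (fun y : 'rV[R]_n => y)} by exact: cvg_id.
  apply: (continuous_local_norm (t := x) cx cidx).
  apply: continuous_matrix => b k; rewrite (ord1 b).
  exact: (C1_on_cont (@field_C1 _ _ _ X i k)).
move=> x cx; rewrite -EFinM lee_fin.
have [dx cE] := codomP cx.
rewrite /k0 (field_norm_chart g X dx) cE /s big_cons big_map /= -/(pt x) extendE//.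
under eq_bigr do rewrite extendE//.
have [->|ptx] := eqVneq (pt x) 0.
  by rewrite normr0 mulr0 big1 ?addr0 ?mul0r ?mulr0// => k _; rewrite mulr0 normr0 mulr0.
have ptx0 : 0 <= pt x by exact: p0.
have [|_ _ _ gx] := good x; first by have := rrho _ (ptsupp x cx ptx); lra.
rewrite (ger0_norm ptx0).
have -> : \sum_k B (Some k) * `|wXW k x * pt x| =
    2 * lip * pt x * \sum_k E k * `|w x * X i x 0 k - W 0 k|.
  rewrite mulr_sumr; apply: eq_bigr => k _; rewrite normrM (ger0_norm ptx0) /B /wXW /=; ring.
rewrite /B /=; set S := \sum_k _ in gx *.
have -> : 2 * lip * A * pt x + 2 * lip * pt x * S = 2 * lip * pt x * (A + S) by ring.
have -> : w x * (2 * lip * (pt x * (local_norm g i x (X i x) + eta))) =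
  2 * lip * pt x * (w x * (local_norm g i x (X i x) + eta)) by ring.
by rewrite ler_wpM2l// !mulr_ge0.
Qed.

End LocalWeakBound.

(** * Volume of neighborhoods and chart independence of the divergence *)

Section Volume.
Context {R : realType} {n : nat} {M : oriented_manifold R n}.
Variables (g : riemannian_metric M) (X : vector_field M).
Variable (mu : {measure set (borel M) -> \bar R}).
Hypothesis hmu : is_riemannian_volume g mu.

Lemma chart_ball_open (i : chart M) (a : 'rV[R]_n) (r : R) :
  open [set q | dom i q /\ ball a r (coord i q)].
Proof.
rewrite openE => q [iq qr]; apply: filterI.
  by apply: open_nbhs_nbhs; split => //; exact: dom_open.
apply: (@Defs.coord_continuous _ _ M i q iq (ball a r)).
by apply: open_nbhs_nbhs; split => //; exact: ball_open.
Qed.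

(** [V] is a coordinate ball on which the density lies between half and twice its value at [p]. *)
Lemma volume_nbhs p (U : set M) : nbhs p U -> exists V : set M,
  [/\ open V, V p, V `<=` U & (0 < mu V < +oo)%E].
Proof.
move=> pU; have [L HL] := @lebesgue_rV_exists R n.
pose i := chart_at p; have ip : dom i p by exact: chart_atP.
have ix := codom_coord ip; pose w := vol_density g i.
have w0 : 0 < w (coord i p) by exact: vol_density_gt0.
have cw : {for coord i p, continuous w}.
  exact: (C1_on_cont (@vol_density_C1 _ _ _ g i)).
have near1 : \forall x \near coord i p, w (coord i p) / 2 < w x.
  by apply: near_gt_continuous => //; rewrite ltr_pdivrMr// ltr_pMr// ltr1n.
have near2 : \forall x \near coord i p, w x < w (coord i p) * 2.
  by apply: near_lt_continuous => //; rewrite ltr_pMr// ltr1n.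
have [r0 /= r00 r0U] : nbhs_ball (coord i p)
    [set x | [/\ codom i x, U (param i x), w (coord i p) / 2 < w x & w x < w (coord i p) * 2]].
  apply/nbhs_ballP; near=> x; split.
  - by near: x; exact: (near_open (@codom_isopen _ _ _ i) ix).
  - near: x; have := nbhs_param ix; rewrite coordK// => /(_ _ pU).
    by apply: filterS => x [].
  - by near: x.
  - by near: x.
pose B := ball (coord i p) r0.
pose V := [set q | dom i q /\ B (coord i q)].
have oV : open V by exact: chart_ball_open.
have mV : measurable (V : set (borel M)) by exact: borel_open_measurable.
have mB : measurable (B : set (borel 'rV[R]_n)) by apply: borel_open_measurable; exact: ball_open.
have muV : mu V = (\int[L]_(x in (B : set (borel 'rV[R]_n))) (w x)%:E)%E.
  have Vi : V `<=` dom i by move=> q [].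
  rewrite (chart_density hmu HL mV Vi).
  rewrite [RHS]integral_mkcond [LHS]integral_mkcond; apply: eq_integral => x _.
  rewrite !patchE; case: ifPn => [|/negP nx]; last first.
    rewrite memNset// => Bx; apply: nx; rewrite inE.
    by have [] := r0U x Bx.
  rewrite inE => cx; have [dx cE] := codomP cx.
  rewrite indicE; case: ifPn => [|/negP nB].
    rewrite inE => Bx; rewrite mem_set ?mulr1//.
    by split => //=; rewrite cE.
  rewrite memNset ?mulr0// => -[_]; rewrite /= cE => Bx; apply: nB.
  by rewrite inE.
have mw : measurable_fun (B : set (borel 'rV[R]_n)) (EFin \o w).
  apply/measurable_EFinP; apply: borel_measurable_fun_within; first exact: ball_open.
  move=> x Bx; apply: (C1_on_cont (@vol_density_C1 _ _ _ g i)).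
  by have [] := r0U x Bx.
exists V; split => //.
- by split => //; exact: ballxx.
- by move=> q [iq /r0U[_ + _ _]]; rewrite coordK.
rewrite muV; apply/andP; split.
  apply: (@lt_le_trans _ _ (\int[L]_(x in (B : set (borel 'rV[R]_n))) (w (coord i p) / 2)%:E)%E).
    rewrite integral_cst// (proj1 HL)// -EFinM lte_fin mulr_gt0 ?divr_gt0// exprn_gt0//.
    by rewrite mulr_gt0.
  apply: ge0_le_integral => //.
  - by move=> x _; rewrite lee_fin divr_ge0// ltW.
  - by move=> x Bx; rewrite lee_fin ltW//; have [] := r0U x Bx.
apply: (@le_lt_trans _ _ (\int[L]_(x in (B : set (borel 'rV[R]_n))) (w (coord i p) * 2)%:E)%E).
  apply: ge0_le_integral => //.
  - by move=> x Bx; rewrite lee_fin ltW//; have [cx _ _ _] := r0U x Bx; exact: vol_density_gt0.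
  - by move=> x Bx; rewrite lee_fin ltW//; have [] := r0U x Bx.
by rewrite integral_cst// (proj1 HL)// -EFinM ltry.
Unshelve. all: by end_near. Qed.

(** The weak form with [phi = 1], whose Lipschitz constant is 0, says that the integral of
    [psi * D + X psi] vanishes when [D] is the local divergence in either chart. Subtracting, the
    integral of [psi * (Di - Dj)] vanishes for every small bump, whence equality by continuity. This
    use is why [local_weak_bound] takes the divergence as a parameter [D]. *)
Lemma local_div_chart (i j : chart M) p : dom i p -> dom j p ->
  local_div g X i (coord i p) = local_div g X j (coord j p).
Proof.
move=> ip jp.
have [Ui pUi HUi] := local_weak_bound X hmu ip (@ltr01 R).
have [Uj pUj HUj] := local_weak_bound X hmu jp (@ltr01 R).
have [rj rj0 rjU] := chart_closed_ball jp pUj.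
pose Di q := local_div g X i (coord i q); pose Dj q := local_div g X j (coord j q).
have cD (k : chart M) : dom k p ->
    {for p, continuous (fun q => local_div g X k (coord k q))}.
  move=> kp; apply: (@continuous_comp _ _ _ (coord k) (local_div g X k)).
    exact: Defs.coord_continuous.
  by apply: local_div_continuous; exact: codom_coord.
apply/eqP; rewrite -subr_eq0; apply/negPn/negP => dne.
pose delta := Di p - Dj p.
(* The factor [delta] makes [F] positive at [p] whichever of the two values is larger. *)
pose F q := delta * (Di q - Dj q).
have F0 : 0 < F p by rewrite /F -/delta lt0r mulf_neq0//= -expr2 sqr_ge0.
have cF : {for p, continuous F}.
  apply: continuousM; first exact: cst_continuous.
  apply: continuousB; exact: cD.
pose U := Ui `&` Uj `&` dom j `&` [set q | `|coord j q - coord j p| < rj] `&`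
  [set q | F p / 2 < F q].
have pU : nbhs p U.
  apply: filterI; last first.
    by apply: near_gt_continuous => //; rewrite ltr_pdivrMr// ltr_pMr// ltr1n.
  apply: filterI; last first.
    apply: (@Defs.coord_continuous _ _ M j p jp [set x : 'rV[R]_n | `|x - coord j p| < rj]).
    by apply/nbhs_ballP; exists rj => // x; rewrite -ball_normE /= distrC.
  apply: filterI; last by apply: open_nbhs_nbhs; split => //; exact: dom_open.
  exact: filterI.
have [psi [r r0 [pC p01 p1 rU psupp]]] := bump_manifold ip pU.
have p0 q : 0 <= psi q by have /andP[] := p01 q.
have psuppU q : psi q != 0 -> U q.
  by move=> /psupp[iq /rU[_ +]]; rewrite coordK.
have psuppj q : psi q != 0 -> dom j q /\ `|coord j q - coord j p| <= rj.
  by move=> /psuppU[[[_ jq] /ltW]].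
have c1 : continuous (fun _ : M => 1 : R) by move=> q; exact: cst_continuous.
have n1 (q : M) : `|(fun _ : M => 1 : R) q| <= 1 by rewrite normr1.
have lip1 (q q' : M) (e : R) : (riemannian_dist g q q' <= e%:E)%E ->
   `|(fun _ : M => 1 : R) q - (fun _ : M => 1 : R) q'| <= 0 * e.
  by rewrite subrr normr0 mul0r.
have rUi x : `|x - coord i p| <= r -> codom i x /\ Ui (param i x).
  by move=> /rU[cx [[[[]]]]].
have [ii bi] := HUi Di psi _ r 0 1 r0 pC p0 rUi psupp (fun q _ => erefl) c1 n1 (lexx 0) lip1.
have [ij bj] := HUj Dj psi _ rj 0 1 rj0 pC p0 rjU psuppj (fun q _ => erefl) c1 n1 (lexx 0) lip1.
pose h D (q : borel M) := 1 * (psi q * D q + lie X psi q).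
have zero D eta : (`|\int[mu]_q (h D q)%:E| <= \int[mu]_q (2 * 0 * (psi q * (field_norm g X q + eta)))%:E)%E ->
    (\int[mu]_q (h D q)%:E = 0)%E.
  rewrite [X in (_ <= X)%E](_ : _ = 0%E).
    by move=> ?; apply/eqP; rewrite -abse_eq0; apply/eqP/le_anti/andP; split.
  by apply: integral0_eq => q _; rewrite mulr0 mul0r.
have psiF0 : (\int[mu]_q (psi q * F q)%:E = 0)%E.
  transitivity (delta%:E * (\int[mu]_q (h Di q)%:E - \int[mu]_q (h Dj q)%:E))%E; last first.
    by rewrite (zero _ _ bi) (zero _ _ bj) sube0 mule0.
  rewrite -(integralB measurableT ii ij) -(integralZl measurableT (integrableB measurableT ii ij)).
  apply: eq_integral => q _; rewrite /= -EFinB -EFinM; congr EFin; rewrite /h /F; ring.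
have [V [oV Vp V1 /andP[V0 _]]] := volume_nbhs p1.
have mV : measurable (V : set (borel M)) by exact: borel_open_measurable.
suff : (0 < \int[mu]_q (psi q * F q)%:E)%E by rewrite psiF0 ltxx.
have psiF q : 0 <= psi q * F q.
  have [->|/psuppU[_ /= Fq]] := eqVneq (psi q) 0; first by rewrite mul0r.
  by rewrite mulr_ge0// ltW// (lt_trans _ Fq)// divr_gt0.
have mpsiF : measurable_fun [set: borel M] (fun q : borel M => (psi q * F q)%:E).
  have /measurable_int m := integrableZl measurableT delta (integrableB measurableT ii ij).
  apply: eq_measurable_fun m => q _; rewrite /= -EFinB -EFinM; congr EFin; rewrite /F; ring.
apply: (@lt_le_trans _ _ (\int[mu]_(q in V) (F p / 2)%:E)%E).
  by rewrite integral_cst// mule_gt0// lte_fin divr_gt0.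
apply: (@le_trans _ _ (\int[mu]_(q in V) (psi q * F q)%:E)%E); last first.
  by apply: ge0_subset_integral => // q _; rewrite lee_fin.
apply: ge0_le_integral => //.
- by move=> q _; rewrite lee_fin divr_ge0// ltW.
- exact: measurable_funTS.
move=> q Vq; have q1 : psi q = 1 by exact: V1.
rewrite lee_fin q1 mul1r ltW//.
by have [] := psuppU q; rewrite ?q1 ?oner_neq0.
Qed.

Lemma divergence_chart (i : chart M) p : dom i p ->
  divergence g X p = local_div g X i (coord i p).
Proof. by move=> ip; apply: local_div_chart => //; exact: chart_atP. Qed.

Lemma divergence_continuous : continuous (divergence g X).
Proof.
move=> p; pose i := chart_at p; have ip : dom i p by exact: chart_atP.
apply: (@continuous_near_eq _ _ (local_div g X i \o coord i)).
  by apply: (near_open (dom_open i) ip) => q iq /=; rewrite (divergence_chart iq).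
apply: continuous_comp; first exact: Defs.coord_continuous.
by apply: local_div_continuous; exact: codom_coord.
Qed.

End Volume.

(** * Global integration by parts *)

Section GlobalBound.
Context {R : realType} {n : nat} {M : oriented_manifold R n}.
Variables (g : riemannian_metric M) (X : vector_field M).
Variable (mu : {measure set (borel M) -> \bar R}).
Hypothesis hmu : is_riemannian_volume g mu.
Hypothesis hL1 : mu.-integrable [set: borel M] (fun p => (field_norm g X p)%:E).

Lemma C1_funD (f h : M -> R) : C1_fun f -> C1_fun h -> C1_fun (fun p => f p + h p).
Proof. by move=> fC hC j; apply: (C1_onD (@codom_isopen _ _ _ j) (fC j) (hC j)). Qed.

Lemma lieD (f h : M -> R) q : C1_fun f -> C1_fun h ->
  lie X (fun p => f p + h p) q = lie X f q + lie X h q.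
Proof.
move=> fC hC; rewrite /lie /dfun -big_split /=; apply: eq_bigr => k _.
have cq : codom (chart_at q) (coord (chart_at q) q) by apply: codom_coord; exact: chart_atP.
rewrite -mulrDr; congr (_ * _); rewrite /partial.
rewrite -deriveD//; exact: diff_derivable (C1_on_diff _ cq).
Qed.

(* The finite subcover is replaced by the composition law [f1 + (1 - f1) f2] of cutoffs, so no
   partition of unity is needed. *)
Lemma compact_cutoff (K : set M) (P : (M -> R) -> Prop) :
  P (fun=> 0) ->
  (forall f1 f2, C1_fun f1 -> (forall q, 0 <= f1 q <= 1) -> C1_fun f2 ->
     (forall q, 0 <= f2 q <= 1) -> P f1 -> P f2 -> P (fun q => f1 q + (1 - f1 q) * f2 q)) ->
  (forall p, exists2 U, nbhs p U & forall (i : chart M) (f : M -> R) (r : R), dom i p -> 0 < r ->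
     C1_fun f -> (forall q, 0 <= f q <= 1) ->
     (forall x, `|x - coord i p| <= r -> codom i x /\ U (param i x)) ->
     (forall q, f q != 0 -> dom i q /\ `|coord i q - coord i p| <= r) -> P f) ->
  compact K -> exists f, [/\ C1_fun f, forall q, 0 <= f q <= 1, forall q, K q -> f q = 1 & P f].
Proof.
move=> P0 PU Ploc cK.
apply: (@compact_ideal _ K (fun A : set M => exists f : M -> R,
  [/\ C1_fun f, forall q, 0 <= f q <= 1, forall q, A q -> f q = 1 & P f])) => //.
- by exists (fun=> 0); split => //; [exact: C1_fun_cst|move=> q; rewrite lexx ler01].
- move=> A B [f1 [C1 f01 f1A P1]] [f2 [C2 f02 f2B P2]].
  exists (fun q => f1 q + (1 - f1 q) * f2 q); split.
  + exact: (C1_funD C1 (C1_funM (C1_funB1 C1) C2)).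
  + by move=> q; have := f01 q; have := f02 q; nra.
  + by move=> q [/f1A ->|/f2B ->]; ring.
  + exact: PU.
- by move=> A B AB [f [C1 f01 fB Pf]]; exists f; split => // q /AB; exact: fB.
move=> p _; have [U pU HU] := Ploc p.
have ip : dom (chart_at p) p by exact: chart_atP.
have [f [r r0 [fC f01 f1 rU fs]]] := bump_manifold ip pU.
exists [set q | f q = 1] => //; exists f; split => //.
exact: (HU _ _ _ ip r0).
Qed.

(** Finiteness of the integral is what later absorbs the error [eta]; it survives the composition
    law because [f1 + (1 - f1) f2 <= f1 + f2]. *)
Lemma finite_cutoff (K : set M) : compact K -> exists chi : M -> R,
  [/\ C1_fun chi, forall q, 0 <= chi q <= 1, forall q, K q -> chi q = 1 &
      (\int[mu]_q (chi q)%:E < +oo)%E].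
Proof.
apply: compact_cutoff.
- by rewrite integral0.
- move=> f1 f2 C1 f01 C2 f02 P1 P2.
  have m1 := borel_measurable_continuous (C1_fun_continuous C1).
  have m2 := borel_measurable_continuous (C1_fun_continuous C2).
  apply: (@le_lt_trans _ _ (\int[mu]_q ((f1 q)%:E + (f2 q)%:E))%E).
    apply: ge0_le_integral => //.
    + by move=> q _; rewrite lee_fin; have := f01 q; have := f02 q; nra.
    + apply/measurable_EFinP; apply: measurable_funD => //; apply: measurable_funM => //.
      exact: measurable_funB.
    + by apply: emeasurable_funD; exact/measurable_EFinP.
    + by move=> q _; rewrite -EFinD lee_fin; have := f01 q; have := f02 q; nra.
  rewrite ge0_integralD//; [exact: lte_add_pinfty|..].
  + by move=> q _; rewrite lee_fin; have /andP[] := f01 q.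
  + exact/measurable_EFinP.
  + by move=> q _; rewrite lee_fin; have /andP[] := f02 q.
  + exact/measurable_EFinP.
move=> p; have [V [oV Vp _ /andP[_ V1]]] := volume_nbhs hmu (@filterT _ (nbhs p) _).
exists V; first exact: open_nbhs_nbhs.
move=> i f r ip r0 C1 f01 rV fs.
have mV : measurable (V : set (borel M)) by exact: borel_open_measurable.
have VE := integral_indic mu measurableT mV; rewrite setIT in VE.
rewrite -VE in V1; apply: le_lt_trans V1.
apply: ge0_le_integral => //.
- by move=> q _; rewrite lee_fin; have /andP[] := f01 q.
- by apply/measurable_EFinP; apply: borel_measurable_continuous; exact: C1_fun_continuous.
- by apply/measurable_EFinP; exact: measurable_indic.
move=> q _; rewrite lee_fin indicE; have [->|fq] := eqVneq (f q) 0; first by rewrite ler0n.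
rewrite mem_set; first by have /andP[] := f01 q.
by have [iq /rV[_]] := fs q fq; rewrite coordK.
Qed.

Section Fixed.
Variables (phi : M -> R) (C lip : R).
Hypotheses (cphi : continuous phi) (phiC : forall q, `|phi q| <= C) (lip0 : 0 <= lip).
Hypothesis philip : forall q q' e, (riemannian_dist g q q' <= e%:E)%E -> `|phi q - phi q'| <= lip * e.

(** [phi] times the divergence of [psi X]. *)
Let flux (psi : M -> R) (q : borel M) : R := phi q * (psi q * divergence g X q + lie X psi q).

Let bounded (eta : R) (psi : M -> R) : Prop :=
  mu.-integrable setT (EFin \o flux psi) /\
  (`| \int[mu]_q (flux psi q)%:E | <=
     \int[mu]_q (2 * lip * (psi q * (field_norm g X q + eta)))%:E)%E.

Let measurable_field_norm : measurable_fun [set: borel M] (field_norm g X : borel M -> R).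
Proof. by have /measurable_int/measurable_EFinP := hL1. Qed.

Lemma boundedD eta psi1 psi2 : 0 < eta -> C1_fun psi1 -> C1_fun psi2 ->
  (forall q, 0 <= psi1 q) -> (forall q, 0 <= psi2 q) ->
  bounded eta psi1 -> bounded eta psi2 -> bounded eta (fun q => psi1 q + psi2 q).
Proof.
move=> eta0 C1 C2 p10 p20 [i1 b1] [i2 b2].
have fE q : flux (fun q => psi1 q + psi2 q) q = flux psi1 q + flux psi2 q.
  by rewrite /flux lieD//; ring.
have fE' : EFin \o flux (fun q => psi1 q + psi2 q) =
    (fun q => (EFin \o flux psi1) q + (EFin \o flux psi2) q)%E.
  by apply/funext => q /=; rewrite fE.
split; first by rewrite fE'; exact: integrableD.
have -> : (\int[mu]_q (flux (fun q => (psi1 q + psi2 q)%R) q)%:E =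
    \int[mu]_q (flux psi1 q)%:E + \int[mu]_q (flux psi2 q)%:E)%E.
  by rewrite -integralD//; apply: eq_integral => q _; rewrite fE.
apply: le_trans (lee_abs_add _ _) _.
pose k psi (q : borel M) := 2 * lip * (psi q * (field_norm g X q + eta)).
have k0 psi q : (forall q, 0 <= psi q) -> 0 <= k psi q.
  by move=> psi0; rewrite !mulr_ge0// addr_ge0 ?sqrtr_ge0// ltW.
have mk psi : C1_fun psi -> measurable_fun [set: borel M] (EFin \o k psi).
  move=> pC; apply/measurable_EFinP; apply: measurable_funM => //; apply: measurable_funM.
    by apply: borel_measurable_continuous; exact: C1_fun_continuous.
  exact: measurable_funD.
apply: le_trans (leeD b1 b2) _; rewrite -ge0_integralD//.
- apply: ge0_le_integral => //.
  + by move=> q _; rewrite adde_ge0// lee_fin k0.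
  + by apply: emeasurable_funD; exact: mk.
  + by apply: (mk (fun q => psi1 q + psi2 q)); exact: C1_funD.
  + by move=> q _; rewrite -EFinD lee_fin -mulrDr -mulrDl.
- by move=> q _; rewrite lee_fin; exact: k0.
- exact: mk.
- by move=> q _; rewrite lee_fin; exact: k0.
- exact: mk.
Qed.

(** The bound is asked for all products [f * psi], because in the composition law the bound for [f2]
    is applied to [(1 - f1) * psi]. *)
Lemma bounded_cutoff (K : set M) eta : 0 < eta -> compact K -> exists f : M -> R,
  [/\ C1_fun f, forall q, 0 <= f q <= 1, forall q, K q -> f q = 1 &
    forall psi, C1_fun psi -> (forall q, 0 <= psi q) -> bounded eta (fun q => f q * psi q)].
Proof.
move=> eta0; apply: compact_cutoff.
- move=> psi pC p0.
  have -> : (fun q => 0 * psi q) = (fun=> 0) by apply/funext => q; rewrite mul0r.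
  have f0 q : flux (fun=> 0) q = 0.
    rewrite /flux /lie (@dfun_locally_constant _ _ _ _ 0) ?mul0r ?addr0 ?mulr0//.
      exact: chart_atP.
    exact: nearW.
  have f0' : EFin \o flux (fun=> 0) = cst 0%E by apply/funext => q /=; rewrite f0.
  split; first by rewrite f0'; exact: integrable0.
  rewrite integral0_eq ?abse0//; last by move=> q _; rewrite f0.
  by apply: integral_ge0 => q _; rewrite mul0r mulr0.
- move=> f1 f2 C1 f01 C2 f02 P1 P2 psi pC p0.
  have -> : (fun q => (f1 q + (1 - f1 q) * f2 q) * psi q) =
      (fun q => f1 q * psi q + f2 q * ((1 - f1 q) * psi q)).
    by apply/funext => q; ring.
  have C3 : C1_fun (fun q => (1 - f1 q) * psi q) by exact: (C1_funM (C1_funB1 C1) pC).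
  have p3 q : 0 <= (1 - f1 q) * psi q.
    by rewrite mulr_ge0// subr_ge0; have /andP[] := f01 q.
  apply: (boundedD eta0 (C1_funM C1 pC) (C1_funM C2 C3) _ _ (P1 _ pC p0) (P2 _ C3 p3)).
  + by move=> q; rewrite mulr_ge0//; have /andP[] := f01 q.
  + by move=> q; rewrite mulr_ge0//; have /andP[] := f02 q.
move=> p; have pp : dom (chart_at p) p by exact: chart_atP.
have [U pU HU] := local_weak_bound X hmu pp eta0.
have [r' r'0 r'U] := chart_closed_ball pp pU.
exists [set q | U q /\ (dom (chart_at p) q /\ `|coord (chart_at p) q - coord (chart_at p) p| < r')].
  apply: filterI => //; apply: filterI; first by apply: open_nbhs_nbhs; split => //; exact: dom_open.
  apply: (@Defs.coord_continuous _ _ M _ p pp [set x : 'rV[R]_n | `|x - coord (chart_at p) p| < r']).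
  by apply/nbhs_ballP; exists r' => // x; rewrite -ball_normE /= distrC.
move=> i f r ip r0 C1 f01 rU fs psi pC p0.
have fs' q : f q * psi q != 0 ->
    dom (chart_at p) q /\ `|coord (chart_at p) q - coord (chart_at p) p| <= r'.
  rewrite mulf_eq0 negb_or => /andP[/fs[iq /rU[_]]]; rewrite coordK//.
  by move=> [_ [pq /ltW]].
apply: (HU (divergence g X) (fun q => f q * psi q) phi r' lip C r'0).
- exact: (C1_funM C1 pC).
- by move=> q; rewrite mulr_ge0//; have /andP[] := f01 q.
- exact: r'U.
- exact: fs'.
- by move=> q /fs'[cq _]; rewrite (divergence_chart _ hmu cq).
- exact: cphi.
- exact: phiC.
- exact: lip0.
- exact: philip.
Qed.

(** The test function is [f * chi]. The cutoff [f] is built after [eta], since the neighborhoods of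
    the local bound depend on [eta], so its integral cannot serve to choose [eta]; that of [chi]
    can, and [eta * \int chi <= 1] is the [+ 1]. *)
Lemma integral_divergence_bound (K : set M) : compact K -> (forall q, phi q != 0 -> K q) ->
  mu.-integrable setT (EFin \o (fun q : borel M => phi q * divergence g X q)) /\
  (`| \int[mu]_q (phi q * divergence g X q)%:E | <=
    (2 * lip)%:E * (\int[mu]_q (field_norm g X q)%:E + 1))%E.
Proof.
move=> cK phiK; have [chi [chiC chi01 chiK chi_fin]] := finite_cutoff cK.
have chi0 q : 0 <= chi q by have /andP[] := chi01 q.
have chi_ge0 : (0 <= \int[mu]_q (chi q)%:E)%E by apply: integral_ge0 => q _; rewrite lee_fin.
pose c := fine (\int[mu]_q (chi q)%:E).
have cE : (\int[mu]_q (chi q)%:E = c%:E)%E by rewrite fineK// ge0_fin_numE.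
have c0 : 0 <= c by rewrite fine_ge0.
have eta0 : 0 < (1 + c)^-1 by rewrite invr_gt0 ltr_pwDl.
have [f [fC f01 fK fB]] := bounded_cutoff eta0 cK.
have [iB bB] := fB chi chiC chi0.
have fluxE q : flux (fun q => f q * chi q) q = phi q * divergence g X q.
  rewrite /flux; have [->|phiq] := eqVneq (phi q) 0; first by rewrite !mul0r.
  rewrite fK ?chiK ?mul1r//; [|exact: phiK..].
  rewrite /lie (@dfun_locally_constant _ _ _ _ 1) ?addr0//; first exact: chart_atP.
  (* The set where [phi] is nonzero is open and contained in [K], so [f * chi] is constantly 1
     around [q] and its derivative along [X] vanishes. *)
  have : \forall x \near q, phi x != 0.
    by apply: (cvgr_neq0 (phi q)) => //; exact: cphi.
  by apply: filterS => x /phiK Kx; rewrite fK// chiK// mulr1.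
have fluxE' : EFin \o flux (fun q => f q * chi q) =
    EFin \o (fun q : borel M => phi q * divergence g X q).
  by apply/funext => q /=; rewrite fluxE.
split; first by rewrite -fluxE'.
have -> : (\int[mu]_q (phi q * divergence g X q)%:E =
    \int[mu]_q (flux (fun q => f q * chi q) q)%:E)%E.
  by apply: eq_integral => q _; rewrite fluxE.
apply: le_trans bB _.
have mchi := borel_measurable_continuous (C1_fun_continuous chiC).
have mf := borel_measurable_continuous (C1_fun_continuous fC).
apply: (@le_trans _ _ (\int[mu]_q ((2 * lip)%:E *
    ((field_norm g X q)%:E + ((1 + c)^-1)%:E * (chi q)%:E)))%E).
  apply: ge0_le_integral => //.
  + move=> q _; rewrite lee_fin !mulr_ge0//; first by have /andP[] := f01 q.
    by rewrite addr_ge0 ?sqrtr_ge0// ltW.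
  + apply/measurable_EFinP; apply: measurable_funM => //; apply: measurable_funM.
      exact: measurable_funM.
    exact: measurable_funD.
  + apply: measurable_funeM; apply: emeasurable_funD; first exact/measurable_EFinP.
    by apply: measurable_funeM; exact/measurable_EFinP.
  move=> q _.
  suff : 2 * lip * (f q * chi q * (field_norm g X q + (1 + c)^-1)) <=
    2 * lip * (field_norm g X q + (1 + c)^-1 * chi q) by rewrite -lee_fin.
  rewrite ler_wpM2l ?mulr_ge0//.
  have N0 : 0 <= field_norm g X q by exact: sqrtr_ge0.
  have fc : 0 <= f q * chi q <= chi q.
    by have /andP[f0 f1] := f01 q; rewrite mulr_ge0//= ler_piMl.
  rewrite mulrDr [X in _ + X]mulrC lerD//.
    rewrite ler_piMl//; have /andP[_ fcle] := fc; apply: le_trans fcle _.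
    by have /andP[] := chi01 q.
  by have /andP[_ fcle] := fc; rewrite ler_wpM2l//; exact: ltW.
rewrite ge0_integralZl//.
- rewrite lee_wpmul2l// ?lee_fin ?mulr_ge0//.
  rewrite ge0_integralD//.
  + rewrite leeD2l// ge0_integralZl//; last 3 first.
    * exact/measurable_EFinP.
    * by move=> q _; rewrite lee_fin.
    * by rewrite lee_fin ltW.
    by rewrite cE -EFinM lee_fin mulrC ler_pdivrMr ?ltr_pwDl// mul1r lerDr.
  + by move=> q _; rewrite lee_fin sqrtr_ge0.
  + exact/measurable_EFinP.
  + by move=> q _; rewrite -EFinM lee_fin mulr_ge0// ltW.
  + by apply: measurable_funeM; exact/measurable_EFinP.
- apply: emeasurable_funD; first exact/measurable_EFinP.
  by apply: measurable_funeM; exact/measurable_EFinP.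
- move=> q _; rewrite adde_ge0// ?lee_fin ?sqrtr_ge0//.
  by rewrite mulr_ge0// ltW.
- by rewrite lee_fin mulr_ge0.
Qed.

End Fixed.
End GlobalBound.

(** * Lipschitz cutoff by the distance to a point *)

Section DistanceCutoff.
Context {R : realType} {n : nat} {M : oriented_manifold R n}.
Variables (g : riemannian_metric M) (p0 : M).
Local Notation d := (riemannian_dist g).

(** Points of the other connected components are at distance [+oo] and get the value 0, which keeps
    the function continuous. *)
Definition dist_cutoff (eps : R) (q : M) : R :=
  if d p0 q is r%:E then Num.max 0 (1 - eps * r) else 0.

Lemma dist_cutoff_ge0 eps q : 0 <= dist_cutoff eps q.
Proof. by rewrite /dist_cutoff; case: (d p0 q) => [r||]//; rewrite le_max lexx. Qed.

Lemma dist_cutoff_le1 eps q : 0 <= eps -> dist_cutoff eps q <= 1.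
Proof.
move=> eps0; rewrite /dist_cutoff; have := dist_ge0 g p0 q.
case: (d p0 q) => [r||]//; rewrite lee_fin => r0.
by rewrite ge_max ler01 gerBl mulr_ge0.
Qed.

Lemma dist_cutoff_support eps q : 0 < eps -> dist_cutoff eps q != 0 -> (d p0 q < eps^-1%:E)%E.
Proof.
move=> eps0; rewrite /dist_cutoff; case: (d p0 q) => [r||]; rewrite ?eqxx// lte_fin.
rewrite -[eps^-1]mul1r ltr_pdivlMr// [r * _]mulrC => H.
by rewrite ltNge; apply: contra H => er; apply/eqP/max_idPl; rewrite subr_le0.
Qed.

Lemma dist_cutoff_ge_half eps q : 0 <= eps -> eps <= 1 -> (d p0 q < (2^-1)%:E)%E ->
  2^-1 <= dist_cutoff eps q.
Proof.
move=> eps0 eps1; rewrite /dist_cutoff; have := dist_ge0 g p0 q.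
case: (d p0 q) => [r||]//; rewrite lee_fin lte_fin => r0 r2.
by rewrite le_max; apply/orP; right; nra.
Qed.

(** A finite bound on [d q q'] makes the distances from [p0] to [q] and [q'] both finite or both
    infinite; in the second case both values are 0. *)
Lemma dist_cutoff_lipschitz eps q q' e : 0 <= eps -> (d q q' <= e%:E)%E ->
  `|dist_cutoff eps q - dist_cutoff eps q'| <= eps * e.
Proof.
move=> eps0 qe; have e0 : 0 <= e by rewrite -lee_fin (le_trans (dist_ge0 g q q')).
have t1 := dist_triangle g p0 q q'; have t2 := dist_triangle g p0 q' q.
rewrite (dist_sym g q' q) in t2.
have {}t1 := le_trans t1 (leeD2l _ qe); have {}t2 := le_trans t2 (leeD2l _ qe).
have := dist_ge0 g p0 q; have := dist_ge0 g p0 q'; rewrite /dist_cutoff.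
move: t1 t2; case: (d p0 q) => [r||]; case: (d p0 q') => [r'||]//=.
  rewrite -!EFinD !lee_fin => t1 t2 _ _.
  have : eps * r' <= eps * (r + e) by rewrite ler_wpM2l.
  have : eps * r <= eps * (r' + e) by rewrite ler_wpM2l.
  have : 0 <= eps * e by rewrite mulr_ge0.
  rewrite !mulrDr => h0 h1 h2; rewrite ler_norml.
  by case: (leP 0 (1 - eps * r)) => ?; case: (leP 0 (1 - eps * r')) => ?; apply/andP; split; lra.
by rewrite subrr normr0 mulr_ge0.
Qed.

Lemma dist_cutoff_continuous eps : 0 <= eps -> continuous (dist_cutoff eps).
Proof.
move=> eps0 q; apply/cvgrPdist_lt => e e0.
have e1 : 0 < e / (eps + 1) by rewrite divr_gt0// ltr_wpDl.
have := dist_ball_nbhs g q e1; apply: filterS => q' /ltW qq'.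
apply: le_lt_trans (dist_cutoff_lipschitz eps0 qq') _.
by rewrite mulrCA gtr_pMr// ltr_pdivrMr ?ltr_wpDl// mul1r ltrDl.
Qed.

End DistanceCutoff.

(** * Contradiction at a point where the divergence does not vanish *)

Theorem proposition2p1 (R : realType) (n : nat) (M : oriented_manifold R n)
    (g : riemannian_metric M) (X : vector_field M)
    (mu : {measure set (borel M) -> \bar R})
    (hmu : is_riemannian_volume g mu)
    (hcomplete : complete_metric g)
    (hnoncompact : ~ compact [set: M])
    (hsign : (forall p : M, 0 <= divergence g X p) \/
             (forall p : M, divergence g X p <= 0))
    (hL1 : mu.-integrable [set: borel M] (fun p => (field_norm g X p)%:E)) :
  forall p : M, divergence g X p = 0.
Proof.
move=> p0; apply/eqP/negPn/negP => div0.
pose D := divergence g X.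
have cD : continuous D by exact: (divergence_continuous hmu).
(* The sign hypothesis as a single identity, so that both cases are treated together. *)
have [s s1 sD] : exists2 s : R, `|s| = 1 & forall q, D q = s * `|D q|.
  case: hsign => h; [exists 1|exists (-1)]; rewrite ?normrN ?normr1// => q.
    by rewrite ger0_norm ?mul1r.
  by rewrite ler0_norm// mulN1r opprK.
have N0 q : 0 <= field_norm g X q by exact: sqrtr_ge0.
have I0 : (0 <= \int[mu]_q (field_norm g X q)%:E)%E.
  by apply: integral_ge0 => q _; rewrite lee_fin.
pose I := fine (\int[mu]_q (field_norm g X q)%:E).
have IE : (\int[mu]_q (field_norm g X q)%:E = I%:E)%E.
  by rewrite fineK//; exact: integrable_fin_num.
have I1 : 0 < I + 1 by rewrite ltr_wpDl// fine_ge0.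
have D0 : 0 < `|D p0| by rewrite normr_gt0.
have [V [oV Vp VU /andP[V0 V1]]] : exists V : set M, [/\ open V, V p0,
    V `<=` [set q | `|D p0| / 2 < `|D q| /\ (riemannian_dist g p0 q < (2^-1)%:E)%E] &
    (0 < mu V < +oo)%E].
  apply: (volume_nbhs hmu); apply: filterI.
    apply: near_gt_continuous; last by rewrite ltr_pdivrMr// ltr_pMr// ltr1n.
    by apply: continuous_comp; [exact: cD|exact: norm_continuous].
  by apply: dist_ball_nbhs; rewrite invr_gt0.
have mV : measurable (V : set (borel M)) by exact: borel_open_measurable.
pose v := fine (mu V).
have vE : mu V = v%:E by rewrite fineK// ge0_fin_numE// ltW.
have v0 : 0 < v by rewrite -lte_fin -vE.
(* A lower bound for the integral of [phi * |D|] that does not depend on [eps]: on [V] one has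
   [|D| > |D p0| / 2] and, as [eps <= 1], also [phi >= 1 / 2]. *)
pose c := `|D p0| / 4 * v.
have c0 : 0 < c by rewrite mulr_gt0// divr_gt0.
(* The second term brings the upper bound [2 * eps * (I + 1)] down to [c / 2], below the lower bound
   [c]. *)
pose eps := Num.min 1 (c / (4 * (I + 1))).
have eps0 : 0 < eps by rewrite lt_min ltr01 divr_gt0// mulr_gt0.
have eps1 : eps <= 1 by rewrite ge_min lexx.
have epsc : 2 * eps * (I + 1) <= c / 2.
  have : eps <= c / (4 * (I + 1)) by rewrite ge_min lexx orbT.
  by rewrite ler_pdivlMr ?mulr_gt0// => h; lra.
pose phi := dist_cutoff g p0 eps.
have phi0 q : 0 <= phi q by exact: dist_cutoff_ge0.
have [K cK HK] := complete_relatively_compact_ball hcomplete p0 eps^-1.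
have phi1 q : `|phi q| <= 1 by rewrite ger0_norm// dist_cutoff_le1// ltW.
have philip q q' e : (riemannian_dist g q q' <= e%:E)%E -> `|phi q - phi q'| <= eps * e.
  by apply: dist_cutoff_lipschitz; exact: ltW.
have phiK q : phi q != 0 -> K q by move=> h; apply: HK; exact: (dist_cutoff_support eps0 h).
have cphi : continuous phi by apply: dist_cutoff_continuous; exact: ltW.
have [iphi] := integral_divergence_bound hmu hL1 cphi phi1 (ltW eps0) philip cK phiK.
apply/negP; rewrite -ltNge IE -EFinD -EFinM.
have mphi : measurable_fun [set: borel M] (fun q : borel M => phi q * `|D q|).
  apply: measurable_funM; first exact: borel_measurable_continuous.
  by apply: measurableT_comp => //; exact: borel_measurable_continuous.
have iphi' : mu.-integrable setT (EFin \o (fun q : borel M => phi q * `|D q|)).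
  apply: (le_integrable measurableT _ _ iphi); first exact/measurable_EFinP.
  by move=> q _ /=; rewrite lee_fin !normrM normr_id.
have -> : (`|\int[mu]_q (phi q * divergence g X q)%:E| = \int[mu]_q (phi q * `|D q|)%:E)%E.
  transitivity (`|s%:E * \int[mu]_q (phi q * `|D q|)%R%:E|)%E.
    rewrite -integralZl//; congr (`| _ |)%E; apply: eq_integral => q _.
    by rewrite -EFinM -/(D q) sD; congr EFin; rewrite mulrCA normrM s1 mul1r normr_id.
  rewrite abseM /= s1 mul1e gee0_abs//.
  by apply: integral_ge0 => q _; rewrite lee_fin mulr_ge0.
apply: (@lt_le_trans _ _ c%:E); first by rewrite lte_fin; apply: le_lt_trans epsc _; lra.
apply: (@le_trans _ _ (\int[mu]_(q in V) (`|D p0| / 4)%:E)%E).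
  by rewrite integral_cst// vE -EFinM.
apply: (@le_trans _ _ (\int[mu]_(q in V) (phi q * `|D q|)%:E)%E); last first.
  apply: ge0_subset_integral => //; first exact/measurable_EFinP.
  by move=> q _; rewrite lee_fin mulr_ge0.
apply: ge0_le_integral => //.
  by apply: measurable_funTS; exact/measurable_EFinP.
move=> q /VU[Dq dq]; rewrite lee_fin.
have := dist_cutoff_ge_half (ltW eps0) eps1 dq; rewrite -/(phi q) => pq.
have : 2^-1 * (`|D p0| / 2) <= phi q * `|D q|.
  by apply: ler_pM => //; exact: ltW.
lra.
Qed.
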